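(* Let $n\ge 1$, $r\ge 1$, $d\ge 1$ be integers and let $\lambda_1,\ldots,\lambda_r\in\mathbb{Z}^n$ be (dominant) weights of $\mathfrak{gl}_n$. Then the tensor product $\mathcal{T}_{\lambda_1,\ldots,\lambda_r}:=\mathcal{T}_{\lambda_1}\otimes\cdots\otimes\mathcal{T}_{\lambda_r}$ of modules of tensor fields is a noetherian module over the Lie algebra $\mathsf{L}_1^{\oplus n}$, acting through the embedding $\mathsf{L}_1^{\oplus n}\hookrightarrow \mathsf{L}_d^{\mathrm{pol}}(n)\subset\mathcal{W}_n^{\mathrm{pol}}$ which sends the basis element $e_k$ of the $m$-th copy of $\mathsf{L}_1$ to $\frac1d x_m^{dk+1}\partial_m$ ($k\ge1$, $1\le m\le n$). In particular, $\mathcal{T}_{\lambda_1,\ldots,\lambda_r}$ is a noetherian $\mathsf{L}_d^{\mathrm{pol}}(n)$-module.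
   Context: $\Bbbk$ is a field of characteristic $0$. $\mathcal{W}_n^{\mathrm{pol}}$ is the Lie algebra of polynomial vector fields $\sum_{i=1}^n f_i\partial_i$, $f_i\in\Bbbk[x_1,\ldots,x_n]$, $\partial_i=\partial/\partial x_i$. For $d\ge 0$, $\mathsf{L}_d^{\mathrm{pol}}(n)\subset\mathcal{W}_n^{\mathrm{pol}}$ is the Lie subalgebra of those vector fields all of whose coefficients $f_i$ have only monomials of degree $\ge d+1$. $\mathsf{L}_1$ is the Lie algebra with basis $e_k=z^{k+1}\frac{d}{dz}$, $k\ge1$, and bracket $[e_k,e_m]=(m-k)e_{k+m}$; $\mathsf{L}_1^{\oplus n}$ is the direct sum of $n$ copies of it. For a dominant weight $\lambda=(\lambda^{(1)}\ge\cdots\ge\lambda^{(n)})\in\mathbb{Z}^n$ let $V_\lambda$ be the finite-dimensional irreducible $\mathfrak{gl}_n$-module of highest weight $\lambda$. The matrix unit $E_{ij}$ corresponds to the linear vector field $x_i\partial_j$. The module of tensor fields $\mathcal{T}_\lambda$ is the (polynomial) module coinduced from $V_\lambda$, on which linear vector fields act via $\mathfrak{gl}_n$ and $\mathsf{L}_1^{\mathrm{pol}}(n)$ acts by zero. Explicitly, $\mathcal{T}_\lambda=\Bbbk[x_1,\ldots,x_n]\otimes V_\lambda$ with action $$\Big(\sum_j f_j\partial_j\Big)\cdot(g\otimes v)=\sum_j f_j\,\partial_j g\otimes v+\sum_{i,j}(\partial_i f_j)\,g\otimes E_{ij}v .$$ A Lie algebra acts on a tensor product of modules by the Leibniz rule.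 A module over a Lie algebra is noetherian if every submodule is finitely generated (equivalently, it satisfies the ascending chain condition on submodules). *)

(* Defs.v *)
From HB Require Import structures.
From mathcomp Require Import all_boot all_order all_algebra.
From mathcomp Require Import ring_quotient boolp ring.
From mathcomp.multinomials Require Import freeg mpoly.

Set Implicit Arguments.
Unset Strict Implicit.
Unset Printing Implicit Defensive.

Import GRing.Theory.
Local Open Scope ring_scope.

HB.mixin Record isLieAlgebra (K : fieldType) L of GRing.Lmodule K L := {
  lieb : L -> L -> L;
  lieb_linearl : forall y, linear (lieb ^~ y);
  lieb_linearr : forall x, linear (lieb x);
  lieb_alt : forall x, lieb x x = 0;
  lieb_jacobi : forall x y z,
    lieb x (lieb y z) + lieb y (lieb z x) + lieb z (lieb x y) = 0
}.

#[short(type="lieAlgType")]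
HB.structure Definition LieAlgebra (K : fieldType) :=
  { L of isLieAlgebra K L & GRing.Lmodule K L }.

Section LieTheory.
Context {K : fieldType}.

Record lieHom (L L' : lieAlgType K) := LieHom {
  hom_fun :> L -> L';
  hom_linear : linear hom_fun;
  hom_lieb : forall x y, hom_fun (lieb x y) = lieb (hom_fun x) (hom_fun y)
}.

Record lieAction (L : lieAlgType K) (M : lmodType K) := LieAction {
  act_fun :> L -> M -> M;
  act_linearl : forall m, linear (act_fun ^~ m);
  act_linearr : forall x, linear (act_fun x);
  act_lieb : forall x y m,
    act_fun (lieb x y) m = act_fun x (act_fun y m) - act_fun y (act_fun x m)
}.

Section Restriction.
Variables (L L' : lieAlgType K) (M : lmodType K).
Variables (f : lieHom L' L) (a : lieAction L M).

Definition restrict_fun (x : L') (m : M) : M := a (f x) m.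

Fact restrict_linearl m : linear (restrict_fun ^~ m).
Proof. by move=> c x y; rewrite /restrict_fun hom_linear act_linearl. Qed.

Fact restrict_linearr x : linear (restrict_fun x).
Proof. exact: act_linearr. Qed.

Fact restrict_lieb x y m : restrict_fun (lieb x y) m
  = restrict_fun x (restrict_fun y m) - restrict_fun y (restrict_fun x m).
Proof. by rewrite /restrict_fun hom_lieb act_lieb. Qed.

Definition lie_restrict : lieAction L' M :=
  LieAction restrict_linearl restrict_linearr restrict_lieb.
End Restriction.

Section Submodules.
Variables (L : lieAlgType K) (M : lmodType K) (a : lieAction L M).

Definition lie_submodule (N : M -> Prop) : Prop :=
  [/\ N 0,
      forall c u v, N u -> N v -> N (c *: u + v)
    & forall x u, N u -> N (a x u)].

Definition lie_fin_gen (N : M -> Prop) : Prop :=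
  exists s : seq M, (forall u, u \in s -> N u) /\
    forall N' : M -> Prop, lie_submodule N' ->
      (forall u, u \in s -> N' u) -> forall u, N u -> N' u.

Definition lie_noetherian : Prop :=
  forall N : M -> Prop, lie_submodule N -> lie_fin_gen N.

Definition lie_irreducible : Prop :=
  (exists v : M, v != 0) /\
  forall N : M -> Prop, lie_submodule N ->
    (forall u, N u -> u = 0) \/ (forall u, N u).
End Submodules.

End LieTheory.

Definition gl (K : fieldType) (n : nat) := 'M[K]_n.

Section Gl.
Variables (K : fieldType) (n : nat).

HB.instance Definition _ := GRing.Lmodule.on (gl K n).

Definition gl_lieb (A B : gl K n) : gl K n := A *m B - B *m A.

Fact gl_linearl B : linear (gl_lieb ^~ B).
Proof.
move=> c A A'; rewrite /gl_lieb mulmxDl mulmxDr -scalemxAl -scalemxAr.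
by rewrite scalerBr opprD addrACA.
Qed.

Fact gl_linearr A : linear (gl_lieb A).
Proof.
move=> c B B'; rewrite /gl_lieb mulmxDl mulmxDr -scalemxAl -scalemxAr.
by rewrite scalerBr opprD addrACA.
Qed.

Fact gl_alt A : gl_lieb A A = 0.
Proof. exact: subrr. Qed.

Fact gl_jacobi A B C :
  gl_lieb A (gl_lieb B C) + gl_lieb B (gl_lieb C A) + gl_lieb C (gl_lieb A B)
  = 0.
Proof.
rewrite /gl_lieb !(mulmxBl, mulmxBr, mulmxA) !opprB.
set a := A *m B *m C; set b := A *m C *m B; set c := B *m C *m A.
set d := C *m B *m A; set e := B *m A *m C; set f := C *m A *m B.
apply/matrixP=> i j; rewrite !mxE; ring.
Qed.

HB.instance Definition _ := isLieAlgebra.Build K (gl K n)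
  gl_linearl gl_linearr gl_alt gl_jacobi.

Definition gl_std_fun (A : gl K n) (v : 'cV[K]_n) : 'cV[K]_n := A *m v.

Fact gl_std_linearl v : linear (gl_std_fun ^~ v).
Proof. by move=> c A B; rewrite /gl_std_fun mulmxDl -scalemxAl. Qed.

Fact gl_std_linearr A : linear (gl_std_fun A).
Proof. by move=> c u v; rewrite /gl_std_fun mulmxDr -scalemxAr. Qed.

Fact gl_std_lieb A B v : gl_std_fun (lieb A B) v
  = gl_std_fun A (gl_std_fun B v) - gl_std_fun B (gl_std_fun A v).
Proof. by rewrite /gl_std_fun /lieb /= /gl_lieb mulmxBl !mulmxA. Qed.

Definition gl_std : lieAction (gl K n) 'cV[K]_n :=
  LieAction gl_std_linearl gl_std_linearr gl_std_lieb.

End Gl.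

(* A homomorphism rho : gl_n -> gl_m makes K^m a gl_n-module of dimension m;  *)
(* every finite-dimensional gl_n-module is of this form in a basis.           *)
Definition gl_module (K : fieldType) (n m : nat) (rho : lieHom (gl K n) (gl K m))
  : lieAction (gl K n) 'cV[K]_m := lie_restrict rho (gl_std K m).

Definition dominant (n : nat) (lam : 'I_n -> int) : Prop :=
  forall i j : 'I_n, (i <= j)%N -> (lam j <= lam i)%R.

(* K^m, with gl_n acting through rho, is V_lam: it is irreducible and has a   *)
(* nonzero vector of weight lam killed by the E_ij with i < j.                *)
Definition is_V (K : fieldType) (n m : nat) (lam : 'I_n -> int)
    (rho : lieHom (gl K n) (gl K m)) : Prop :=
  lie_irreducible (gl_module rho) /\
  exists v : 'cV[K]_m,
    [/\ v != 0,
        forall i j : 'I_n, (i < j)%N -> gl_module rho (delta_mx i j) v = 0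
      & forall i : 'I_n, gl_module rho (delta_mx i i) v = (lam i)%:~R *: v].

(* X : vfield K n stands for the vector field \sum_j X j \partial_j. *)
Definition vfield (K : fieldType) (n : nat) := {ffun 'I_n -> {mpoly K[n]}}.

Section VectorFields.
Variables (K : fieldType) (n : nat).
Implicit Types (X Y Z : vfield K n) (f g : {mpoly K[n]}).

HB.instance Definition _ := GRing.Lmodule.on (vfield K n).

Definition vf_der X f : {mpoly K[n]} := \sum_(j < n) X j * mderiv j f.

Lemma vf_der_is_linear X : linear (vf_der X).
Proof.
move=> c f g; rewrite /vf_der scaler_sumr -big_split; apply: eq_bigr => j _ /=.
by rewrite linearP mulrDr scalerAr.
Qed.

HB.instance Definition _ X :=
  GRing.isLinear.Build K {mpoly K[n]} {mpoly K[n]} _ (vf_der X)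
    (vf_der_is_linear X).

Lemma vf_derP c X Y f : vf_der (c *: X + Y) f = c *: vf_der X f + vf_der Y f.
Proof.
rewrite /vf_der scaler_sumr -big_split; apply: eq_bigr => j _ /=.
by rewrite !ffunE mulrDl scalerAl.
Qed.

Lemma vf_derM X f g : vf_der X (f * g) = vf_der X f * g + f * vf_der X g.
Proof.
rewrite /vf_der mulr_suml mulr_sumr -big_split; apply: eq_bigr => j _ /=.
by rewrite mderivM; ring.
Qed.

Definition vf_lieb X Y : vfield K n :=
  [ffun j => vf_der X (Y j) - vf_der Y (X j)].

Lemma vf_der_lieb X Y f :
  vf_der (vf_lieb X Y) f = vf_der X (vf_der Y f) - vf_der Y (vf_der X f).
Proof.
have E A B : vf_der A (vf_der B f) = \sum_j vf_der A (B j) * mderiv j f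
    + \sum_j \sum_i A i * B j * mderiv i (mderiv j f).
  rewrite {2}/vf_der linear_sum -big_split; apply: eq_bigr => j _ /=.
  rewrite vf_derM; congr (_ + _); rewrite /vf_der mulr_sumr.
  by apply: eq_bigr => i _; ring.
rewrite !E opprD addrACA [X in _ + (X - _)]exchange_big /=.
rewrite [X in _ + (X - _)](_ : _ =
    \sum_j \sum_i Y i * X j * mderiv i (mderiv j f)); last first.
  by apply: eq_bigr => i _; apply: eq_bigr => j _; rewrite mderiv_comm; ring.
rewrite subrr addr0 -sumrB; apply: eq_bigr => j _.
by rewrite !ffunE mulrBl.
Qed.

Fact vf_linearl Y : linear (vf_lieb ^~ Y).
Proof.
move=> c X X'; apply/ffunP=> j; rewrite !ffunE vf_derP linearP /=.
by rewrite scalerBr opprD addrACA.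
Qed.

Fact vf_linearr X : linear (vf_lieb X).
Proof.
move=> c Y Y'; apply/ffunP=> j; rewrite !ffunE vf_derP linearP /=.
by rewrite scalerBr opprD addrACA.
Qed.

Fact vf_alt X : vf_lieb X X = 0.
Proof. by apply/ffunP=> j; rewrite !ffunE subrr. Qed.

Fact vf_jacobi X Y Z :
  vf_lieb X (vf_lieb Y Z) + vf_lieb Y (vf_lieb Z X) + vf_lieb Z (vf_lieb X Y)
  = 0.
Proof.
apply/ffunP=> j; rewrite !ffunE !vf_der_lieb !linearB /=; ring.
Qed.

HB.instance Definition _ := isLieAlgebra.Build K (vfield K n)
  vf_linearl vf_linearr vf_alt vf_jacobi.

End VectorFields.

Section Ld.
Variables (K : fieldType) (n d : nat).

Definition in_Ld : {pred vfield K n} := fun X =>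
  [forall j, all (fun mu : 'X_{1..n} => d.+1 <= mdeg mu)%N (msupp (X j))].

Lemma in_LdP (X : vfield K n) :
  reflect (forall j mu, mu \in msupp (X j) -> (d.+1 <= mdeg mu)%N)
          (X \in in_Ld).
Proof.
apply: (iffP forallP) => [h j mu|h j]; first by move/(allP (h j)).
by apply/allP => mu; apply: h.
Qed.

Fact in_Ld_submod : submod_closed in_Ld.
Proof.
split=> [|c X Y /in_LdP hX /in_LdP hY].
  by apply/in_LdP => j mu; rewrite ffunE msupp0.
apply/in_LdP => j mu; rewrite !ffunE => /msuppD_le; rewrite mem_cat.
by case/orP=> [/msuppZ_le|]; [apply: hX | apply: hY].
Qed.

HB.instance Definition _ :=
  GRing.isSubmodClosed.Build K (vfield K n) in_Ld in_Ld_submod.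

Fact in_Ld_lieb X Y : X \in in_Ld -> Y \in in_Ld -> lieb X Y \in in_Ld.
Proof.
have der A f mu : A \in in_Ld -> (forall nu, nu \in msupp f -> d < mdeg nu)%N ->
    mu \in msupp (vf_der A f) -> (d < mdeg mu)%N.
  move=> /in_LdP hA hf; rewrite /vf_der.
  move/msupp_sum_le => /flattenP [s /mapP [j _ ->]].
  move/msuppM_le => /allpairsP [[m1 m2] /= [/hA h1 h2 ->]].
  by rewrite mdegD (leq_trans h1) // leq_addr.
move=> hX hY; apply/in_LdP => j mu; rewrite ffunE => /msuppB_le.
rewrite mem_cat => /orP[]; apply: der => // nu.
  by move: hY => /in_LdP; apply.
by move: hX => /in_LdP; apply.
Qed.

Record Ld := MkLd { Ld_val : vfield K n; Ld_valP : Ld_val \in in_Ld }.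

HB.instance Definition _ := [isSub for Ld_val].
HB.instance Definition _ := [Choice of Ld by <:].
HB.instance Definition _ := [SubChoice_isSubLmodule of Ld by <:].

Definition Ld_lieb (X Y : Ld) : Ld := MkLd (in_Ld_lieb (Ld_valP X) (Ld_valP Y)).

Fact Ld_val_is_linear : linear Ld_val.
Proof. exact: (linearP (val : Ld -> vfield K n)). Qed.

Fact Ld_linearl Y : linear (Ld_lieb ^~ Y).
Proof.
move=> c X X'; apply: val_inj.
by rewrite /= lieb_linearl.
Qed.

Fact Ld_linearr X : linear (Ld_lieb X).
Proof.
move=> c Y Y'; apply: val_inj.
by rewrite /= lieb_linearr.
Qed.

Fact Ld_alt X : Ld_lieb X X = 0.
Proof. by apply: val_inj; rewrite /= lieb_alt. Qed.

Fact Ld_jacobi X Y Z :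
  Ld_lieb X (Ld_lieb Y Z) + Ld_lieb Y (Ld_lieb Z X) + Ld_lieb Z (Ld_lieb X Y)
  = 0.
Proof. by apply: val_inj; rewrite /= lieb_jacobi. Qed.

HB.instance Definition _ := isLieAlgebra.Build K Ld
  Ld_linearl Ld_linearr Ld_alt Ld_jacobi.

Definition Ld_incl : lieHom Ld (vfield K n) :=
  @LieHom K Ld (vfield K n) Ld_val Ld_val_is_linear (fun _ _ => erefl).

End Ld.

(* p : L1 K stands for z^2 p(z) d/dz, so that e_k = z^(k+1) d/dz is X^(k-1).  *)
Definition L1 (K : fieldType) := {poly K}.

Section L1.
Variable K : fieldType.

HB.instance Definition _ := GRing.Lmodule.on (L1 K).

Definition L1_e (k : nat) : L1 K := 'X^(k.-1).

(* z^2 p (z^2 q)' - z^2 q (z^2 p)' = z^2 (z^2 (p q' - p' q)) *)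
Definition L1_lieb (p q : {poly K}) : {poly K} :=
  'X^2 * (p * q^`() - p^`() * q).

Fact L1_linearl q : linear (L1_lieb ^~ q).
Proof.
by move=> c p p'; rewrite /L1_lieb derivD derivZ -!mul_polyC; ring.
Qed.

Fact L1_linearr p : linear (L1_lieb p).
Proof.
by move=> c q q'; rewrite /L1_lieb derivD derivZ -!mul_polyC; ring.
Qed.

Fact L1_alt p : L1_lieb p p = 0.
Proof. by rewrite /L1_lieb; ring. Qed.

Fact L1_jacobi p q s :
  L1_lieb p (L1_lieb q s) + L1_lieb q (L1_lieb s p) + L1_lieb s (L1_lieb p q)
  = 0.
Proof.
by rewrite /L1_lieb !(derivM, derivB, derivXn) /=; ring.
Qed.

HB.instance Definition _ := isLieAlgebra.Build K (L1 K)
  L1_linearl L1_linearr L1_alt L1_jacobi.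

Lemma L1_lieb_e (k l : nat) : (0 < k)%N -> (0 < l)%N ->
  lieb (L1_e k) (L1_e l) = (l%:R - k%:R) *: L1_e (k + l).
Proof.
case: k l => [|k] [|l] // _ _.
apply: etrans (_ : L1_lieb 'X^k 'X^l = _) _ => //.
have E m : 'X * ('X^m)^`() = m%:R *: 'X^m :> {poly K}.
  by case: m => [|m]; rewrite derivXn ?scale0r ?mulr0 // scaler_nat mulrnAr exprS.
have -> : (l.+1%:R - k.+1%:R : K) = l%:R - k%:R by rewrite -!natr1; ring.
have -> : L1_lieb 'X^k 'X^l = 'X * ('X^k * ('X * ('X^l)^`())
    - ('X * ('X^k)^`()) * 'X^l) by rewrite /L1_lieb; ring.
rewrite !E -scalerAr -scalerAl -exprD -scalerBl -scalerAr -exprS.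
by rewrite /L1_e addnS.
Qed.

End L1.

Definition L1_sum (K : fieldType) (n : nat) := {ffun 'I_n -> L1 K}.

Section L1Sum.
Variables (K : fieldType) (n : nat).

HB.instance Definition _ := GRing.Lmodule.on (L1_sum K n).

Definition L1_sum_lieb (x y : L1_sum K n) : L1_sum K n :=
  [ffun m => lieb (x m) (y m)].

Fact L1_sum_linearl y : linear (L1_sum_lieb ^~ y).
Proof. by move=> c x x'; apply/ffunP=> m; rewrite !ffunE lieb_linearl. Qed.

Fact L1_sum_linearr x : linear (L1_sum_lieb x).
Proof. by move=> c y y'; apply/ffunP=> m; rewrite !ffunE lieb_linearr. Qed.

Fact L1_sum_alt x : L1_sum_lieb x x = 0.
Proof. by apply/ffunP=> m; rewrite !ffunE lieb_alt. Qed.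

Fact L1_sum_jacobi x y z :
  L1_sum_lieb x (L1_sum_lieb y z) + L1_sum_lieb y (L1_sum_lieb z x)
    + L1_sum_lieb z (L1_sum_lieb x y) = 0.
Proof. by apply/ffunP=> m; rewrite !ffunE lieb_jacobi. Qed.

HB.instance Definition _ := isLieAlgebra.Build K (L1_sum K n)
  L1_sum_linearl L1_sum_linearr L1_sum_alt L1_sum_jacobi.

Definition L1_inj (m : 'I_n) (p : L1 K) : L1_sum K n :=
  [ffun j => if j == m then p else 0].

End L1Sum.

Section Embedding.
Variables (K : fieldType) (n d : nat).
Hypothesis charK0 : [pchar K] =i pred0.
Hypothesis d_gt0 : (0 < d)%N.

(* By linearity from e_k |-> d^-1 x_m^(dk+1): as e_k is X^(k-1), X^i goes to  *)
(* d^-1 x_m^(d+1) (x_m^d)^i.                                                  *)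
Definition L1_coef (m : 'I_n) (p : {poly K}) : {mpoly K[n]} :=
  d%:R^-1 *: ('X_m ^+ d.+1 * horner_alg ('X_m ^+ d) p).

Definition L1_vf (x : L1_sum K n) : vfield K n := [ffun m => L1_coef m (x m)].

Fact L1_vf_linear : linear L1_vf.
Proof.
move=> c x y; apply/ffunP=> m; rewrite !ffunE /L1_coef linearP /=.
by rewrite mulr_algl mulrDr scalerDr -scalerAr !scalerA mulrC.
Qed.

Lemma mderiv_exp (i : 'I_n) (f : {mpoly K[n]}) k :
  mderiv i (f ^+ k) = f ^+ k.-1 *+ k * mderiv i f.
Proof.
elim: k => [|k IHk]; first by rewrite expr0 -mpolyC1 mderivC mulr0n mul0r.
rewrite exprS mderivM {}IHk mulrS mulrDl [mderiv _ _ * _]mulrC; congr (_ + _).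
by case: k => [|k]; rewrite ?mulr0n ?mul0r ?mulr0 // mulrA mulrnAr -exprS.
Qed.

Lemma mderiv_horner (i : 'I_n) (f : {mpoly K[n]}) (q : {poly K}) :
  mderiv i (horner_alg f q) = horner_alg f q^`() * mderiv i f.
Proof.
elim/poly_ind: q => [|q c IHq]; first by rewrite deriv0 !raddf0 mul0r.
rewrite derivD derivM derivX derivC addr0 mulr1.
rewrite !rmorphD !rmorphM /= !horner_algX !horner_algC.
rewrite mderivD mderivM IHq alg_mpolyC mderivC; ring.
Qed.

Lemma mderiv_var (i m : 'I_n) :
  mderiv i ('X_m : {mpoly K[n]}) = (m == i)%:R.
Proof.
rewrite mderivX mnm1E; case: eqVneq => [->|_]; last by rewrite scale0r.
by rewrite -[X in 'X_[X - _]]add0m addmK mpolyX0 scale1r.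
Qed.

Lemma d_neq0 : d%:R != 0 :> K.
Proof.
by rewrite ((pcharf0P K).1 charK0) -lt0n.
Qed.

Lemma L1_vf_lieb_aux (A : comNzRingType) (e u v w p q p' q' : A) :
  e * d%:R = 1 -> u * w = v ->
  e * ((u * v) * (v * v * (p * q' - p' * q))) =
    (e * ((u * v) * p)) * (e * (v *+ d.+1 * q + (u * v) * q' * (w *+ d)))
  - (e * ((u * v) * q)) * (e * (v *+ d.+1 * p + (u * v) * p' * (w *+ d))).
Proof.
move=> ed uw; rewrite -(mulr_natr v) -(mulr_natr w) -natr1 -uw.
move: (d%:R : A) ed => D ed.
transitivity ((e * D) * (e * ((u * (u * w)) * ((u * w) * (u * w)
  * (p * q' - p' * q))))); first by rewrite ed mul1r.
by ring.
Qed.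

Fact L1_vf_lieb x y : L1_vf (lieb x y) = lieb (L1_vf x) (L1_vf y).
Proof.
have der p j q : vf_der (L1_vf p) (L1_coef j q) = L1_coef j (p j) *
    (d%:R^-1 *: ('X_j ^+ d *+ d.+1 * horner_alg ('X_j ^+ d) q
      + 'X_j ^+ d.+1 * horner_alg ('X_j ^+ d) q^`() * ('X_j ^+ d.-1 *+ d))).
  rewrite /vf_der (bigD1 j) //= [X in _ + X]big1 => [|i ij].
    rewrite addr0 ffunE; congr (_ * _).
    rewrite /L1_coef mderivZ mderivM mderiv_horner !mderiv_exp mderiv_var eqxx.
    by rewrite !mulr1 mulrA.
  rewrite ffunE {2}/L1_coef mderivZ mderivM mderiv_horner !mderiv_exp mderiv_var.
  by rewrite eq_sym (negPf ij) !mulr0 mul0r addr0 scaler0 mulr0.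
apply/ffunP=> j; rewrite !ffunE !der.
apply: etrans (_ : L1_coef j (L1_lieb (x j) (y j)) = _) _ => //.
rewrite /L1_coef /L1_lieb !(rmorphM, rmorphB, rmorphXn) /= horner_algX.
rewrite -!(mul_mpolyC d%:R^-1) !exprS.
apply: L1_vf_lieb_aux; last by rewrite -exprS prednK.
by rewrite -mpolyC_nat -mpolyCM mulVf ?d_neq0 ?mpolyC1.
Qed.

Fact L1_vf_Ld x : L1_vf x \in @in_Ld K n d.
Proof.
apply/in_LdP => j mu; rewrite ffunE => /msuppZ_le /msuppM_le.
case/allpairsP => -[m1 m2] /= [h1 _ ->].
rewrite mdegD; move: h1; rewrite mpolyXn msuppX inE => /eqP ->.
by rewrite mdegMn mdeg1 mul1n leq_addr.
Qed.

Definition L1_emb (x : L1_sum K n) : Ld K n d := MkLd (L1_vf_Ld x).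

Fact L1_emb_linear : linear L1_emb.
Proof.
move=> c x y; apply: val_inj; rewrite /= L1_vf_linear.
by [].
Qed.

Fact L1_emb_lieb x y : L1_emb (lieb x y) = lieb (L1_emb x) (L1_emb y).
Proof. by apply: val_inj; exact: L1_vf_lieb. Qed.

Definition L1_embedding : lieHom (L1_sum K n) (Ld K n d) :=
  LieHom L1_emb_linear L1_emb_lieb.

Lemma L1_embeddingE (m : 'I_n) k : (0 < k)%N ->
  Ld_val (L1_embedding (L1_inj m (L1_e K k)))
  = [ffun j => if j == m then d%:R^-1 *: 'X_m ^+ (d * k).+1 else 0].
Proof.
case: k => // k _; apply/ffunP=> j; rewrite !ffunE; case: eqP => [->|_].
  by rewrite /L1_coef rmorphXn /= horner_algX -exprM -exprD mulnS addSn.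
by rewrite /L1_coef raddf0 mulr0 scaler0.
Qed.

Lemma mcoeff_horner_var (m : 'I_n) (p : {poly K}) (i : nat) :
  (horner_alg ('X_m ^+ d : {mpoly K[n]}) p)@_(U_(m) *+ (d * i)) = p`_i.
Proof.
rewrite -[in LHS](coefK p) poly_def !raddf_sum /=.
transitivity (\sum_(k < size p) p`_k * (k == i :> nat)%:R).
  apply: eq_bigr => k _; rewrite linearZ /= mulr_algl mcoeffZ; congr (_ * _).
  rewrite rmorphXn /= horner_algX -exprM mpolyXn mcoeffX; congr ((nat_of_bool _)%:R).
  apply/eqP/eqP => [/mnmP /(_ m)|-> //].
  rewrite !mulmnE mnm1E eqxx !mul1n => /eqP.
  by rewrite eqn_pmul2l // => /eqP.
case: (ltnP i (size p)) => hi; last first.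
  rewrite nth_default // big1 // => k _; case: eqP => [E|_]; rewrite ?mulr0 //.
  by move: (ltn_ord k); rewrite E ltnNge hi.
rewrite (bigD1 (Ordinal hi)) //= eqxx mulr1 big1 ?addr0 // => k.
by rewrite -val_eqE /= => /negPf ->; rewrite mulr0.
Qed.

Lemma L1_embedding_inj : injective L1_embedding.
Proof.
move=> x y /(congr1 (@Ld_val _ _ _)) /= /ffunP E; apply/ffunP=> m.
have := E m; rewrite !ffunE /L1_coef => /(scalerI (invr_neq0 d_neq0)) Em.
have X0 : ('X_m : {mpoly K[n]}) ^+ d.+1 != 0.
  rewrite mpolyXn; apply/eqP => /(congr1 (mcoeff (U_(m) *+ d.+1))) /eqP.
  by rewrite mcoeffX eqxx mcoeff0 oner_eq0.
have {}Em := mulfI X0 Em.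
by apply/polyP => i; rewrite -(mcoeff_horner_var m) Em mcoeff_horner_var.
Qed.

End Embedding.

(* The tensor fields K[x] (x) V for V = K^m, as K[x]^m: g (x) v has           *)
(* components v_a g, and tf_act_pure below is the action on it.               *)
Definition tfield (K : fieldType) (n m : nat) := {ffun 'I_m -> {mpoly K[n]}}.

Section TensorFields.
Variables (K : fieldType) (n m : nat) (rho : lieHom (gl K n) (gl K m)).
Implicit Types (X Y : vfield K n) (F G : tfield K n m).

HB.instance Definition _ := GRing.Lmodule.on (tfield K n m).

Definition tf_pure (g : {mpoly K[n]}) (v : 'cV[K]_m) : tfield K n m :=
  [ffun a => v a 0 *: g].

(* The K[x]-linear extension of the action of E_ij to K[x]^m. *)
Definition tf_E (i j : 'I_n) F : tfield K n m :=
  [ffun a => \sum_(b < m) rho (delta_mx i j) a b *: F b].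

Definition tf_act X F : tfield K n m :=
  [ffun a => vf_der X (F a)
    + \sum_(i < n) \sum_(j < n) mderiv i (X j) * tf_E i j F a].

Lemma tf_act_pure X g v :
  tf_act X (tf_pure g v)
  = \sum_(j < n) tf_pure (X j * mderiv j g) v
  + \sum_(i < n) \sum_(j < n)
      tf_pure (mderiv i (X j) * g) (gl_module rho (delta_mx i j) v).
Proof.
apply/ffunP=> a; rewrite !ffunE !sum_ffunE; congr (_ + _).
  rewrite linearZ /= /vf_der scaler_sumr; apply: eq_bigr => j _.
  by rewrite ffunE.
apply: eq_bigr => i _; rewrite sum_ffunE; apply: eq_bigr => j _.
rewrite !ffunE /gl_module /= /restrict_fun /= /gl_std_fun mxE scaler_suml mulr_sumr.
apply: eq_bigr => b _; rewrite ffunE scalerA -scalerAr //.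
Qed.

Lemma tf_E_linear i j : linear (tf_E i j).
Proof.
move=> c F G; apply/ffunP=> a; rewrite !ffunE scaler_sumr -big_split.
by apply: eq_bigr => b _ /=; rewrite !ffunE scalerDr !scalerA mulrC.
Qed.

Fact tf_linearl F : linear (tf_act ^~ F).
Proof.
move=> c X Y; apply/ffunP=> a; rewrite !ffunE vf_derP scalerDr addrACA.
congr (_ + _); rewrite scaler_sumr -big_split; apply: eq_bigr => i _ /=.
rewrite scaler_sumr -big_split; apply: eq_bigr => j _ /=.
by rewrite !ffunE linearP mulrDl scalerAl.
Qed.

Fact tf_linearr X : linear (tf_act X).
Proof.
move=> c F G; apply/ffunP=> a; rewrite !ffunE linearP scalerDr addrACA.
congr (_ + _); rewrite scaler_sumr -big_split; apply: eq_bigr => i _ /=.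
rewrite scaler_sumr -big_split; apply: eq_bigr => j _ /=.
by rewrite tf_E_linear !ffunE mulrDr scalerAr.
Qed.

(* The K[x]-linear extension of rho to matrices with polynomial entries. *)
Definition rhoX (A : 'M[{mpoly K[n]}]_n) : 'M[{mpoly K[n]}]_m :=
  \sum_i \sum_j A i j *: map_mx (@mpolyC n K) (rho (delta_mx i j)).
Definition vf_jac X : 'M[{mpoly K[n]}]_n := \matrix_(i, j) mderiv i (X j).

Definition rhoXE (i j : 'I_n) : 'M[{mpoly K[n]}]_m :=
  map_mx (@mpolyC n K) (rho (delta_mx i j)).

Lemma rhoX_pair (A : 'M_n) : rhoX A = \sum_(p : 'I_n * 'I_n) A p.1 p.2 *: rhoXE p.1 p.2.
Proof. by rewrite /rhoX pair_bigA. Qed.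

Lemma rhoX_prod (A B : 'M_n) :
  \sum_(p : 'I_n * 'I_n) \sum_(q : 'I_n * 'I_n)
    (A p.1 p.2 * B q.1 q.2) *: (rhoXE p.1 q.2 *+ (p.2 == q.1)) = rhoX (A *m B).
Proof.
rewrite -(pair_bigA _ (fun i j => \sum_(q : 'I_n * 'I_n)
    (A i j * B q.1 q.2) *: (rhoXE i q.2 *+ (j == q.1)))) /=.
apply: eq_bigr => i _; under [RHS]eq_bigr => l _ do rewrite mxE scaler_suml.
rewrite [RHS]exchange_big; apply: eq_bigr => j _ /=.
rewrite -(pair_bigA _ (fun k l => (A i j * B k l) *: (rhoXE i l *+ (j == k)))) /=.
rewrite (bigD1 j) //= [X in _ + X]big1 ?addr0 => [|k /negPf jk].
  by apply: eq_bigr => l _; rewrite eqxx.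
by apply: big1 => l _; rewrite eq_sym jk mulr0n scaler0.
Qed.

Lemma rhoXE_comm i j k l :
  rhoXE i j *m rhoXE k l - rhoXE k l *m rhoXE i j = rhoXE i l *+ (j == k) - rhoXE k j *+ (l == i).
Proof.
have h0 : rho 0 = 0.
  by have := hom_linear rho (-1) 0 0; rewrite scaler0 addr0 scaleN1r addNr.
have hom_mn A (b : bool) : rho (A *+ b) = rho A *+ b.
  by case: b; rewrite ?mulr1n // !mulr0n.
have homB A B : rho (A - B) = rho A - rho B.
  by rewrite addrC -scaleN1r hom_linear scaleN1r addrC.
rewrite /rhoXE -!map_mxM -map_mxB.
have -> : rho (delta_mx i j) *m rho (delta_mx k l)
    - rho (delta_mx k l) *m rho (delta_mx i j)
    = rho (delta_mx i l *+ (j == k) - delta_mx k j *+ (l == i)).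
  rewrite -[LHS](hom_lieb rho); congr (rho _).
  by rewrite /lieb /= /gl_lieb !mul_delta_mx_cond.
by rewrite homB !hom_mn map_mxB !raddfMn.
Qed.

Lemma rhoX_comm (A B : 'M_n) : rhoX (A *m B - B *m A) = rhoX A *m rhoX B - rhoX B *m rhoX A.
Proof.
have -> : rhoX (A *m B - B *m A) = rhoX (A *m B) - rhoX (B *m A).
  rewrite !rhoX_pair -sumrB; apply: eq_bigr => p _.
  by rewrite !mxE scalerBl.
have E C D : rhoX C *m rhoX D = \sum_(p : 'I_n * 'I_n) \sum_(q : 'I_n * 'I_n)
    (C p.1 p.2 * D q.1 q.2) *: (rhoXE p.1 p.2 *m rhoXE q.1 q.2).
  rewrite (rhoX_pair C) mulmx_suml; apply: eq_bigr => p _.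
  rewrite (rhoX_pair D) mulmx_sumr; apply: eq_bigr => q _.
  by rewrite -scalemxAl -scalemxAr scalerA.
rewrite -!rhoX_prod !E [X in _ - X]exchange_big [X in _ = _ - X]exchange_big /=.
rewrite -!sumrB; apply: eq_bigr => p _; rewrite -!sumrB; apply: eq_bigr => q _.
by rewrite [B _ _ * _]mulrC -!scalerBr rhoXE_comm.
Qed.

Lemma tf_actE X F a :
  tf_act X F a = vf_der X (F a) + \sum_b rhoX (vf_jac X) a b * F b.
Proof.
rewrite ffunE; congr (_ + _); rewrite /rhoX.
under [RHS]eq_bigr => b _ do rewrite summxE mulr_suml.
rewrite [RHS]exchange_big /=; apply: eq_bigr => i _.
under [RHS]eq_bigr => b _ do rewrite summxE mulr_suml.
rewrite [RHS]exchange_big /=; apply: eq_bigr => j _.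
rewrite ffunE mulr_sumr; apply: eq_bigr => b _.
by rewrite !mxE -mul_mpolyC mulrA.
Qed.

Lemma tf_lieb_aux (A : comNzRingType) (s1 s2 s3 s4 s5 s6 s7 : A) :
  s1 - s2 + (s3 - s4 + (s5 - s6))
  = s1 + s3 + s7 + s5 - (s2 + s4 + s7 + s6).
Proof. by ring. Qed.

Fact tf_lieb X Y F : tf_act (lieb X Y) F
  = tf_act X (tf_act Y F) - tf_act Y (tf_act X F).
Proof.
apply/ffunP=> a; rewrite [RHS]ffunE [X in _ + X]ffunE.
rewrite tf_actE (tf_actE X (tf_act Y F)) (tf_actE Y (tf_act X F)).
have E U V : vf_der U (tf_act V F a) + \sum_b rhoX (vf_jac U) a b * tf_act V F b
  = vf_der U (vf_der V (F a)) + \sum_b (vf_der U (rhoX (vf_jac V) a b)) * F b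
    + \sum_b (rhoX (vf_jac V) a b * vf_der U (F b) + rhoX (vf_jac U) a b * vf_der V (F b))
    + \sum_b (rhoX (vf_jac U) *m rhoX (vf_jac V)) a b * F b.
  rewrite tf_actE linearD -!addrA; congr (_ + _); rewrite linear_sum /=.
  under eq_bigr => b _ do rewrite vf_derM.
  rewrite [X in _ + X = _](eq_bigr _ (fun b _ => congr2 *%R erefl (tf_actE V F b))).
  under [X in _ + X = _]eq_bigr => b _ do rewrite mulrDr.
  rewrite !big_split /= -!addrA; congr (_ + (_ + (_ + _))).
  under eq_bigr => b _ do rewrite mulr_sumr.
  rewrite exchange_big; apply: eq_bigr => c _ /=.
  by rewrite mxE mulr_suml; apply: eq_bigr => b _; rewrite mulrA.
rewrite !E vf_der_lieb.
have -> : rhoX (vf_jac (lieb X Y)) = map_mx (vf_der X) (rhoX (vf_jac Y))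
    - map_mx (vf_der Y) (rhoX (vf_jac X))
    + (rhoX (vf_jac X) *m rhoX (vf_jac Y) - rhoX (vf_jac Y) *m rhoX (vf_jac X)).
  have Rd U A : map_mx (vf_der U) (rhoX A) = rhoX (map_mx (vf_der U) A).
    apply/matrixP => b c; rewrite !rhoX_pair mxE !summxE (linear_sum (vf_der U)).
    apply: eq_bigr => p _; rewrite !mxE.
    apply: etrans (vf_derM _ _ _) _.
    have -> : vf_der U (rho (delta_mx p.1 p.2) b c)%:MP = 0.
      by apply: big1 => i _; rewrite mderivC mulr0.
    by rewrite mulr0 addr0.
  have RD A B : rhoX (A + B) = rhoX A + rhoX B.
    rewrite !rhoX_pair -big_split; apply: eq_bigr => p _ /=.
    by rewrite !mxE scalerDl.
  have RB A B : rhoX (A - B) = rhoX A - rhoX B.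
    rewrite !rhoX_pair -sumrB; apply: eq_bigr => p _ /=.
    by rewrite !mxE scalerBl.
  rewrite -rhoX_comm !Rd -RB -RD; congr rhoX; apply/matrixP => i j.
  have H (U V : vfield K n) : mderiv i (vf_der U (V j)) = vf_der U (mderiv i (V j))
      + \sum_k vf_jac U i k * vf_jac V k j.
    rewrite /vf_der (linear_sum (mderiv i)) -big_split.
    apply: eq_bigr => k _ /=.
    by rewrite mderivM mderiv_comm addrC !mxE.
  rewrite !mxE ffunE mderivB !H.
  by rewrite opprD addrACA.
have mxD4 (P Q S T : 'M[{mpoly K[n]}]_m) b :
    (map_mx (vf_der X) P - map_mx (vf_der Y) Q + (S - T)) a b
    = vf_der X (P a b) - vf_der Y (Q a b) + (S a b - T a b) by rewrite !mxE.
under eq_bigr => b _ do rewrite mxD4 mulrDl !mulrBl.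
rewrite big_split /= !sumrB.
have -> : \sum_b (rhoX (vf_jac Y) a b * vf_der X (F b)
      + rhoX (vf_jac X) a b * vf_der Y (F b))
    = \sum_b (rhoX (vf_jac X) a b * vf_der Y (F b)
      + rhoX (vf_jac Y) a b * vf_der X (F b)).
  by apply: eq_bigr => b _; rewrite addrC.
exact: tf_lieb_aux.
Qed.

Definition tf_action : lieAction (vfield K n) (tfield K n m) :=
  LieAction tf_linearl tf_linearr tf_lieb.

End TensorFields.

(* The tensor product over K of a finite family of vector spaces: the free    *)
(* vector space on the product of the family, modulo multilinearity.          *)

Section Tensor.
Local Open Scope quotient_scope.
Variables (K : fieldType) (I : finType) (M : I -> lmodType K).

Definition tprod := {dffun forall i, M i}.

Definition upd (t : tprod) (i : I) (y : M i) : tprod :=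
  [ffun k => dfwith t y k].

Lemma upd_in t i (y : M i) : upd t y i = y.
Proof. by rewrite ffunE dfwith_in. Qed.

Lemma upd_out t i (y : M i) k : i != k -> upd t y k = t k.
Proof. by move=> ik; rewrite ffunE dfwith_out. Qed.

Lemma upd_upd t i (y z : M i) : upd (upd t y) z = upd t z.
Proof.
apply/ffunP=> k; have [<-|ik] := eqVneq i k; first by rewrite !upd_in.
by rewrite !upd_out.
Qed.

Lemma upd_comm t i j (y : M i) (z : M j) : i != j ->
  upd (upd t y) z = upd (upd t z) y.
Proof.
move=> ij; apply/ffunP=> k; have [<-|ik] := eqVneq i k.
  by rewrite upd_in upd_out 1?eq_sym // upd_in.
have [<-|jk] := eqVneq j k; first by rewrite upd_in upd_out // upd_in.
by rewrite !upd_out.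
Qed.

Lemma upd_id t i : upd t (t i) = t.
Proof.
by apply/ffunP=> k; have [<-|ik] := eqVneq i k; rewrite ?upd_in ?upd_out.
Qed.

Definition tfree := {freeg tprod / K}.
HB.instance Definition _ := GRing.Lmodule.on tfree.

Definition tgen (t : tprod) : tfree := << t >>.

Inductive trel : tfree -> Prop :=
| Trel_gen t i c (y z : M i) :
    trel (tgen (upd t (c *: y + z)) - (c *: tgen (upd t y) + tgen (upd t z)))
| Trel_0 : trel 0
| Trel_lin c u v : trel u -> trel v -> trel (c *: u + v).

Definition trelb : {pred tfree} := fun u => `[< trel u >].

Lemma trelP u : reflect (trel u) (u \in trelb).
Proof. exact: asboolP. Qed.

Fact trel_submod : submod_closed trelb.
Proof.
split=> [|c u v /trelP hu /trelP hv]; apply/trelP; first exact: Trel_0.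
exact: Trel_lin.
Qed.

HB.instance Definition _ := GRing.isSubmodClosed.Build K tfree trelb trel_submod.

Definition tensor := Quotient.quot trelb.
HB.instance Definition _ := GRing.Zmodule.on tensor.

Definition tpi (u : tfree) : tensor := \pi_tensor u.

Lemma tpiE u v : (tpi u = tpi v) <-> trel (u - v).
Proof.
split=> [E|/trelP h].
  by apply/trelP; rewrite Quotient.idealrBE; apply/eqP.
by apply/eqP; rewrite /tpi -Quotient.idealrBE.
Qed.

Lemma tpiB u v : tpi (u - v) = tpi u - tpi v.
Proof. exact: raddfB. Qed.

Lemma tpiD u v : tpi (u + v) = tpi u + tpi v.
Proof. exact: raddfD. Qed.

Lemma tpi_repr (u : tensor) : tpi (repr u) = u.
Proof. exact: reprK. Qed.

Definition tscale (c : K) (u : tensor) : tensor := tpi (c *: repr u).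

Lemma tpiZ c u : tpi (c *: u) = tscale c (tpi u).
Proof.
apply/tpiE; rewrite -scalerBr; apply/trelP; apply: rpredZ; apply/trelP.
by apply/tpiE; rewrite tpi_repr.
Qed.

Fact tscaleA a b v : tscale a (tscale b v) = tscale (a * b) v.
Proof. by rewrite -[v]tpi_repr -!tpiZ scalerA. Qed.

Fact tscale1 : left_id 1 tscale.
Proof. by move=> v; rewrite -[v]tpi_repr -tpiZ scale1r. Qed.

Fact tscaleDr : right_distributive tscale +%R.
Proof.
move=> c u v; rewrite -[u]tpi_repr -[v]tpi_repr -!tpiZ -!tpiD -tpiZ.
by rewrite scalerDr.
Qed.

Fact tscaleDl v : {morph tscale^~ v : a b / a + b}.
Proof. by move=> a b; rewrite -[v]tpi_repr -!tpiZ -tpiD scalerDl. Qed.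

HB.instance Definition _ := GRing.Zmodule_isLmodule.Build K tensor
  tscaleA tscale1 tscaleDr tscaleDl.

Lemma tpi_linear : linear tpi.
Proof. by move=> c u v; rewrite tpiD tpiZ. Qed.

Definition tens (t : tprod) : tensor := tpi (tgen t).

Lemma tens_lin t i c (y z : M i) :
  tens (upd t (c *: y + z)) = c *: tens (upd t y) + tens (upd t z).
Proof. by rewrite /tens -tpi_linear; apply/tpiE; apply: Trel_gen. Qed.

Section Lift.
Variables (W : lmodType K) (f : tprod -> W).
Hypothesis f_lin : forall t i c (y z : M i),
  f (upd t (c *: y + z)) = c *: f (upd t y) + f (upd t z).

Lemma fglift_linear : linear (fglift f : tfree -> W).
Proof.
have addf : {morph fglift f : x y / x + y}.
  move=> x y; have B := lift_is_additive f.
  have N z : fglift f (- z) = - fglift f z.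
    rewrite -[- z]sub0r B; suff -> : fglift f 0 = 0 by rewrite sub0r.
    by rewrite -[X in fglift f X](subrr 0) B subrr.
  by rewrite -[y in LHS]opprK B N opprK.
move=> c u v; rewrite addf; congr (_ + _).
have f0 : fglift f 0 = 0.
  by have := lift_is_additive f 0 0; rewrite !subrr.
rewrite -[u]freeg_sumE scaler_sumr.
rewrite !(big_morph (fglift f) addf f0) scaler_sumr.
apply: eq_bigr => k _.
have -> : c *: << coeff k u *g k >> = << c * coeff k u *g k >> :> {freeg tprod / K}.
  by apply/eqP/freeg_eqP => l; rewrite coeffZ !coeffU mulrA.
by rewrite !liftU scalerA.
Qed.

Lemma fglift_trel u : trel u -> fglift f u = 0.
Proof.
have f0 : fglift f 0 = 0.
  by have := lift_is_additive f 0 0; rewrite !subrr.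
elim=> [t i c y z||c a b _ ha _ hb] //.
  rewrite lift_is_additive fglift_linear !liftU !scale1r f_lin subrr //.
by rewrite fglift_linear ha hb scaler0 addr0.
Qed.

Definition tlift (u : tensor) : W := fglift f (repr u).

Lemma tlift_tpi u : tlift (tpi u) = fglift f u.
Proof.
apply/eqP; rewrite -subr_eq0 -lift_is_additive; apply/eqP/fglift_trel/tpiE.
exact: tpi_repr.
Qed.

Lemma tlift_linear : linear tlift.
Proof.
move=> c u v; rewrite -[u]tpi_repr -[v]tpi_repr -tpi_linear !tlift_tpi.
exact: fglift_linear.
Qed.

Lemma tlift_tens t : tlift (tens t) = f t.
Proof. by rewrite tlift_tpi liftU scale1r. Qed.
End Lift.

Lemma tensor_ind (P : tensor -> Prop) :
  (forall c u v, P u -> P v -> P (c *: u + v)) -> P 0 ->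
  (forall t, P (tens t)) -> forall u, P u.
Proof.
move=> PD P0 Pt u; rewrite -[u]tpi_repr -(freeg_sumE (repr u)).
elim: (dom _) => [|k s IHs].
  by rewrite big_nil; have := tpiB 0 0; rewrite !subrr => ->.
rewrite big_cons.
have -> : << coeff k (repr u) *g k >> = coeff k (repr u) *: tgen k :> tfree.
  by apply/eqP/freeg_eqP => l; rewrite coeffZ !coeffU mul1r.
by rewrite tpi_linear; apply: PD => //; exact: Pt.
Qed.

Section Action.
Variables (L : lieAlgType K) (a : forall i, lieAction L (M i)).

Definition leibniz (x : L) (t : tprod) : tensor :=
  \sum_(i : I) tens (upd t (a i x (t i))).

Lemma leibniz_lin x t i c (y z : M i) :
  leibniz x (upd t (c *: y + z))
  = c *: leibniz x (upd t y) + leibniz x (upd t z).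
Proof.
rewrite /leibniz scaler_sumr -big_split; apply: eq_bigr => k _ /=.
have [<-|ik] := eqVneq i k.
  by rewrite !upd_in !upd_upd act_linearr tens_lin.
by rewrite !upd_out // !(upd_comm _ _ _ ik) tens_lin.
Qed.

Definition tensor_act (x : L) : tensor -> tensor := tlift (leibniz x).

Lemma tensor_act_tens x t :
  tensor_act x (tens t) = \sum_(i : I) tens (upd t (a i x (t i))).
Proof. by rewrite /tensor_act tlift_tens //; exact: leibniz_lin. Qed.

Fact tensor_linearr x : linear (tensor_act x).
Proof. by apply: tlift_linear; exact: leibniz_lin. Qed.

Lemma tensor_act0 x : tensor_act x 0 = 0.
Proof.
by have := tensor_linearr x (-1) 0 0; rewrite scaler0 addr0 scaleN1r addNr.
Qed.

Fact tensor_linearl u : linear (tensor_act ^~ u).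
Proof.
move=> c x y; elim/tensor_ind: u => [b u v hu hv||t].
- rewrite !tensor_linearr hu hv !scalerDr !scalerA [b * c]mulrC.
  by rewrite addrACA.
- by rewrite !tensor_act0 scaler0 addr0.
rewrite !tensor_act_tens scaler_sumr -big_split; apply: eq_bigr => i _ /=.
by rewrite act_linearl tens_lin.
Qed.

Lemma tensor_act_sum x (J : finType) (F : J -> tensor) :
  tensor_act x (\sum_j F j) = \sum_j tensor_act x (F j).
Proof.
apply: big_morph; last exact: tensor_act0.
by move=> u v; have := tensor_linearr x 1 u v; rewrite !scale1r.
Qed.

Lemma tens_updB t i (y z : M i) :
  tens (upd t (y - z)) = tens (upd t y) - tens (upd t z).
Proof. by rewrite addrC -scaleN1r tens_lin scaleN1r addrC. Qed.

Fact tensor_lieb x y u : tensor_act (lieb x y) u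
  = tensor_act x (tensor_act y u) - tensor_act y (tensor_act x u).
Proof.
elim/tensor_ind: u => [c u v hu hv||t].
- by rewrite !tensor_linearr hu hv scalerBr opprD addrACA.
- by rewrite !tensor_act0 subrr.
rewrite !tensor_act_tens !tensor_act_sum.
have E x' y' : \sum_i tensor_act x' (tens (upd t (a i y' (t i))))
  = \sum_i tens (upd t (a i x' (a i y' (t i))))
  + \sum_i \sum_(j | j != i)
      tens (upd (upd t (a i y' (t i))) (a j x' (t j))).
  rewrite -big_split; apply: eq_bigr => i _ /=.
  rewrite tensor_act_tens (bigD1 i) //= upd_in upd_upd; congr (_ + _).
  by apply: eq_bigr => j ji; rewrite upd_out // eq_sym.
rewrite !E opprD addrACA -sumrB.
rewrite [X in _ + (_ - X)](_ : _ = \sum_i \sum_(j | j != i)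
      tens (upd (upd t (a i y (t i))) (a j x (t j)))) ?subrr ?addr0.
  by apply: eq_bigr => i _; rewrite act_lieb tens_updB.
rewrite (exchange_big_dep xpredT) //=; apply: eq_bigr => i _.
rewrite (eq_bigl (fun j => j != i)) => [|j]; last by rewrite eq_sym.
by apply: eq_bigr => j ji; rewrite (upd_comm _ _ _ ji).
Qed.

Definition tensor_action : lieAction L tensor :=
  LieAction tensor_linearl tensor_linearr tensor_lieb.

End Action.
End Tensor.

(* Main.v *)
(* After decomposing each V_lambda into weight vectors and each exponent of x     *)
(* into a residue and a quotient modulo d, the tensor product is a finite sum of  *)
(* images of modules K[y_1..y_N] on which the element e_k of the m-th copy of L_1 *)
(* acts by                                                                        *)
(*     sum over the y_s of colour m of y_s^k (y_s d/dy_s + alpha_s + k beta_s).   *)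
(* These are noetherian by induction on N. Let Sym be the ring of polynomials     *)
(* invariant under the permutations preserving colours; K[y] is a noetherian      *)
(* Sym-module. Let q be the product of the y_s and of the differences y_s - y_t   *)
(* of variables of equal colour. The key point is that for each u some power of q *)
(* satisfies q^k Sym u <= U u, where U is the enveloping algebra (one first       *)
(* removes the cases where some alpha_s is a nonpositive integer or beta_s = 1).  *)
(* To see it, consider sums of h_k e_{k_1} ... e_{k_2N} u over the monomials of a *)
(* polynomial h in 2N variables grouped in N pairs. Expanding each e_k over s     *)
(* gives a sum over maps phi from the 2N variables to the N ones; the coefficients*)
(* being polynomial in k, the terms in which phi mixes two pairs vanish when h is *)
(* divisible by a large power of the differences of variables of distinct pairs.  *)
(* Inside a pair (z, z'), the factor (z - z')^2 extracts the scalar               *)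
(* 2 beta (1 - beta) if beta <> 0, and (z - z') extracts y_s d/dy_s + alpha_s if  *)
(* beta = 0; the latter is inverted by interpolation on the support of u.         *)
(* The quotients K[y]/(q^k) embed in the sum of the K[y]/(l^k) for linear forms   *)
(* l = y_s or y_s - y_t, which are filtered by modules of the same kind in fewer  *)
(* variables, and an Artin-Rees argument for the powers of q concludes.           *)

Require Import Defs.
From HB Require Import structures.
From mathcomp Require Import all_boot all_order all_algebra.
From mathcomp Require Import boolp ring.
From mathcomp.multinomials Require Import freeg mpoly.

Set Implicit Arguments.
Unset Strict Implicit.
Unset Printing Implicit Defensive.

Import GRing.Theory.
Local Open Scope ring_scope.

(** * Relative noetherianity *)

(** Each e_k shifts exponents of x_m by multiples of d and acts on weight vectors through scalars.
    So the tensor product is a finite sum of images of polynomial modules with the operators [opE]: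
    one variable for each pair of a tensor factor and an index m, coloured by m, the weights and the
    residues mod d entering through [alpha] and [beta] ([comp_map_eq], [comp_span], [noeth_tensor]).
    What remains is [noeth_model], an induction on the number of variables that combines two facts.

    Modulo a power of q = [qpol] the module is noetherian by induction ([noeth_qpol]): such a
    quotient is controlled by quotients by powers of linear forms, and these are filtered by
    restrictions to a hyperplane, which are model modules in one variable fewer.

    On the other side, a submodule containing u contains q^k f u for some k and all symmetric f
    ([satur_mem]). Up to powers of q, submodules are thus modules over the symmetric polynomials,
    over which the polynomial ring is noetherian ([sym_fg], from [hilbert]). [noeth_nonresonant]
    glues the two facts.

    The heart of the second fact is [key_step]. A word in the e_k acts as a sum, over maps phi from
    letters to variables, of terms whose scalars are polynomial in the indices k. Weighting words by
    the coefficients of a polynomial h turns these scalars into differential operators on h,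
    followed by the substitution along phi ([opT_formula]). For h = [hpol] only the phi permuting
    the blocks survive ([term_bad]), and all contribute the same diagonal operator [kap]
    ([term_good]). It is invertible if no alpha is a nonpositive integer and no beta is 1;
    [noeth_beta1] and a shift by a power of [vars] in [noeth_model] reduce to this case. *)

Lemma seq_choice (T T' : eqType) (P : T -> T' -> Prop) (s : seq T) :
  (forall u, u \in s -> exists v, P u v) ->
  exists t : seq T', (forall v, v \in t -> exists2 u, u \in s & P u v) /\
    forall u, u \in s -> exists2 v, v \in t & P u v.
Proof.
elim: s => [|u s IHs] h; first by exists [::].
have [|t [ts st]] := IHs; first by move=> v vs; apply: h; rewrite inE vs orbT.
have [|v Puv] := h u; first by rewrite inE eqxx.
exists (v :: t); split=> w; rewrite inE => /orP[/eqP->|].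
- by exists u; rewrite ?inE ?eqxx.
- by move=> /ts[x xs ?]; exists x; rewrite // inE xs orbT.
- by exists v; rewrite ?inE ?eqxx.
by move=> /st[x xs ?]; exists x; rewrite // inE xs orbT.
Qed.

Section Subspaces.
Context {K : fieldType} {V : lmodType K}.
Implicit Types (N A B : V -> Prop) (u v : V).

Definition subspace N : Prop :=
  N 0 /\ forall c u v, N u -> N v -> N (c *: u + v).

Lemma subspaceD N u v : subspace N -> N u -> N v -> N (u + v).
Proof. by case=> _ h hu hv; rewrite -[u]scale1r; apply: h. Qed.

Lemma subspaceZ N c u : subspace N -> N u -> N (c *: u).
Proof. by case=> h0 h hu; rewrite -[_ *: _]addr0; apply: h. Qed.

Lemma subspaceB N u v : subspace N -> N u -> N v -> N (u - v).
Proof.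
by move=> hN hu hv; apply: subspaceD => //; rewrite -scaleN1r; apply: subspaceZ.
Qed.

Lemma subspaceN N u : subspace N -> N u -> N (- u).
Proof. by move=> hN; rewrite -scaleN1r; apply: subspaceZ. Qed.

Lemma subspace_sum N (I : Type) (s : seq I) (P : pred I) (f : I -> V) :
  subspace N -> (forall i, P i -> N (f i)) -> N (\sum_(i <- s | P i) f i).
Proof.
move=> hN h; elim/big_rec: _ => [|i x Pi hx]; first by case: hN.
by apply: subspaceD => //; apply: h.
Qed.

Lemma subspaceI N N' : subspace N -> subspace N' ->
  subspace (fun u => N u /\ N' u).
Proof.
move=> [h0 h] [h0' h']; split=> // c u v [? ?] [? ?].
by split; [apply: h | apply: h'].
Qed.

Lemma subspace0 : subspace (fun u : V => u = 0).
Proof. by split=> // c u v -> ->; rewrite scaler0 addr0. Qed.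

Definition stable {J : Type} (F : J -> V -> V) N : Prop :=
  subspace N /\ forall j u, N u -> N (F j u).

(* The quotient of A by A :&: B is noetherian, phrased without quotients. *)
Definition noeth {J : Type} (F : J -> V -> V) A B : Prop :=
  forall N, stable F N -> (forall u, N u -> A u) ->
  exists s : seq V, (forall u, u \in s -> N u) /\
    forall N', stable F N' -> (forall u, u \in s -> N' u) ->
    forall u, N u -> exists2 v, N' v & B (u - v).

Definition whole := fun _ : V => True.
Definition null := fun u : V => u = 0.

Section Family.
Variables (J : Type) (F : J -> V -> V).

Lemma stableI N N' : stable F N -> stable F N' ->
  stable F (fun u => N u /\ N' u).
Proof.
move=> [h s] [h' s']; split; first exact: subspaceI.
by move=> j u [? ?]; split; [apply: s | apply: s'].
Qed.

Lemma noethI A B N : noeth F A B -> stable F N -> (forall u, N u -> A u) ->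
  exists s : seq V, (forall u, u \in s -> N u) /\
    forall N', stable F N' -> (forall u, u \in s -> N' u) ->
    forall u, N u -> exists v, [/\ N' v, N v & B (u - v)].
Proof.
move=> h hN NA; have [s [sN hs]] := h N hN NA.
exists s; split=> // N' hN' sN' u Nu.
have [|v [? ?] ?] := hs _ (stableI hN' hN) _ u Nu; last by exists v.
by move=> w ws; split; [apply: sN' | apply: sN].
Qed.

Lemma noeth_mono A B A' B' : (forall u, A' u -> A u) -> (forall u, B u -> B' u) ->
  noeth F A B -> noeth F A' B'.
Proof.
move=> hA hB h N hN NA; have [u /NA/hA|s [sN hs]] := h N hN; first by [].
exists s; split=> // N' hN' sN' u Nu.
by have [v ? /hB] := hs N' hN' sN' u Nu; exists v.
Qed.

Lemma noeth_refl A : noeth F A A.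
Proof.
move=> N hN NA; exists [::]; split=> // N' [[N0 _] _] _ u /NA Au.
by exists 0; rewrite ?subr0.
Qed.

Lemma noeth_trans A B C : stable F B -> noeth F A B -> noeth F B C ->
  noeth F A C.
Proof.
move=> hB h1 h2 N hN NA.
have [s [sN hs]] := noethI h1 hN NA.
have [u [] //|t [tN ht]] := noethI h2 (stableI hN hB) _.
exists (s ++ t); split=> [u|N' hN' sN' u Nu].
  by rewrite mem_cat => /orP[/sN|/tN[]].
have [|v [N'v Nv Buv]] := hs N' hN' _ u Nu.
  by move=> w ws; apply: sN'; rewrite mem_cat ws.
have [||v' [N'v' _ Cv]] := ht N' hN' _ (u - v).
- by move=> w ws; apply: sN'; rewrite mem_cat ws orbT.
- by split=> //; apply: subspaceB => //; case: hN.
exists (v + v'); last by rewrite opprD addrA.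
by apply: subspaceD => //; case: hN'.
Qed.

(** The quotient by the intersection embeds in the sum of the quotients by B and by B'. Concretely,
    generators modulo B are completed by generators, modulo B', of what lies in B. *)
Lemma noeth_meet A B B' : stable F B ->
  noeth F A B -> noeth F A B' -> noeth F A (fun u => B u /\ B' u).
Proof.
move=> hB h1 h2 N hN NA.
have [s [sN hs]] := noethI h1 hN NA.
have [u [/NA //]|t [tN ht]] := noethI h2 (stableI hN hB) _.
exists (s ++ t); split=> [u|N' hN' sN' u Nu].
  by rewrite mem_cat => /orP[/sN|/tN[]].
have [|v [N'v Nv Buv]] := hs N' hN' _ u Nu.
  by move=> w ws; apply: sN'; rewrite mem_cat ws.
have [||v' [N'v' [_ Bv'] Cv]] := ht N' hN' _ (u - v).
- by move=> w ws; apply: sN'; rewrite mem_cat ws orbT.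
- by split=> //; apply: subspaceB => //; case: hN.
exists (v + v'); first by apply: subspaceD => //; case: hN'.
by rewrite opprD addrA; split=> //; apply: subspaceB => //; case: hB.
Qed.

End Family.

End Subspaces.

Arguments whole {K V}.
Arguments null {K V}.

(** A quotient of a noetherian module is noetherian. As [phi] is equivariant and onto only modulo B,
    submodules are pulled back along relations n = phi x modulo B. *)
Lemma noeth_image {K : fieldType} {V V' : lmodType K} (J : Type) (F : J -> V -> V)
    (F' : J -> V' -> V') (phi : V' -> V) (A B : V -> Prop) :
  stable F B -> (forall j, linear (F j)) -> linear phi ->
  (forall u, A u -> exists x, B (u - phi x)) ->
  (forall j x, B (phi (F' j x) - F j (phi x))) ->
  (forall N : V' -> Prop, stable F' N -> exists s : seq V',
    (forall x, x \in s -> N x) /\ forall N' : V' -> Prop, stable F' N' ->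
    (forall x, x \in s -> N' x) -> forall x, N x -> N' x) ->
  noeth F A B.
Proof.
move=> hB Flin plin surj equiv h N hN NA.
have pull N0 : stable F N0 ->
    stable F' (fun x => exists2 n, N0 n & B (n - phi x)).
  move=> [hN0 hFN0]; have [[B0 Bl] BF] := hB; split; [split|].
  - exists 0; first by case: hN0.
    have := plin (-1) 0 0; rewrite scaleN1r oppr0 addr0 scaleN1r addNr => ->.
    by rewrite subr0.
  - move=> c x y [n Nn Bn] [n' Nn' Bn']; exists (c *: n + n').
      by case: hN0 => _; apply.
    by rewrite plin opprD addrACA -scalerBr; apply: Bl.
  - move=> j x [n Nn Bn]; exists (F j n); first exact: hFN0.
    have lB : F j (n - phi x) = F j n - F j (phi x).
      by rewrite addrC -scaleN1r Flin scaleN1r addrC.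
    have -> : F j n - phi (F' j x)
        = F j (n - phi x) - (phi (F' j x) - F j (phi x)).
      by rewrite lB opprB addrA subrK.
    by apply: subspaceB => //; apply: BF.
have [s [sN hs]] := h _ (pull N hN).
have [|t [ts st]] := @seq_choice _ _ (fun x n => N n /\ B (n - phi x)) s.
  by move=> x /sN[n ? ?]; exists n.
exists t; split=> [n /ts[x _ []] //|N' hN' tN' u Nu].
have [x Bx] := surj u (NA u Nu).
have [||n N'n Bn] := hs _ (pull N' hN') _ x.
- by move=> y /st[n nt []]; exists n => //; apply: tN'.
- by exists u.
exists n => //; have -> : u - n = (u - phi x) - (n - phi x).
  by rewrite opprB addrA subrK.
by apply: subspaceB => //; case: hB.
Qed.

Lemma noeth_fg {K : fieldType} {V : lmodType K} (J : Type) (F : J -> V -> V) : noeth F whole null ->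
  forall N : V -> Prop, stable F N -> exists s : seq V,
    (forall x, x \in s -> N x) /\ forall N' : V -> Prop, stable F N' ->
    (forall x, x \in s -> N' x) -> forall x, N x -> N' x.
Proof.
move=> h N hN; have [//|s [sN hs]] := h N hN.
exists s; split=> // N' hN' sN' x Nx.
have [v N'v xv] := hs N' hN' sN' x Nx.
by rewrite (subr0_eq xv).
Qed.

Section Generated.
Context {K : fieldType} {V : lmodType K}.

Definition generated {J : Type} (F : J -> V -> V) (s : seq V) : V -> Prop :=
  fun u => forall N, stable F N -> (forall v, v \in s -> N v) -> N u.

Lemma generated_stable (J : Type) (F : J -> V -> V) s :
  stable F (generated F s).
Proof.
split; [split|] => [N [[]]|c u v hu hv N hN sN|j u hu N hN sN] //.
  by have [[_ h] _] := hN; apply: h; [apply: hu | apply: hv].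
by have [_ h] := hN; apply: h; apply: hu.
Qed.

Lemma generated_mem (J : Type) (F : J -> V -> V) s u : u \in s ->
  generated F s u.
Proof. by move=> us N _; apply. Qed.

End Generated.

(** * Hilbert's basis theorem *)

Section Hilbert.
Context {K : fieldType} {R : comAlgType K}.
Implicit Types (V N : R -> Prop) (e u v w : R).

Definition mulfam {J : Type} (G : J -> R) : J -> R -> R := fun j u => G j * u.

Definition ocons {J : Type} (e : R) (G : J -> R) (o : option J) : R :=
  if o is Some j then G j else e.

(** The polynomials in [e] of degree below d with coefficients in V. *)
Fixpoint powers (e : R) V (d : nat) : R -> Prop :=
  if d is d'.+1 then
    fun u => exists v w, [/\ V v, powers e V d' w & u = e ^+ d' * v + w]
  else fun u => u = 0.

Section Step.
Variables (J : Type) (G : J -> R) (e : R) (V : R -> Prop).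
Hypothesis hV : stable (mulfam G) V.

Let V_d d := powers e V d.

Lemma powers_stable d : stable (mulfam G) (V_d d).
Proof.
elim: d => [|d [[h0 hl] hG]].
  by split; [exact: subspace0 | move=> j u ->; rewrite /mulfam mulr0].
have [[V0 Vl] VG] := hV; split; [split|].
- by exists 0, 0; split; rewrite ?mulr0 ?addr0.
- move=> c _ _ [v [w [Vv hw ->]]] [v' [w' [Vv' hw' ->]]].
  exists (c *: v + v'), (c *: w + w'); split; [exact: Vl | exact: hl |].
  by rewrite scalerDr mulrDr -scalerAr addrACA.
move=> j _ [v [w [Vv hw ->]]]; exists (G j * v), (G j * w).
by split; [exact: VG | exact: hG | rewrite /mulfam mulrDr mulrCA].
Qed.

Lemma powersS d u : V_d d u -> V_d d.+1 u.
Proof.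
move=> hu; exists 0, u; split=> //; first by case: hV => -[].
by rewrite mulr0 add0r.
Qed.

Lemma powers_mul d u : V_d d u -> V_d d.+1 (e * u).
Proof.
elim: d u => [|d IHd] u; first by move=> /= ->; rewrite mulr0; apply: powersS.
case=> v [w [Vv hw ->]]; exists v, (e * w); split=> //; first exact: IHd.
by rewrite mulrDr mulrA -exprS.
Qed.

Definition polyspan : R -> Prop := fun u => exists d, V_d d u.

Lemma powers_le d d' u : (d <= d')%N -> V_d d u -> V_d d' u.
Proof.
move=> /subnK <-; elim: (d' - d)%N => [|k IHk] // hu.
by apply: powersS; apply: IHk.
Qed.

Lemma polyspan_stable : stable (mulfam (ocons e G)) polyspan.
Proof.
split; [split|].
- by exists 0%N.
- move=> c u v [d hu] [d' hv]; exists (maxn d d').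
  have [[_ hl] _] := powers_stable (maxn d d').
  apply: hl; first exact: powers_le (leq_maxl _ _) hu.
  exact: powers_le (leq_maxr _ _) hv.
case=> [j|] u [d hu].
  by exists d; have [_ h] := powers_stable d; exact: h.
by exists d.+1; exact: powers_mul.
Qed.

Lemma polyspan_sub u : V u -> polyspan u.
Proof.
by move=> Vu; exists 1%N, u, 0; rewrite mul1r addr0.
Qed.

(** As [e] may be algebraic over V, an element can have several leading coefficients; every
    admissible v is kept. *)
Definition leading N d : R -> Prop :=
  fun v => V v /\ exists2 w, V_d d w & N (e ^+ d * v + w).

Lemma leading_stable N d : stable (mulfam (ocons e G)) N ->
  stable (mulfam G) (leading N d).
Proof.
move=> [[N0 Nl] NG]; have [[V0 Vl] VG] := hV.
have [[D0 Dl] DG] := powers_stable d; split; [split|].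
- by split=> //; exists 0; rewrite // mulr0 addr0.
- move=> c u v [Vu [w hw Nu]] [Vv [w' hw' Nv]]; split; first exact: Vl.
  exists (c *: w + w'); first exact: Dl.
  rewrite mulrDr -scalerAr addrACA -scalerDr; exact: Nl.
move=> j u [Vu [w hw Nu]]; split; first exact: VG.
exists (G j * w); first exact: DG.
by rewrite mulrCA -mulrDr; exact: (NG (Some j)).
Qed.

Lemma leading_addn N d k v : stable (mulfam (ocons e G)) N ->
  leading N d v -> leading N (k + d)%N v.
Proof.
move=> [_ NG] [Vv [w hw Nv]]; split=> //.
elim: k => [|k [w' hw' Nv']]; first by exists w.
exists (e * w'); first exact: powers_mul.
by rewrite exprS -mulrA -mulrDr; exact: (NG None).
Qed.

(* The usual proof: the modules [leading N d] of leading coefficients of the *)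
(* elements of N of degree at most d in e are stationary.                    *)
Lemma noeth_polyspan : noeth (mulfam G) V null ->
  noeth (mulfam (ocons e G)) polyspan null.
Proof.
move=> nV N hN Npoly; have [hN0 NG] := hN.
have fg N1 : stable (mulfam G) N1 -> (forall u, N1 u -> V u) ->
    exists s : seq R, (forall u, u \in s -> N1 u) /\
    forall N', stable (mulfam G) N' -> (forall u, u \in s -> N' u) ->
    forall u, N1 u -> N' u.
  move=> h1 N1V; have [s [sN hs]] := nV N1 h1 N1V.
  exists s; split=> // N' hN' sN' u Nu.
  by have [v N'v /subr0_eq ->] := hs N' hN' sN' u Nu.
pose L v := exists d, leading N d v.
have hL : stable (mulfam G) L.
  split; [split|].
  - by exists 0%N; have [[]] := leading_stable 0 hN.
  - move=> c u v [d hu] [d' hv]; exists (d + d')%N.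
    have [[_ hl] _] := leading_stable (d + d') hN.
    by apply: hl; [rewrite addnC|]; exact: leading_addn.
  by move=> j u [d hu]; exists d; have [_ h] := leading_stable d hN; exact: h.
have [u [d []] //|s [sL hs]] := fg L hL.
have [D sD] : exists D, forall u, u \in s -> leading N D u.
  elim: s sL {hs} => [|u s IHs] sL; first by exists 0%N.
  have [|D hD] := IHs; first by move=> v vs; apply: sL; rewrite inE vs orbT.
  have [|d hd] := sL u; first by rewrite inE eqxx.
  exists (d + D)%N => v; rewrite inE => /orP[/eqP->|/hD].
    by rewrite addnC; exact: leading_addn.
  exact: leading_addn.
have LD d u : leading N d u -> leading N D u.
  by move=> hu; apply: (hs _ (leading_stable D hN) sD); exists d.
have step d : exists S : seq R, (forall u, u \in S -> N u) /\
    forall N', stable (mulfam (ocons e G)) N' -> (forall u, u \in S -> N' u) ->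
    forall u, leading N d u -> leading (fun u => N u /\ N' u) d u.
  have [u []//|S0 [S0N hS0]] := fg _ (leading_stable d hN).
  pose P u n := N n /\ exists2 w, V_d d w & n = e ^+ d * u + w.
  have [|S [SS0 S0S]] := @seq_choice _ _ P S0.
    by move=> u /S0N[_ [w hw Nw]]; exists (e ^+ d * u + w); split=> //; exists w.
  exists S; split=> [n /SS0[u _ []] //|N' hN' SN'].
  apply: (hS0 _ (leading_stable d (stableI hN hN'))) => u uS0.
  have [n nS [Nn [w hw nE]]] := S0S u uS0.
  split; first by have [] := S0N u uS0.
  by exists w => //; rewrite -nE; split=> //; apply: SN'.
have [S [SN hS]] : exists S : seq R, (forall u, u \in S -> N u) /\
    forall N', stable (mulfam (ocons e G)) N' -> (forall u, u \in S -> N' u) ->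
    forall d, (d <= D)%N -> forall u, leading N d u ->
      leading (fun u => N u /\ N' u) d u.
  move: (D) => {sD LD}; elim=> [|D' [S [SN hS]]].
    have [S [SN hS]] := step 0%N; exists S; split=> // N' hN' SN' d.
    by rewrite leqn0 => /eqP->; exact: hS.
  have [T [TN hT]] := step D'.+1; exists (T ++ S); split=> [u|N' hN' SN' d].
    by rewrite mem_cat => /orP[/TN|/SN].
  rewrite leq_eqVlt => /orP[/eqP->|]; [apply: hT | rewrite ltnS => dD; apply: hS] => // u uS;
  by apply: SN'; rewrite mem_cat uS ?orbT.
exists S; split=> // N' hN' SN' u Nu; exists u; last exact: subrr.
have [d ud] := Npoly u Nu; move: u Nu ud.
(* Beyond degree D leading coefficients are those of degree D, multiplied up by powers of e. This
   allows subtracting leading terms inside N'. *)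
have lead d' v : leading N d' v -> leading (fun u => N u /\ N' u) d' v.
  move=> hv; case: (leqP d' D) => [dD|/ltnW Dd]; first exact: hS.
  rewrite -(subnK Dd); apply: leading_addn; first exact: stableI.
  by apply: hS => //; exact: LD hv.
elim: d => [|d IHd] u Nu; first by move=> ->; case: hN' => -[].
case=> v [w [Vv hw eu]].
have [|_ [w' hw' [Nv' N'v']]] := lead d v; first by split=> //; exists w; rewrite -?eu.
have -> : u = (e ^+ d * v + w') + (w - w') by rewrite addrACA subrr addr0 eu.
apply: subspaceD => //; first by case: hN'.
apply: IHd; last by apply: subspaceB => //; case: (powers_stable d).
have -> : w - w' = u - (e ^+ d * v + w') by rewrite eu opprD addrACA subrr add0r.
exact: subspaceB.
Qed.

End Step.

Fixpoint gens_idx (n : nat) : Type :=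
  if n is n'.+1 then option (gens_idx n') else void.

Fixpoint gens (es : seq R) : gens_idx (size es) -> R :=
  match es return gens_idx (size es) -> R with
  | [::] => fun j : void => match j with end
  | e :: es' => ocons e (@gens es')
  end.

Definition es_stable (es : seq R) N : Prop :=
  subspace N /\ forall e u, e \in es -> N u -> N (e * u).

Lemma gens_stable es N : es_stable es N <-> stable (mulfam (@gens es)) N.
Proof.
split=> -[hN h]; split=> //.
  move=> j u Nu; apply: h => //.
  elim: es j => [|e es IHes] //= [j|]; rewrite inE ?eqxx //.
  by apply/orP; right; exact: IHes.
move=> e u ees Nu.
suff [j ->] : exists j, e = @gens es j by exact: h.
elim: es ees {h} => [|e' es IHes] //; rewrite inE => /orP[/eqP->|/IHes[j ->]].
  by exists None.
by exists (Some j).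
Qed.

(** The start of the induction on ring generators: a finite-dimensional space is noetherian even
    with no operators at all. *)
Lemma noeth_span (bs : seq R) : exists V,
  [/\ subspace V, forall b, b \in bs -> V b
    & noeth (mulfam (fun j : void => match j with end)) V null].
Proof.
elim: bs => [|b bs [V [hV bV nV]]].
  exists (fun u => u = 0); split=> //; first exact: subspace0.
  exact: noeth_refl.
exists (fun u => exists c, V (u - c *: b)); split.
- split=> [|c u v [a hu] [a' hv]].
    by exists 0; rewrite scale0r subr0; case: hV.
  exists (c * a + a').
  have -> : c *: u + v - (c * a + a') *: b = c *: (u - a *: b) + (v - a' *: b).
    by rewrite scalerDl scalerBr scalerA opprD addrACA.
  by case: hV => _; apply.
- move=> b'; rewrite inE => /orP[/eqP->|/bV Vb'].
    by exists 1; rewrite scale1r subrr; case: hV.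
  by exists 0; rewrite scale0r subr0.
apply: (@noeth_trans _ _ _ _ _ V) nV => // N hN NA.
have [[u Nu nVu]|Nall] := pselect (exists2 u, N u & ~ V u); last first.
  exists [::]; split=> // N' [[N'0 _] _] _ u Nu; exists 0 => //.
  by rewrite subr0; apply: contrapT => nVu; apply: Nall; exists u.
exists [:: u]; split=> [v|N' hN' sN' v Nv]; first by rewrite inE => /eqP->.
have [c hc] := NA u Nu; have [a ha] := NA v Nv.
have c0 : c != 0.
  by apply: contra_notN nVu => /eqP c0; rewrite c0 scale0r subr0 in hc.
exists ((a / c) *: u).
  by apply: subspaceZ; [case: hN' | apply: sN'; rewrite inE eqxx].
have -> : v - (a / c) *: u = (v - a *: b) - (a / c) *: (u - c *: b).
  by rewrite scalerBr scalerA divfK // opprB addrA subrK.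
by apply: subspaceB => //; apply: subspaceZ.
Qed.

(** The first hypothesis says that [bs] generates R as a module over K[es]. The span of [bs] is
    noetherian, and adjoining the elements of [es] one at a time by [noeth_polyspan] yields all of
    R. *)
Lemma hilbert (es bs : seq R) :
  (forall N, es_stable es N -> (forall b, b \in bs -> N b) -> forall u, N u) ->
  forall N, es_stable es N -> exists s : seq R, (forall u, u \in s -> N u) /\
    forall N', es_stable es N' -> (forall u, u \in s -> N' u) ->
    forall u, N u -> N' u.
Proof.
move=> gen N hN.
have [V [hV bV nV]] : exists V, [/\ stable (mulfam (@gens es)) V,
    forall b, b \in bs -> V b & noeth (mulfam (@gens es)) V null].
  elim: es {gen hN} => [|e es [V [hV bV nV]]].
    by have [V [hV bV nV]] := noeth_span bs; exists V; split=> //; split=> // -[].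
  exists (polyspan e V); split.
  - exact: polyspan_stable.
  - by move=> b /bV; exact: polyspan_sub.
  exact: noeth_polyspan.
have Vtot u : V u by apply: gen => //; apply/gens_stable.
have [//|//|s [sN hs]] := nV N.
  exact/gens_stable.
exists s; split=> // N' /gens_stable hN' sN' u Nu.
by have [v N'v /subr0_eq ->] := hs N' hN' sN' u Nu.
Qed.

End Hilbert.

(** * Tensor densities and symmetric polynomials *)

Section MPolyTools.
Context {K : fieldType}.

Lemma mpoly_lin_ind n (P : {mpoly K[n]} -> Prop) :
  (forall c p q, P p -> P q -> P (c *: p + q)) -> P 0 -> (forall a, P 'X_[a]) ->
  forall p, P p.
Proof.
move=> hl h0 hX p; rewrite [p]mpolyE; elim: (msupp p) => [|a s IHs].
  by rewrite big_nil.
by rewrite big_cons; apply: hl.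
Qed.

Lemma mpoly_mul_ind n (P : {mpoly K[n]} -> Prop) :
  (forall c p q, P p -> P q -> P (c *: p + q)) -> P 1 ->
  (forall i p, P p -> P ('X_i * p)) -> forall p, P p.
Proof.
move=> hl h1 hX; apply: mpoly_lin_ind => // [|a].
  by have := hl (-1) 1 1 h1 h1; rewrite scaleN1r addNr.
rewrite mpolyXE_id; elim: (index_enum _) => [|i s IHs]; first by rewrite big_nil.
rewrite big_cons; elim: (a i) => [|k IHk]; first by rewrite mul1r.
by rewrite exprS -mulrA; apply: hX.
Qed.

Lemma mpolyXU_inj n : injective (fun i : 'I_n => 'X_i : {mpoly K[n]}).
Proof.
move=> i j /(congr1 (mcoeff U_(i))); rewrite !mcoeffXU eqxx.
by case: eqP => // _ /eqP; rewrite oner_eq0.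
Qed.

Lemma mpolyXU_neq0 n (i : 'I_n) : 'X_i != 0 :> {mpoly K[n]}.
Proof.
apply/eqP => /(congr1 (mcoeff U_(i))) /eqP.
by rewrite mcoeffXU eqxx mcoeff0 oner_eq0.
Qed.

Definition subst n k (f : 'I_n -> {mpoly K[k]}) (p : {mpoly K[n]}) :
  {mpoly K[k]} := comp_mpoly [tuple f i | i < n] p.

HB.instance Definition _ n k (f : 'I_n -> {mpoly K[k]}) :=
  GRing.LRMorphism.copy (subst f) (comp_mpoly [tuple f i | i < n]).

Lemma substU n k (f : 'I_n -> {mpoly K[k]}) i : subst f 'X_i = f i.
Proof. by rewrite /subst comp_mpolyXU -tnth_nth tnth_mktuple. Qed.

Lemma substX n k (f : 'I_n -> {mpoly K[k]}) a :
  subst f 'X_[a] = \prod_(i < n) f i ^+ a i.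
Proof.
by rewrite /subst comp_mpolyX; apply: eq_bigr => i _; rewrite tnth_mktuple.
Qed.

Lemma eq_subst n k (f g : 'I_n -> {mpoly K[k]}) : f =1 g -> subst f =1 subst g.
Proof. by move=> fg p; rewrite /subst (eq_mktuple _ fg). Qed.

Lemma subst_comp n k l (f : 'I_n -> {mpoly K[k]}) (g : 'I_k -> {mpoly K[l]}) p :
  subst g (subst f p) = subst (fun i => subst g (f i)) p.
Proof.
elim/mpoly_mul_ind: p => [c p q hp hq||i p hp].
- by rewrite !linearP /= hp hq.
- by rewrite !rmorph1.
by rewrite !rmorphM /= hp !substU.
Qed.

Definition theta n (i : 'I_n) (p : {mpoly K[n]}) : {mpoly K[n]} :=
  'X_i * mderiv i p.

Lemma theta_is_linear n (i : 'I_n) : linear (theta i).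
Proof. by move=> c p q; rewrite /theta linearP mulrDr scalerAr. Qed.

HB.instance Definition _ n i :=
  GRing.isLinear.Build K {mpoly K[n]} {mpoly K[n]} _ (theta i)
    (theta_is_linear i).

Lemma thetaM n (i : 'I_n) p q : theta i (p * q) = theta i p * q + p * theta i q.
Proof. by rewrite /theta mderivM mulrDr; congr (_ + _); ring. Qed.

Lemma theta1 n (i : 'I_n) : theta i 1 = 0.
Proof. by rewrite /theta -mpolyC1 mderivC mulr0. Qed.

Lemma thetaXn n (i : 'I_n) p k :
  theta i (p ^+ k.+1) = p ^+ k * theta i p *+ k.+1.
Proof.
elim: k => [|k IHk]; first by rewrite !expr1 mulr1n mul1r.
by rewrite exprS thetaM IHk [RHS]mulrS [p ^+ k.+1]exprS; ring.
Qed.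

Lemma thetaX n (i : 'I_n) a : theta i 'X_[a] = (a i)%:R *: 'X_[a] :> {mpoly K[n]}.
Proof.
rewrite /theta mderivX -scalerAr -mpolyXD; case: (posnP (a i)) => [->|ai].
  by rewrite !scale0r.
congr (_ *: 'X_[_]); apply/mnmP => j; rewrite mnmDE mnmBE mnm1E.
by case: eqP => [<-|_]; rewrite ?add0n ?subn0 // subnKC.
Qed.

Lemma thetaU n (i j : 'I_n) : theta i 'X_j = (i == j)%:R *: 'X_j :> {mpoly K[n]}.
Proof. by rewrite thetaX mnm1E eq_sym. Qed.

Lemma theta_rename n k (f : 'I_n -> 'I_k) i p : injective f ->
  theta (f i) (subst (fun j => 'X_(f j)) p) = subst (fun j => 'X_(f j)) (theta i p).
Proof.
move=> finj; elim/mpoly_mul_ind: p => [c p q hp hq||j p hp].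
- by rewrite !linearP /= hp hq.
- by rewrite theta1 !rmorph1 linear0 theta1.
rewrite rmorphM /= substU !thetaM !thetaU hp (inj_eq finj).
by rewrite -!scalerAl rmorphD /= linearZ /= !rmorphM /= !substU.
Qed.

End MPolyTools.

Section Model.
Context {K : fieldType} {C : eqType}.
Variables (r : nat) (c : 'I_r -> C) (alpha beta : 'I_r -> K).
Local Notation M := {mpoly K[r]}.
Implicit Types (p f : M) (mk : C * nat).

(* Here mk = (m, k) stands for the element e_(k+1) of the copy m of L_1. *)
Definition opD mk p : M :=
  \sum_(s | c s == mk.1) 'X_s ^+ mk.2.+1 * theta s p.

Definition opE mk p : M :=
  \sum_(s | c s == mk.1)
    'X_s ^+ mk.2.+1 * (theta s p + (alpha s + mk.2.+1%:R * beta s) *: p).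

Lemma opE_linear mk : linear (opE mk).
Proof.
move=> a p q; rewrite /opE scaler_sumr -big_split; apply: eq_bigr => s _ /=.
rewrite linearP scalerDr !scalerA [_ * a]mulrC -!scalerA addrACA -scalerDr.
by rewrite mulrDr scalerAr.
Qed.

Lemma opD_linear mk : linear (opD mk).
Proof.
move=> a p q; rewrite /opD scaler_sumr -big_split; apply: eq_bigr => s _ /=.
by rewrite linearP mulrDr scalerAr.
Qed.

HB.instance Definition _ mk :=
  GRing.isLinear.Build K M M _ (opE mk) (opE_linear mk).
HB.instance Definition _ mk :=
  GRing.isLinear.Build K M M _ (opD mk) (opD_linear mk).

Lemma opEM mk f p : opE mk (f * p) = opD mk f * p + f * opE mk p.
Proof.
rewrite /opE /opD mulr_suml mulr_sumr -big_split; apply: eq_bigr => s _ /=.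
by rewrite thetaM scalerAr; ring.
Qed.

Lemma opDM mk f p : opD mk (f * p) = opD mk f * p + f * opD mk p.
Proof.
rewrite /opD mulr_suml mulr_sumr -big_split; apply: eq_bigr => s _ /=.
by rewrite thetaM; ring.
Qed.

Lemma opDXn mk f k : opD mk (f ^+ k.+1) = f ^+ k * opD mk f *+ k.+1.
Proof.
elim: k => [|k IHk]; first by rewrite !expr1 mulr1n mul1r.
by rewrite exprS opDM IHk [RHS]mulrS [f ^+ k.+1]exprS; ring.
Qed.

Lemma opEX mk a : opE mk 'X_[a] = \sum_(s | c s == mk.1)
  ((a s)%:R + alpha s + mk.2.+1%:R * beta s) *: 'X_[a + U_(s) *+ mk.2.+1].
Proof.
rewrite /opE; apply: eq_bigr => s _; rewrite thetaX -scalerDl addrA -scalerAr mpolyXD.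
by congr (_ *: _); rewrite mulrC mpolyXn.
Qed.

Definition colour_preserving (sigma : 'I_r -> 'I_r) :=
  injective sigma /\ forall s, c (sigma s) = c s.

Definition sym f : Prop := forall sigma, colour_preserving sigma ->
  subst (fun s => 'X_(sigma s)) f = f.

Lemma sym1 : sym 1. Proof. by move=> sigma _; rewrite rmorph1. Qed.

Lemma symM f p : sym f -> sym p -> sym (f * p).
Proof. by move=> hf hp sigma hs; rewrite rmorphM /= hf // hp. Qed.

Lemma symD f p : sym f -> sym p -> sym (f + p).
Proof. by move=> hf hp sigma hs; rewrite rmorphD /= hf // hp. Qed.

Lemma symX f k : sym f -> sym (f ^+ k).
Proof. by move=> hf sigma hs; rewrite rmorphXn /= hf. Qed.

Lemma symMn f k : sym f -> sym (f *+ k).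
Proof. by move=> hf sigma hs; rewrite raddfMn /= hf. Qed.

Lemma sym_opD mk f : sym f -> sym (opD mk f).
Proof.
move=> hf sigma hs; have [inj cs] := hs; rewrite /opD linear_sum /=.
rewrite [RHS](reindex_inj inj) /=; apply: eq_big => s; first by rewrite cs.
by move=> _; rewrite rmorphM rmorphXn /= substU -theta_rename // hf.
Qed.

Definition vars : M := \prod_s 'X_s.
Definition disc : M := \prod_s \prod_(t | (t != s) && (c t == c s)) ('X_s - 'X_t).
Definition qpol : M := vars * disc.

Lemma sym_vars : sym vars.
Proof.
move=> sigma [inj _]; rewrite rmorph_prod /= [RHS](reindex_inj inj) /=.
by apply: eq_bigr => s _; rewrite substU.
Qed.

Lemma sym_disc : sym disc.
Proof.
move=> sigma [inj cs]; rewrite rmorph_prod /= [RHS](reindex_inj inj) /=.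
apply: eq_bigr => s _; rewrite rmorph_prod [RHS](reindex_inj inj) /=.
apply: eq_big => t; first by rewrite (inj_eq inj) !cs.
by move=> _; rewrite rmorphB /= !substU.
Qed.

Lemma sym_qpol : sym qpol.
Proof. by apply: symM; [exact: sym_vars | exact: sym_disc]. Qed.

Definition sym_stable (N : M -> Prop) : Prop :=
  subspace N /\ forall f u, sym f -> N u -> N (f * u).

(** Its coefficients are, up to sign, the elementary symmetric polynomials in the variables coloured
    like s. Since X_s is a root, X_s is integral over the symmetric polynomials. *)
Definition orbit_poly (s : 'I_r) : {poly M} :=
  \prod_(t | c t == c s) ('X - ('X_t)%:P).

Lemma sym_orbit_poly s i : sym (orbit_poly s)`_i.
Proof.
move=> sigma [inj cs]; rewrite -coef_map /=.
suff E : map_poly (subst (fun t => 'X_(sigma t))) (orbit_poly s) = orbit_poly s.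
  by rewrite E.
rewrite /orbit_poly rmorph_prod [RHS](reindex_inj inj) /=.
apply: eq_big => t; first by rewrite cs.
by move=> _; rewrite rmorphB /= map_polyX map_polyC /= substU.
Qed.

Lemma orbit_polyP s : exists2 l, (l < r)%N &
  'X_s ^+ l.+1 = - \sum_(i < l.+1) (orbit_poly s)`_i * 'X_s ^+ i.
Proof.
have root0 : (orbit_poly s).['X_s] = 0.
  apply/rootP; rewrite /orbit_poly -big_filter.
  rewrite -(big_map (fun t => 'X_t) xpredT (fun x : M => 'X - x%:P)).
  rewrite root_prod_XsubC; apply/map_f.
  by rewrite mem_filter eqxx mem_index_enum.
have mon : orbit_poly s \is monic by apply: monic_prod => t _; exact: monicXsubC.
pose orb := [seq t <- index_enum 'I_r | c t == c s].
have sz : size (orbit_poly s) = (size orb).+1.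
  by rewrite /orbit_poly -big_filter size_prod_XsubC.
have : (0 < size orb <= r)%N.
  rewrite size_filter -has_count -[X in (_ <= X)%N](size_enum_ord r) enumT.
  rewrite count_size andbT.
  by apply/hasP; exists s; rewrite ?mem_index_enum.
case: (size orb) sz => // l sz /= lr; exists l => //.
move: root0; rewrite horner_coef sz big_ord_recr /=.
have -> : (orbit_poly s)`_l.+1 = 1 by move/monicP: mon; rewrite lead_coefE sz.
by rewrite mul1r addrC => /eqP; rewrite addr_eq0 => /eqP.
Qed.

Definition sym_gens : seq M :=
  flatten [seq (orbit_poly s : seq M) | s <- enum 'I_r].

Definition low_monomials : seq M :=
  [seq 'X_[[multinom (a i : nat) | i < r]] | a : {ffun 'I_r -> 'I_r}].

(** By integrality an exponent reaching r can be lowered with symmetric coefficients, the degree of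
    [orbit_poly] being at most r. So the span of the monomials with exponents below r absorbs every
    variable. *)
Lemma low_monomials_gen (N : M -> Prop) : es_stable sym_gens N ->
  (forall b, b \in low_monomials -> N b) -> forall u : M, N u.
Proof.
move=> hN bN u.
pose W : M -> Prop := generated (mulfam (@gens _ _ sym_gens)) low_monomials.
suff Wu : W u by apply: Wu => //; apply/gens_stable.
have hW : es_stable sym_gens W by apply/gens_stable/generated_stable.
have hW0 : subspace W by case: hW.
have Wlow (a : 'X_{1..r}) : (forall i, (a i < r)%N) -> W 'X_[a].
  move=> ar; apply: generated_mem.
  apply/mapP; exists [ffun i => Ordinal (ar i)]; first by rewrite mem_enum.
  by congr 'X_[_]; apply/mnmP => i; rewrite mnmE ffunE.
have WX s (v : M) : W v -> W ('X_s * v).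
  move: v; apply: (_ : forall v, _ -> (fun v => W ('X_s * v)) v) => v Wv.
  apply: (Wv (fun v => W ('X_s * v))) => [|w].
    apply/gens_stable; have [[W0 Wl] WG] := hW; split; [split|].
    - by rewrite mulr0.
    - by move=> a x y hx hy; rewrite mulrDr -scalerAr; apply: Wl.
    by move=> e x es hx; rewrite mulrCA; apply: WG.
  case/mapP => a _ ->; set b := [multinom _ | i < r].
  have br i : (b i < r)%N by rewrite mnmE.
  have [bs|bs] := ltnP (b s).+1 r.
    rewrite -mpolyXD; apply: Wlow => i; rewrite mnmDE mnm1E.
    by case: eqP => [<-|]; rewrite ?add1n ?add0n.
  have [l lr hl] := orbit_polyP s.
  have {bs}bsE : r = (b s).+1 by apply/eqP; rewrite eqn_leq bs br.
  pose b' := (b - U_(s) *+ b s)%MM.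
  have bE : b = (b' + U_(s) *+ b s)%MM.
    apply/mnmP => i; rewrite mnmDE mnmBE mulmnE mnm1E.
    by case: eqP => [<-|]; rewrite ?mul1n ?mul0n ?subnn ?subn0 ?addn0.
  have -> : 'X_s * 'X_[b] = - \sum_(i < l.+1)
      (orbit_poly s)`_i * 'X_[b' + U_(s) *+ (i + (r - l.+1))] :> M.
    transitivity ('X_s ^+ l.+1 * 'X_s ^+ (r - l.+1) * 'X_[b'] : M).
      have -> : forall x : M, x ^+ l.+1 * x ^+ (r - l.+1) = x ^+ (b s).+1.
        by move=> x; rewrite -exprD subnKC // -bsE.
      rewrite exprS -mulrA; congr (_ * _).
      by rewrite {1}bE mpolyXD mulrC mpolyXn.
    rewrite hl !mulNr !mulr_suml; congr (- _); apply: eq_bigr => i _.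
    by rewrite mpolyXD -mpolyXn exprD; ring.
  apply: (subspaceN hW0).
  refine (@subspace_sum _ _ W _ _ _ _ hW0 _) => i _.
  have [hi|hi] := ltnP i (size (orbit_poly s)); last first.
    by rewrite nth_default // mul0r; case: hW => -[].
  have [_ h] := hW; apply: h.
    apply/flattenP; exists (orbit_poly s : seq M); last exact: mem_nth.
    by apply: map_f; rewrite mem_enum.
  apply: Wlow => j; rewrite mnmDE mulmnE mnm1E mnmBE mulmnE mnm1E.
  have [<-|_] := eqVneq s j; last by rewrite !mul0n subn0 addn0; apply: br.
  by rewrite !mul1n subnn add0n -[X in (_ < X)%N](subnKC lr) ltn_add2r.
move: u; apply: (@mpoly_mul_ind K r W) => [a p q hp hq||].
- by case: hW => -[_ h] _; apply: h.
- rewrite -mpolyX0; have [r0|r0] := posnP r; last first.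
    by apply: Wlow => i; rewrite mnm0E.
  by apply: Wlow => i; move: (ltn_ord i); rewrite [X in (_ < X)%N]r0.
exact: WX.
Qed.

Lemma sym_fg (N : M -> Prop) : sym_stable N -> exists s : seq M,
  (forall u, u \in s -> N u) /\
  forall N', sym_stable N' -> (forall u, u \in s -> N' u) ->
  forall u, N u -> N' u.
Proof.
have sub N' : sym_stable N' -> es_stable sym_gens N'.
  case=> hN' h; split=> // e u /flattenP[_ /mapP[s _ ->] /(nthP 0)[i _ <-]].
  by apply: h; exact: sym_orbit_poly.
move=> /sub hN; have [s [sN hs]] := hilbert low_monomials_gen hN.
by exists s; split=> // N' /sub; exact: hs.
Qed.


End Model.

(** * Quotients by products of linear forms *)

(* [freeg] exports another [lift]. *)
Local Notation lift := fintype.lift.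

Section Ideals.
Context {K : fieldType} {r : nat}.
Local Notation M := {mpoly K[r]}.
Implicit Types (f g p : M).

Definition ideal f : M -> Prop := fun p => exists q, p = f * q.

Lemma ideal_subspace f : subspace (ideal f).
Proof.
split=> [|a _ _ [u ->] [v ->]]; first by exists 0; rewrite mulr0.
by exists (a *: u + v); rewrite mulrDr scalerAr.
Qed.

Definition prime_poly f : Prop :=
  [/\ f != 0, ~ ideal f 1 & forall p q, ideal f (p * q) -> ideal f p \/ ideal f q].

Lemma prime_prod f (gs : seq M) : prime_poly f ->
  ideal f (\prod_(g <- gs) g) -> exists2 g, g \in gs & ideal f g.
Proof.
move=> [_ f1 fp]; elim: gs => [|g gs IHgs]; first by rewrite big_nil => /f1.
rewrite big_cons => /fp[fg|/IHgs[g' g's ?]]; first by exists g; rewrite ?inE ?eqxx.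
by exists g'; rewrite // inE g's orbT.
Qed.

Lemma prime_exp f g k : prime_poly f -> ideal f (g ^+ k) -> ideal f g.
Proof.
move=> [_ f1 fp]; elim: k => [|k IHk]; first by rewrite expr0 => /f1.
by rewrite exprS => /fp[].
Qed.

Lemma prime_cancel f P k v : prime_poly f -> ~ ideal f P ->
  ideal (f ^+ k) (P * v) -> ideal (f ^+ k) v.
Proof.
move=> [f0 _ fp] fP; elim: k v => [|k IHk] v [u pE].
  by exists v; rewrite mul1r.
have [|//|[v' vE]] := fp P v; first by exists (f ^+ k * u); rewrite pE exprS mulrA.
have [|w wE] := IHk v'; last by exists w; rewrite vE wE exprS mulrA.
by exists u; apply: (mulfI f0); rewrite mulrCA -vE pE exprS mulrA.
Qed.

(** For pairwise non-associated primes, the intersection of the (f^k) is generated by the k-th power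
    of their product. *)
Lemma ideal_prod_pow (fs : seq M) k :
  (forall f, f \in fs -> prime_poly f) -> uniq fs ->
  (forall f g, f \in fs -> g \in fs -> ideal f g -> f = g) ->
  forall p, (forall f, f \in fs -> ideal (f ^+ k) p) ->
  ideal ((\prod_(f <- fs) f) ^+ k) p.
Proof.
elim: fs => [|f fs IHfs] prime ufs copr p hp.
  by exists p; rewrite big_nil expr1n mul1r.
have /andP[ffs {}ufs] : (f \notin fs) && uniq fs := ufs.
have [|||v pE] := IHfs _ ufs _ p.
- by move=> g gfs; apply: prime; rewrite inE gfs orbT.
- by move=> g g' hg hg'; apply: copr; rewrite inE ?hg ?hg' orbT.
- by move=> g gfs; apply: hp; rewrite inE gfs orbT.
have ffs' : f \in f :: fs by rewrite inE eqxx.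
have hf := prime f ffs'.
rewrite big_cons; set P := \prod_(f <- fs) f in pE *.
have nP : ~ ideal f (P ^+ k).
  move=> /(prime_exp hf)/(prime_prod hf)[g gfs fg].
  by move: ffs; rewrite (copr f g) ?gfs // inE gfs orbT.
have := hp f ffs'; rewrite pE => /(prime_cancel hf nP)[w ->].
by exists w; rewrite exprMn; ring.
Qed.

End Ideals.

Section Quotients.
Context {K : fieldType} {C : eqType}.

Section Ideal.
Variables (r : nat) (c : 'I_r -> C) (alpha beta : 'I_r -> K).
Local Notation M := {mpoly K[r]}.
Implicit Types (f g p : M).
Local Notation E := (opE c alpha beta).

Lemma ideal_stable f : (forall mk, ideal f (opD c mk f)) -> stable E (ideal f).
Proof.
move=> hf; split=> [|mk _ [p ->]]; first exact: ideal_subspace.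
have [g fg] := hf mk; exists (g * p + E mk p).
by rewrite opEM fg mulrDr mulrA.
Qed.

Lemma opD_exp_ideal mk f k : ideal f (opD c mk f) ->
  exists2 g, opD c mk f = f * g & opD c mk (f ^+ k) = f ^+ k * (g *+ k).
Proof.
case=> g fg; exists g => //; case: k => [|k].
  rewrite expr0 mulr0n mulr0 /opD big1 // => s _.
  by rewrite theta1 mulr0.
by rewrite opDXn fg mulrA -exprSr -mulrnAr.
Qed.

Lemma opDU mk s : opD c mk ('X_s : M) = 'X_s * ('X_s ^+ mk.2.+1 *+ (c s == mk.1)).
Proof.
rewrite /opD; case: eqP => [<-|/eqP cs]; last first.
  rewrite mulr0n mulr0; apply: big1 => t ct; rewrite thetaU.
  by case: (eqVneq t s) ct => [->|_]; rewrite ?(negPf cs) // scale0r mulr0.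
rewrite (bigD1 s) //= thetaU eqxx scale1r big1 ?addr0 => [|t /andP[_ ts]].
  by rewrite mulr1n mulrC.
by rewrite thetaU (negPf ts) scale0r mulr0.
Qed.

Lemma opDUB mk s t : c s = c t -> opD c mk ('X_s - 'X_t : M) =
  ('X_s - 'X_t) * ((\sum_(i < mk.2.+2) 'X_s ^+ (mk.2.+1 - i) * 'X_t ^+ i)
    *+ (c s == mk.1)).
Proof.
move=> cst; rewrite raddfB /= !opDU -cst; case: eqP => _; last first.
  by rewrite !mulr0n !mulr0 subrr.
by rewrite !mulr1n -!exprS subrXX.
Qed.

End Ideal.

Section Step.
Variables (r : nat) (c : 'I_r.+1 -> C) (alpha beta : 'I_r.+1 -> K).
Variables (s : 'I_r.+1) (eta : {mpoly K[r]}).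
Local Notation M := {mpoly K[r.+1]}.
Local Notation M' := {mpoly K[r]}.
Local Notation E := (opE c alpha beta).

(** [psi] restricts to the hypersurface X_s = eta, [iota] is its section by polynomials free of X_s,
    and the kernel of [psi] is the ideal of [ell]. *)
Local Notation iota := (@subst K r r.+1 (fun j => 'X_(lift s j))).
Local Notation psi :=
  (@subst K r.+1 r (fun v => if unlift s v is Some j then 'X_j else eta)).
Local Notation ell := ('X_s - iota eta).

Lemma psi_iota (p : M') : psi (iota p) = p.
Proof.
rewrite subst_comp; elim/(@mpoly_mul_ind K r): p => [a p q hp hq||i p hp].
- by rewrite linearP /= hp hq.
- by rewrite rmorph1.
by rewrite rmorphM /= hp substU substU liftK.
Qed.

Lemma psi_ell : psi ell = 0.
Proof.
by rewrite rmorphB /= psi_iota substU unlift_none subrr.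
Qed.

Lemma iota_psi (p : M) : ideal ell (p - iota (psi p)).
Proof.
elim/(@mpoly_mul_ind K r.+1): p => [a p q [x hx] [y hy]||i p [x hx]].
- by exists (a *: x + y); rewrite linearP /= linearP /= opprD addrACA -scalerBr hx hy; rewrite mulrDr scalerAr.
- by exists 0; rewrite !rmorph1 subrr mulr0.
have [y hy] : ideal ell ('X_i - iota (psi 'X_i)).
  rewrite substU; case: unliftP => [j|] ->.
    by exists 0; rewrite substU subrr mulr0.
  by exists 1; rewrite mulr1.
exists ('X_i * x + y * iota (psi p)); rewrite !rmorphM /= mulrDr mulrCA -hx.
by rewrite mulrA -hy; ring.
Qed.

Lemma ideal_psi (p : M) : ideal ell p <-> psi p = 0.
Proof.
split=> [[q ->]|p0]; first by rewrite rmorphM /= psi_ell mul0r.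
by have := iota_psi p; rewrite p0 raddf0 subr0.
Qed.

Lemma ell_prime : ell != 0 -> prime_poly ell.
Proof.
move=> ell0; split=> // [/ideal_psi /eqP|p q /ideal_psi].
  by rewrite rmorph1 oner_eq0.
rewrite rmorphM => /eqP; rewrite mulf_eq0 => /orP[] /eqP ?; [left | right];
  exact/ideal_psi.
Qed.

Lemma theta_iota (p : M') : theta s (iota p) = 0.
Proof.
elim/(@mpoly_mul_ind K r): p => [a p q hp hq||i p hp].
- by rewrite !linearP /= hp hq scaler0 addr0.
- by rewrite rmorph1 theta1.
rewrite rmorphM /= thetaM hp mulr0 addr0 substU thetaU.
by rewrite (negPf (neq_lift _ _)) scale0r mul0r.
Qed.

Lemma psi_opE mk (p : M') : psi (E mk (iota p)) =
  opE (fun j => c (lift s j)) (fun j => alpha (lift s j))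
    (fun j => beta (lift s j)) mk p
  + (alpha s + mk.2.+1%:R * beta s) *: (eta ^+ mk.2.+1 * p) *+ (c s == mk.1).
Proof.
rewrite /opE (bigID (pred1 s)) /= addrC rmorphD /=; congr (_ + _).
  rewrite (reindex_omap (lift s) (unlift s)) => [|v /andP[_]]; last first.
    by case: unliftP => [j|] -> //; rewrite eqxx.
  rewrite rmorph_sum; apply: eq_big => j.
    by rewrite liftK eqxx (eq_sym _ s) neq_lift !andbT.
  move=> _; rewrite rmorphM rmorphXn rmorphD /= linearZ /= psi_iota.
  rewrite substU liftK theta_rename; last exact: lift_inj.
  by rewrite psi_iota.
case: eqP => [cs|/eqP cs]; last first.
  rewrite big1 ?raddf0 // => v /andP[cv /eqP vs].
  by rewrite vs (negPf cs) in cv.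
rewrite (big_pred1 s) => [|v]; last first.
    by rewrite /= andbC; case: (eqVneq v s) => [->|]; rewrite ?cs ?eqxx.
rewrite theta_iota add0r rmorphM rmorphXn /= linearZ /= psi_iota.
by rewrite substU unlift_none -scalerAr mulr1n.
Qed.

Variables (alpha' beta' : 'I_r -> K) (g : C * nat -> M) (k : nat).
Local Notation E' := (@opE K C r (fun j => c (lift s j)) alpha' beta').
Hypothesis ell_opD : forall mk, opD c mk ell = ell * g mk.
Hypothesis reduced : forall mk p,
  E' mk p = psi (E mk (iota p)) + psi (g mk) * p *+ k.
Hypothesis noethE' : noeth E' whole null.

(** Multiplication by ell^k maps functions on the hypersurface onto this quotient. Differentiating
    ell^k adds the multiplication by k g, and by [reduced] the resulting operator is again of model
    type. *)
Lemma noeth_step : noeth E (ideal (ell ^+ k)) (ideal (ell ^+ k.+1)).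
Proof.
have opDX l mk : opD c mk (ell ^+ l) = ell ^+ l * (g mk *+ l).
  case: l => [|l]; first by rewrite expr0 /opD mulr0n mulr0 big1 // => v _; rewrite theta1 mulr0.
  by rewrite opDXn ell_opD mulrA -exprSr -mulrnAr.
apply: (@noeth_image _ _ _ _ E E' (fun p => ell ^+ k * iota p)).
- by apply: ideal_stable => mk; exists (g mk *+ k.+1).
- exact: opE_linear.
- by move=> a x y; rewrite linearP /= mulrDr scalerAr.
- move=> _ [q ->]; exists (psi q); have [x hx] := iota_psi q.
  by exists x; rewrite -mulrBr hx exprSr mulrA.
- move=> mk p; rewrite opEM opDX.
  suff [x hx] : ideal ell (iota (E' mk p) - (g mk *+ k * iota p + E mk (iota p))).
    by exists x; rewrite exprSr -!mulrA -hx; ring.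
  apply/ideal_psi; rewrite rmorphB rmorphD rmorphM /= !psi_iota reduced raddfMn /=.
  by rewrite mulrnAl [X in _ - X]addrC subrr.
exact: noeth_fg.
Qed.

End Step.

Lemma noeth_powers r (c : 'I_r -> C) alpha beta (f : {mpoly K[r]}) :
  (forall mk, ideal f (opD c mk f)) ->
  (forall k, noeth (opE c alpha beta) (ideal (f ^+ k)) (ideal (f ^+ k.+1))) ->
  forall k, noeth (opE c alpha beta) whole (ideal (f ^+ k)).
Proof.
move=> hf step; elim=> [|k IHk].
  have h := @noeth_refl _ _ _ (opE c alpha beta) (ideal (f ^+ 0)).
  by apply: (noeth_mono _ _ h) => // p _; exists p; rewrite mul1r.
apply: (noeth_trans _ IHk (step k)); apply: ideal_stable => mk.
by have [g _ ->] := opD_exp_ideal k (hf mk); exists (g *+ k).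
Qed.

Section Forms.
Variables (r' : nat) (c' : 'I_r'.+1 -> C) (alpha' beta' : 'I_r'.+1 -> K).
Local Notation M := {mpoly K[r'.+1]}.
Local Notation E := (opE c' alpha' beta').
Hypothesis IH' : forall (c : 'I_r' -> C) (alpha beta : 'I_r' -> K),
  noeth (opE c alpha beta) whole null.

Lemma noeth_var s k : noeth E whole (ideal (('X_s : M) ^+ k)).
Proof.
apply: noeth_powers => [mk|{}k].
  by exists ('X_s ^+ mk.2.+1 *+ (c' s == mk.1)); rewrite opDU.
have ellE : 'X_s - @subst K r' r'.+1 (fun j => 'X_(lift s j)) 0 = 'X_s.
  by rewrite raddf0 subr0.
have := @noeth_step r' c' alpha' beta' s 0 (fun j => alpha' (lift s j))
  (fun j => beta' (lift s j)) (fun mk => 'X_s ^+ mk.2.+1 *+ (c' s == mk.1)) k.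
rewrite ellE; apply=> [mk|mk p|]; [exact: opDU | | exact: IH'].
rewrite psi_opE raddfMn /= rmorphXn /= substU unlift_none.
by rewrite expr0n /= mul0r scaler0 !mul0rn addr0 mul0r mul0rn addr0.
Qed.

Lemma noeth_diff s t k : s != t -> c' s = c' t ->
  noeth E whole (ideal (('X_s - 'X_t : M) ^+ k)).
Proof.
move=> st cst.
apply: noeth_powers => [mk|{}k].
  by eexists; apply: opDUB.
have [t0 tE] : exists t0, t = lift s t0 by have [t0 ->] := unlift_some st; exists t0.
have ellE : 'X_s - @subst K r' r'.+1 (fun j => 'X_(lift s j)) 'X_t0 = 'X_s - 'X_t.
  by rewrite substU tE.
pose g mk : {mpoly K[r'.+1]} := (\sum_(i < mk.2.+2) 'X_s ^+ (mk.2.+1 - i) * 'X_t ^+ i)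
    *+ (c' s == mk.1 :> C).
(* The fused variable carries the summands of both s and t. As g restricts to (l + 1) X_t0^l for the
   letter e_l, the factor ell^k contributes k + l k, that is k to alpha and k to beta. *)
have := @noeth_step r' c' alpha' beta' s 'X_t0
  (fun j => if j == t0 then alpha' t + alpha' s + k%:R else alpha' (lift s j))
  (fun j => if j == t0 then beta' t + beta' s + k%:R else beta' (lift s j)) g k.
rewrite ellE; apply=> [mk|mk p|]; [exact: opDUB | | exact: IH'].
rewrite psi_opE.
have -> : @subst K r'.+1 r' (fun v => if unlift s v is Some j then 'X_j else 'X_t0) (g mk)
    = 'X_t0 ^+ mk.2.+1 *+ mk.2.+2 *+ (c' s == mk.1).
  rewrite /g raddfMn /= rmorph_sum /=; congr (_ *+ _).
  rewrite (eq_bigr (fun=> 'X_t0 ^+ mk.2.+1)) ?sumr_const ?card_ord // => i _.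
  rewrite rmorphM !rmorphXn /= !substU tE unlift_none liftK -exprD subnK //.
  by rewrite -ltnS.
have [ct|ct] := eqVneq (c' s) mk.1; last first.
  rewrite !mulr0n mul0r mul0rn !addr0; apply: eq_bigr => j cj.
  case: (eqVneq j t0) cj => // ->; by rewrite -tE -cst (negPf ct).
have c0 : c' (lift s t0) == mk.1 by rewrite -tE -cst ct.
rewrite !mulr1n /opE [LHS](bigD1 t0) //= [in RHS](bigD1 t0) //= eqxx -tE.
rewrite [X in _ + X = _](eq_bigr (fun j => 'X_j ^+ mk.2.+1 * (theta j p
  + (alpha' (lift s j) + mk.2.+1%:R * beta' (lift s j)) *: p))); last first.
  by move=> j /andP[_ /negPf ->].
rewrite -!mul_mpolyC !(mpolyCD, mpolyCM, mpolyC_nat).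
rewrite -(mulr_natr (_ * p) k) -(mulr_natr ('X_t0 ^+ _) mk.2.+2).
rewrite -[mk.2.+2%:R]natr1; ring.
Qed.

End Forms.

Lemma prime_var r (s : 'I_r) : prime_poly ('X_s : {mpoly K[r]}).
Proof.
case: r s => [|r] s; first by case: s.
have := @ell_prime r s 0; rewrite raddf0 subr0; apply.
exact: mpolyXU_neq0.
Qed.

Lemma prime_diff r (s t : 'I_r) : s != t ->
  prime_poly ('X_s - 'X_t : {mpoly K[r]}).
Proof.
case: r s t => [|r] s t st; first by case: s st.
have [t0 tE] : exists t0, t = lift s t0 by have [t0 ->] := unlift_some st; exists t0.
have := @ell_prime r s 'X_t0; rewrite substU -tE; apply.
by rewrite subr_eq0; apply: contra_neq st => /mpolyXU_inj.
Qed.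

Section Discriminant.
Variables (r : nat) (c : 'I_r -> C).
Local Notation M := {mpoly K[r]}.

Definition forms : seq M :=
  [seq 'X_s | s : 'I_r] ++ [seq 'X_p.1 - 'X_p.2
    | p : 'I_r * 'I_r <- enum {: 'I_r * 'I_r} & (p.1 < p.2)%N && (c p.1 == c p.2)].

Variant forms_spec : M -> Prop :=
| FormsVar s : forms_spec 'X_s
| FormsDiff (s t : 'I_r) of (s < t)%N & c s = c t : forms_spec ('X_s - 'X_t).

Lemma formsP f : f \in forms -> forms_spec f.
Proof.
rewrite mem_cat => /orP[/mapP[s _ ->]|/mapP[[s t]]]; first exact: FormsVar.
by rewrite mem_filter /= => /andP[/andP[st /eqP cst] _] ->; exact: FormsDiff.
Qed.

Lemma mpolyXUB_eq0 (s t : 'I_r) : ('X_s - 'X_t : M) = 0 -> s = t.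
Proof. by move/subr0_eq/mpolyXU_inj. Qed.

(** A multiple of f dies under the substitution killing f, X_s := 0 or X_s := X_t; the other forms
    survive it. *)
Lemma forms_coprime f g : f \in forms -> g \in forms -> ideal f g -> f = g.
Proof.
have ev (h : 'I_r -> M) f' g' : subst h f' = 0 -> ideal f' g' -> subst h g' = 0.
  by move=> hf [q ->]; rewrite rmorphM /= hf mul0r.
have X0 (s : 'I_r) : ('X_s : M) <> 0 by apply/eqP/mpolyXU_neq0.
case/formsP => [s|s t st _] /formsP[u|u v uv _] fg.
- have := ev (fun w => if w == s then 0 else 'X_w) _ _ _ fg.
  rewrite !substU eqxx => /(_ erefl).
  by case: eqP => [->|_ /X0].
- have := ev (fun w => if w == s then 0 else 'X_w) _ _ _ fg.
  rewrite rmorphB /= !substU eqxx => /(_ erefl).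
  case: eqP uv => [->|_]; case: eqP => [->|_]; rewrite ?ltnn //.
  + by move=> _ /eqP; rewrite sub0r oppr_eq0 => /eqP/X0.
  + by move=> _; rewrite subr0 => /X0.
  by move=> uv /mpolyXUB_eq0 E; rewrite E ltnn in uv.
- have := ev (fun w => if w == s then 'X_t else 'X_w) _ _ _ fg.
  rewrite rmorphB /= !substU eqxx.
  have [ts|_] := eqVneq t s; first by rewrite ts ltnn in st.
  by rewrite subrr => /(_ erefl); case: eqP => [_ /X0|_ /X0].
have := ev (fun w => if w == s then 'X_t else 'X_w) _ _ _ fg.
rewrite !rmorphB /= !substU eqxx.
have [ts|_] := eqVneq t s; first by rewrite ts ltnn in st.
rewrite subrr => /(_ erefl).
case: (eqVneq u s) uv => [->|us]; case: (eqVneq v s) => [->|vs] uv.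
- by rewrite ltnn in uv.
- by move/mpolyXUB_eq0 => ->.
- by move/mpolyXUB_eq0 => E; move: uv; rewrite E ltnNge ltnW.
by move/mpolyXUB_eq0 => E; rewrite E ltnn in uv.
Qed.

Lemma forms_prime f : f \in forms -> prime_poly f.
Proof.
case/formsP => [s|s t st _]; first exact: prime_var.
by apply: prime_diff; rewrite neq_ltn st.
Qed.

Lemma forms_uniq : uniq forms.
Proof.
rewrite cat_uniq; apply/and3P; split.
- by rewrite map_inj_uniq ?enum_uniq //; exact: mpolyXU_inj.
- apply/hasPn => f /mapP[[s t]]; rewrite mem_filter /= => /andP[/andP[st _] _] ->.
  apply/mapP => -[u _ E].
  have := congr1 (subst (fun w => if w == s then 'X_t else 'X_w : M)) E.
  rewrite rmorphB /= !substU eqxx.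
  have [ts|_] := eqVneq t s; first by rewrite ts ltnn in st.
  rewrite subrr => /esym; case: eqP => _ /eqP;
  by rewrite (negPf (mpolyXU_neq0 _)).
rewrite map_inj_in_uniq; first by apply: filter_uniq; exact: enum_uniq.
move=> [s t] [u v].
rewrite !mem_filter /= => /andP[/andP[st _] _] /andP[/andP[uv _] _] E.
have := congr1 (subst (fun w => if w == s then 'X_t else 'X_w : M)) E.
rewrite !rmorphB /= !substU eqxx.
have [ts|_] := eqVneq t s; first by rewrite ts ltnn in st.
rewrite subrr => /esym.
case: (eqVneq u s) uv => [->|us]; case: (eqVneq v s) => [->|vs] uv.
- by rewrite ltnn in uv.
- by move/mpolyXUB_eq0 => ->.
- by move/mpolyXUB_eq0 => E'; move: uv; rewrite E' ltnNge ltnW.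
by move/mpolyXUB_eq0 => E'; rewrite E' ltnn in uv.
Qed.

(** [disc] runs over ordered pairs, so each difference occurs twice in it up to sign, against once
    in [forms]; [e0] is the total sign. *)
Lemma prod_forms : ideal (qpol c) ((\prod_(f <- forms) f) ^+ 2).
Proof.
pose G (s t : 'I_r) : M := if c t == c s then 'X_s - 'X_t else 1.
pose e (s t : 'I_r) : M := if c t == c s then - 1 else 1.
pose cut (b : bool) (x : M) := if b then x else 1.
pose D : M := \prod_(s < r) \prod_(t < r) cut (s < t)%N (G s t).
have formsE : \prod_(f <- forms) f = vars r * D.
  rewrite big_cat; congr (_ * _); first by rewrite big_map big_enum.
  rewrite big_map big_filter big_enum_cond /D pair_bigA [LHS]big_mkcond.
  by apply: eq_bigr => -[s t] _ /=; rewrite /G /cut eq_sym; case: ltnP.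
pose e0 : M := \prod_(s < r) \prod_(t < r) cut (s < t)%N (e t s).
have discE : @disc K C r c = e0 * D ^+ 2.
  transitivity (D * \prod_(s < r) \prod_(t < r) cut (t < s)%N (G s t)).
    rewrite /disc /D -big_split /=; apply: eq_bigr => s _.
    rewrite big_mkcond -big_split /=; apply: eq_bigr => t _.
    rewrite /cut /G -val_eqE /=; case: ltngtP => _ //=; rewrite ?mulr1 ?mul1r //.
  rewrite [X in _ * X]exchange_big /= mulrC expr2 mulrA; congr (_ * _).
  rewrite /e0 /D -big_split /=; apply: eq_bigr => s _.
  rewrite -big_split /=; apply: eq_bigr => t _; rewrite /cut.
  case: ltnP => _; rewrite ?mulr1 // /G /e eq_sym.
  by case: eqP => _; rewrite ?mulN1r ?opprB ?mul1r.
have e02 : e0 ^+ 2 = 1.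
  rewrite -prodrXl big1 // => s _; rewrite -prodrXl big1 // => t _.
  by rewrite /cut /e; case: (s < t)%N; case: (c s == c t); rewrite ?sqrrN expr1n.
exists (vars r * e0); rewrite formsE /qpol discE.
transitivity (vars r ^+ 2 * (e0 ^+ 2 * D ^+ 2)); last by ring.
by rewrite e02 mul1r exprMn.
Qed.

End Discriminant.

(** The intersection of the (f^(2k)), f a linear form, is generated by the (2k)-th power of their
    product, which q^k divides; [noeth_meet] handles the intersection. *)
Lemma noeth_qpol r (c : 'I_r -> C) (alpha beta : 'I_r -> K) :
  (forall r', (r' < r)%N -> forall (c' : 'I_r' -> C) (alpha' beta' : 'I_r' -> K),
    noeth (opE c' alpha' beta') whole null) ->
  forall k, noeth (opE c alpha beta) whole (ideal (qpol c ^+ k)).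
Proof.
move=> IH k.
have one f : f \in forms c -> noeth (opE c alpha beta) whole (ideal (f ^+ (2 * k))) /\
    stable (opE c alpha beta) (ideal (f ^+ (2 * k))).
  move=> hf; suff [h1 h2] : noeth (opE c alpha beta) whole (ideal (f ^+ (2 * k)))
      /\ forall mk, ideal f (opD c mk f).
    split=> //; apply: ideal_stable => mk.
    by have [g _ ->] := opD_exp_ideal (2 * k) (h2 mk); exists (g *+ (2 * k)).
  case/formsP: hf => [s|s t st cst].
    split; last by move=> mk; eexists; apply: opDU.
    case: r c alpha beta IH {f} s => [|r'] c' alpha' beta' IH s; first by case: s.
    by apply: noeth_var => c'' a b; apply: IH.
  split; last by move=> mk; eexists; apply: opDUB.
  case: r c alpha beta IH {f} s t st cst => [|r'] c' alpha' beta' IH s t st cst.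
    by case: s st cst.
  apply: noeth_diff => // [c'' a b|]; first exact: IH.
  by rewrite neq_ltn st.
have all (s : seq {mpoly K[r]}) : {subset s <= forms c} -> noeth (opE c alpha beta) whole
    (fun p => forall f, f \in s -> ideal (f ^+ (2 * k)) p).
  elim: s => [|f s IHs] sub.
    move=> N hN _; exists [::]; split=> // N' [[N'0 _] _] _ p _.
    by exists 0.
  have [|h1 h2] := one f; first by apply: sub; rewrite inE eqxx.
  have h3 := IHs (fun g gs => sub g (mem_behead (s := f :: s) gs)).
  apply: (noeth_mono _ _ (noeth_meet h2 h1 h3)) => // p [hf hs] g.
  by rewrite inE => /orP[/eqP->|/hs].
apply: (noeth_mono _ _ (all (forms c) _)) => // p hp.
have := ideal_prod_pow (forms_prime (c := c)) (forms_uniq c) (forms_coprime (c := c)) hp.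
case=> q ->; have [x hx] := prod_forms c.
by exists (x ^+ k * q); rewrite exprM hx exprMn mulrA.
Qed.

End Quotients.

(** * Expanding a composition of sums over choice functions *)

Section Distribute.
Variables (I J : finType) (V : zmodType) (phi0 : {ffun J -> I}).
Variables (Q : J -> pred I) (G : J -> I -> V -> V).
Hypothesis G_add : forall j i, {morph G j i : x y / x + y}.
Hypothesis G0 : forall j i, G j i 0 = 0.

Definition setf (phi : {ffun J -> I}) j i : {ffun J -> I} :=
  [ffun x => if x == j then i else phi x].

Fixpoint choices (js : seq J) : seq {ffun J -> I} :=
  if js is j :: js' then
    [seq setf phi j i | i <- enum (Q j), phi <- choices js']
  else [:: phi0].

Lemma foldr_sum js v : uniq js ->
  foldr (fun j v => \sum_(i | Q j i) G j i v) v js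
  = \sum_(phi <- choices js) foldr (fun j v => G j (phi j) v) v js.
Proof.
elim: js => [|j js IHjs] /=; first by rewrite big_seq1.
case/andP=> jjs ujs; rewrite big_allpairs_dep /= IHjs // -big_enum.
apply: eq_bigr => i _; rewrite (big_morph (G j i) (G_add j i) (G0 j i)).
apply: eq_bigr => phi _; rewrite ffunE eqxx; congr (G j i _).
elim: js jjs {IHjs ujs} => [|j' js IHjs] //=; rewrite inE negb_or => /andP[jj' jjs].
by rewrite IHjs // ffunE eq_sym (negPf jj').
Qed.

Lemma choicesP js phi : (forall j, Q j (phi0 j)) -> phi \in choices js ->
  forall j, Q j (phi j).
Proof.
move=> h0; elim: js phi => [|j js IHjs] phi /=; first by rewrite inE => /eqP->.
case/allpairsP => -[i phi'] /= [+ /IHjs hphi' -> j']; rewrite mem_enum => Qi.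
by rewrite ffunE; case: eqP => [->|_].
Qed.

Lemma mem_choices js : (forall j, Q j (phi0 j)) -> phi0 \in choices js.
Proof.
move=> h0; elim: js => [|j js IHjs] /=; first by rewrite inE.
apply/allpairsP; exists (phi0 j, phi0); split=> //=; first by rewrite mem_enum; apply: h0.
by apply/ffunP => x; rewrite ffunE; case: eqP => [->|].
Qed.

End Distribute.

(** * Operators diagonal on monomials *)

Section Diagonal.
Context {K : fieldType} {r : nat}.
Implicit Types (pi : 'X_{1..r} -> K) (u : {mpoly K[r]}).

Definition mdiag pi u : {mpoly K[r]} :=
  \sum_(a <- msupp u) (u@_a * pi a) *: 'X_[a].

Lemma mcoeff_mdiag pi u a : (mdiag pi u)@_a = u@_a * pi a.
Proof.
rewrite /mdiag raddf_sum /=.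
under eq_bigr => b _ do rewrite mcoeffZ mcoeffX.
have [ua|ua] := boolP (a \in msupp u).
  rewrite (bigD1_seq a) ?msupp_uniq //= eqxx mulr1 big1 ?addr0 // => b /negPf ->.
  by rewrite mulr0.
rewrite (memN_msupp_eq0 ua) mul0r big_seq big1 // => b ub.
by case: (eqVneq b a) ub => [->|_ _]; rewrite ?mulr0 // (negPf ua).
Qed.

(* As pi takes finitely many values on the support of u, none of them zero, u  *)
(* is a combination of its images under the positive powers of mdiag pi.       *)
Lemma mdiag_recover pi (N : {mpoly K[r]} -> Prop) u : subspace N ->
  (forall a, a \in msupp u -> pi a != 0) ->
  (forall k, N (mdiag (fun a => pi a ^+ k.+1) u)) -> N u.
Proof.
move=> hN pi0 hpi.
pose p : {poly K} := \prod_(a <- msupp u) ('X - (pi a)%:P).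
have pE x : root p x = (x \in [seq pi a | a <- msupp u]).
  by rewrite /p -(big_map pi xpredT (fun x => 'X - x%:P)) root_prod_XsubC.
have pa a : a \in msupp u -> p.[pi a] = 0.
  by move=> ua; apply/rootP; rewrite pE map_f.
have p0 : p`_0 != 0.
  rewrite -horner_coef0; apply/rootP => /rootP; rewrite pE => /mapP[a ua E].
  by have := pi0 a ua; rewrite -E eqxx.
have -> : u = - (p`_0)^-1 *: \sum_(i < (size p).-1) p`_i.+1 *: mdiag (fun a => pi a ^+ i.+1) u.
  apply/mpolyP => a; rewrite mcoeffZ raddf_sum /=.
  have [ua|ua] := boolP (a \in msupp u); last first.
    rewrite (memN_msupp_eq0 ua) big1 ?mulr0 // => i _.
    by rewrite mcoeffZ mcoeff_mdiag (memN_msupp_eq0 ua) mul0r mulr0.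
  have := pa a ua; rewrite (horner_coef_wide _ (leqSpred (size p))).
  rewrite big_ord_recl expr0 mulr1 => /eqP.
  rewrite addr_eq0 => /eqP E.
  under eq_bigr => i _ do rewrite mcoeffZ mcoeff_mdiag mulrCA.
  rewrite -mulr_sumr; apply: (mulfI p0).
  by rewrite mulNr mulrN [in RHS]mulrA divff // mul1r E mulNr mulrC.
apply: subspaceZ => //; apply: subspace_sum => // i _.
exact: subspaceZ.
Qed.

End Diagonal.

(** * Separating the factors *)

Section Words.
Context {K : fieldType} {C : eqType}.
Variables (r : nat) (c : 'I_r -> C) (alpha beta : 'I_r -> K).
Local Notation M := {mpoly K[r]}.
Local Notation MJ := {mpoly K[r + r]}.
Local Notation J := 'I_(r + r).
Local Notation E := (opE c alpha beta).
Implicit Types (p u : M) (h : MJ) (phi : {ffun J -> 'I_r}) (a : 'X_{1..r}).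

Definition fst2 (s : 'I_r) : J := lshift r s.
Definition snd2 (s : 'I_r) : J := rshift r s.
Definition blk (j : J) : 'I_r := match split j with inl s => s | inr s => s end.

Lemma blk_fst s : blk (fst2 s) = s.
Proof. by rewrite /blk /fst2 (unsplitK (inl s)). Qed.

Lemma blk_snd s : blk (snd2 s) = s.
Proof. by rewrite /blk /snd2 (unsplitK (inr s)). Qed.

Lemma fst2_or_snd2 j : j = fst2 (blk j) \/ j = snd2 (blk j).
Proof.
by rewrite /blk /fst2 /snd2; case: split_ordP => s ->; [left | right].
Qed.

Lemma fst2_neq_snd2 s t : (fst2 s == snd2 t) = false.
Proof. exact: eq_lrshift. Qed.

Lemma fst2_inj : injective fst2. Proof. exact: lshift_inj. Qed.
Lemma snd2_inj : injective snd2. Proof. exact: rshift_inj. Qed.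

Definition blocks (ss : seq 'I_r) : seq J :=
  flatten [seq [:: fst2 s; snd2 s] | s <- ss].

Lemma mem_blocks ss j : (j \in blocks ss) = (blk j \in ss).
Proof.
elim: ss => [|s ss IHss] //=; rewrite !inE IHss orbA; congr (_ || _).
case: (fst2_or_snd2 j) => ->; rewrite ?blk_fst ?blk_snd.
  by rewrite (inj_eq fst2_inj) fst2_neq_snd2 orbF.
by rewrite [_ == fst2 s]eq_sym fst2_neq_snd2 (inj_eq snd2_inj).
Qed.

Lemma blocks_uniq ss : uniq ss -> uniq (blocks ss).
Proof.
elim: ss => [|s ss IHss] //= /andP[sss uss].
by rewrite -/(blocks ss) inE negb_or !mem_blocks blk_fst blk_snd sss fst2_neq_snd2 IHss.
Qed.

Definition word := blocks (enum 'I_r).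

Lemma word_uniq : uniq word.
Proof. by apply: blocks_uniq; exact: enum_uniq. Qed.

Lemma mem_word j : j \in word.
Proof. by rewrite mem_blocks mem_enum. Qed.

(** [opE] counts from e_1, hence the predecessor; it is faithful only for positive exponents, which
    the factor [vars] of [hpol] guarantees. *)
Definition opW (k : 'X_{1..r + r}) p : M :=
  foldr (fun j p => E (c (blk j), (k j).-1) p) p word.

Definition opT h u : M := \sum_(k <- msupp h) h@_k *: opW k u.

Lemma opT_stable N h u : stable E N -> N u -> N (opT h u).
Proof.
move=> [hN hE] Nu; apply: subspace_sum => // k _; apply: subspaceZ => //.
by rewrite /opW; elim: word => [|j w IHw] //=; apply: hE.
Qed.

Definition opEs (s : 'I_r) (k : nat) p : M :=
  'X_s ^+ k * (theta s p + (alpha s + k%:R * beta s) *: p).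

Lemma opEs_linear s k : linear (opEs s k).
Proof.
move=> x p q; rewrite /opEs linearP scalerDr !scalerA [_ * x]mulrC -!scalerA.
by rewrite addrACA -scalerDr mulrDr scalerAr.
Qed.

HB.instance Definition _ s k :=
  GRing.isLinear.Build K M M _ (opEs s k) (opEs_linear s k).

Lemma opEsX s k a : opEs s k 'X_[a] =
  ((a s)%:R + alpha s + k%:R * beta s) *: 'X_[a + U_(s) *+ k].
Proof.
rewrite /opEs thetaX -scalerDl addrA -scalerAr; congr (_ *: _).
by rewrite mpolyXD mulrC mpolyXn.
Qed.

Definition blkf : {ffun J -> 'I_r} := [ffun j => blk j].
Definition samecol (j : J) : pred 'I_r := fun s => c s == c (blk j).
Definition phis := choices blkf samecol word.

Lemma phisP phi : phi \in phis -> forall j, c (phi j) = c (blk j).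
Proof.
move=> hphi j; apply/eqP; apply: (choicesP _ hphi j) => i.
by rewrite /samecol ffunE.
Qed.

Lemma blkf_phis : blkf \in phis.
Proof. by apply: mem_choices => j; rewrite /samecol ffunE. Qed.

Definition opWphi phi (k : 'X_{1..r + r}) (js : seq J) p : M :=
  foldr (fun j p => opEs (phi j) (k j) p) p js.

Lemma opW_sum (k : 'X_{1..r + r}) u : (forall j, (0 < k j)%N) ->
  opW k u = \sum_(phi <- phis) opWphi phi k word u.
Proof.
move=> k0; rewrite -(@foldr_sum _ _ _ _ _ (fun j i p => opEs i (k j) p));
  last exact: word_uniq.
- rewrite /opW; elim: word => [|j w IHw] //=; rewrite IHw /opE /=.
  by apply: eq_bigr => s _; rewrite prednK.
- by move=> j i x y; rewrite raddfD.
by move=> j i; rewrite raddf0.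
Qed.

Local Notation ev phi := (@subst K (r + r) r (fun j => 'X_(phi j))).

(* Applied to a monomial z^k, these operators multiply it by the scalar that    *)
(* the corresponding term of e_{k_j} produces on y^a times the monomials        *)
(* created by the letters after j: the scalars are polynomial in k.             *)
Definition opL phi a (j : J) (js : seq J) h : MJ :=
  ((a (phi j))%:R + alpha (phi j)) *: h + beta (phi j) *: theta j h
  + \sum_(i <- js | phi i == phi j) theta i h.

Fixpoint opLs phi a (js : seq J) h : MJ :=
  if js is j :: js' then opL phi a j js' (opLs phi a js' h) else h.

Lemma opL_linear phi a j js : linear (opL phi a j js).
Proof.
move=> x g h; rewrite /opL (linearP (theta j)) /=.
have -> : \sum_(i <- js | phi i == phi j) theta i (x *: g + h) =
  x *: (\sum_(i <- js | phi i == phi j) theta i g)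
  + \sum_(i <- js | phi i == phi j) theta i h.
  by rewrite scaler_sumr -big_split; apply: eq_bigr => i _; rewrite linearP.
rewrite -!mul_mpolyC; ring.
Qed.

Lemma opLs_linear phi a js : linear (opLs phi a js).
Proof.
elim: js => [|j js IHjs] x g h //=; rewrite IHjs; exact: opL_linear.
Qed.

HB.instance Definition _ phi a js :=
  GRing.isLinear.Build K MJ MJ _ (opLs phi a js) (opLs_linear phi a js).

(** The dictionary between words and differential operators: letter j produces (a + alpha + beta k_j
    + the k_i of the earlier applied letters sent to the same variable), and a factor k_i is the
    eigenvalue of [theta i] on z^k. *)
Lemma opWphiX phi (k : 'X_{1..r + r}) js a : uniq js -> exists2 l : K,
  opLs phi a js 'X_[k] = l *: 'X_[k]
  & opWphi phi k js 'X_[a] = l *: 'X_[a + \sum_(j <- js) U_(phi j) *+ k j].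
Proof.
elim: js => [|j js IHjs] /=; first by exists 1; rewrite ?big_nil ?addm0 scale1r.
case/andP=> jjs /IHjs[l lE wE].
exists (((a (phi j))%:R + alpha (phi j) + beta (phi j) * (k j)%:R
  + \sum_(i <- js | phi i == phi j) (k i)%:R) * l).
  rewrite lE /opL !linearZ /= thetaX.
  under eq_bigr => i _ do rewrite linearZ /= thetaX.
  rewrite -scaler_sumr -scaler_suml !scalerA -!scalerDl; congr (_ *: _).
  by rewrite !mulrDl; ring.
rewrite wE linearZ /= opEsX scalerA big_cons [l * _]mulrC; congr (_ *: 'X_[_]).
  congr (_ * l); rewrite mnmDE natrD mnm_sumE natr_sum -!addrA; congr (_ + _).
  rewrite addrCA; congr (_ + _); rewrite [X in _ = X]addrC mulrC; congr (_ + _).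
  rewrite [RHS]big_mkcond /=; apply: eq_bigr => i _.
  by rewrite mulmnE mnm1E; case: eqP => _; rewrite ?mul1n ?mul0n.
by rewrite -addmA [(_ + \sum_(_ <- _) _)%MM]addmC.
Qed.

Lemma opT_formula h u : (forall k, k \in msupp h -> forall j, (0 < k j)%N) ->
  opT h u = \sum_(phi <- phis) \sum_(a <- msupp u)
    u@_a *: ('X_[a] * ev phi (opLs phi a word h)).
Proof.
move=> h0; rewrite /opT big_seq.
rewrite (eq_bigr (fun k => \sum_(phi <- phis) \sum_(a <- msupp u)
    u@_a *: ('X_[a] * ev phi (opLs phi a word (h@_k *: 'X_[k]))))) => [|k hk].
  rewrite -big_seq exchange_big /=; apply: eq_bigr => phi _.
  rewrite exchange_big /=; apply: eq_bigr => a _.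
  rewrite -scaler_sumr -mulr_sumr; congr (_ *: (_ * _)).
  by rewrite [in RHS](mpolyE h) linear_sum /= linear_sum.
rewrite opW_sum; last exact: h0.
rewrite scaler_sumr; apply: eq_bigr => phi _.
rewrite {1}[u]mpolyE.
have opWl js : linear (opWphi phi k js).
  elim: js => [|j js IHjs] x p q //=; by rewrite IHjs linearP.
have opW0 : opWphi phi k word 0 = 0.
  by have := opWl word (-1) 0 0; rewrite scaler0 addr0 scaleN1r addNr.
have opWD : {morph opWphi phi k word : x y / x + y}.
  by move=> x y; have := opWl word 1 x y; rewrite !scale1r.
rewrite (big_morph _ opWD opW0) scaler_sumr; apply: eq_bigr => a _.
have [l lE wE] := opWphiX phi k a word_uniq.
have -> : opWphi phi k word (u@_a *: 'X_[a]) = u@_a *: opWphi phi k word 'X_[a].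
  by have := opWl word u@_a 'X_[a] 0; rewrite opW0 !addr0.
have -> : opLs phi a word (h@_k *: 'X_[k]) = h@_k *: (l *: 'X_[k]).
  by rewrite linearZ /= lE.
rewrite wE !scalerA [subst _ _]linearZ /= -scalerAr mpolyXD !scalerA.
congr (_ *: (_ * _)); first by rewrite mulrAC mulrA mulrC mulrA.
rewrite substX (big_morph (fun b => 'X_[b]) (@mpolyXD _ _) (@mpolyX0 _ _)).
rewrite (perm_big (index_enum J)) /=; last first.
  rewrite uniq_perm ?word_uniq ?index_enum_uniq // => j.
  by rewrite mem_word mem_index_enum.
by apply: eq_bigr => j _; rewrite mpolyXn.
Qed.

Lemma theta_ideal n (j : 'I_n) (f h : {mpoly K[n]}) k :
  ideal (f ^+ k.+1) h -> ideal (f ^+ k) (theta j h).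
Proof.
case=> q ->; exists ((theta j f *+ k.+1) * q + f * theta j q).
by rewrite thetaM thetaXn exprSr -!mulrnAr; ring.
Qed.

Lemma opLs_ideal phi a js f h k :
  ideal (f ^+ (size js + k)) h -> ideal (f ^+ k) (opLs phi a js h).
Proof.
elim: js k => [|j js IHjs] k //=; rewrite addSnnS => /IHjs {IHjs}.
move: (opLs phi a js h) => {}h hh; rewrite /opL.
have hf := ideal_subspace (f ^+ k).
have hk : ideal (f ^+ k) h by case: hh => q ->; exists (f * q); rewrite exprSr mulrA.
apply: subspaceD => //; [apply: subspaceD => //|].
- exact: subspaceZ.
- by apply: subspaceZ => //; apply: theta_ideal.
by apply: subspace_sum => // i _; apply: theta_ideal.
Qed.

(** Each of the [size word] first-order operators lowers the power of z_i - z_j by at most one, so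
    one factor remains, and phi sends it to 0. *)
Lemma opLs_vanish phi a i j h : phi i = phi j ->
  ideal (('X_i - 'X_j) ^+ (size word).+1) h -> ev phi (opLs phi a word h) = 0.
Proof.
move=> pij; rewrite -addn1 => /(opLs_ideal phi a)[q ->].
by rewrite expr1 rmorphM rmorphB /= !substU pij subrr mul0r.
Qed.

Section Block.
Variables (sigma : 'I_r -> 'I_r) (a : 'X_{1..r}).
Hypothesis sigma_inj : injective sigma.

(** The two letters of block s when phi is injective on blocks. The letter [snd2 s] acts first, so
    its exponent enters the scalar of [fst2 s]: hence the last term. *)
Definition opQ (s : 'I_r) h : MJ :=
  let x := (a (sigma s))%:R + alpha (sigma s) in
  let g := x *: h + beta (sigma s) *: theta (snd2 s) h in
  x *: g + beta (sigma s) *: theta (fst2 s) g + theta (snd2 s) g.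

Lemma opLs_blocks phi ss h : (forall j, phi j = sigma (blk j)) -> uniq ss ->
  opLs phi a (blocks ss) h = foldr opQ h ss.
Proof.
move=> phiE; elim: ss => [|s ss IHss] //= /andP[sss uss].
rewrite -/(blocks ss) IHss // {IHss}; move: (foldr opQ h ss) => {}h.
have rest g : \sum_(k <- blocks ss | phi k == sigma s) theta k g = 0 :> MJ.
  rewrite big_seq_cond big_pred0 // => k; rewrite mem_blocks phiE.
  rewrite (inj_eq sigma_inj); case: eqP => [->|_]; last exact: andbF.
  by rewrite (negPf sss).
rewrite /opL big_cons !phiE !blk_fst !blk_snd eqxx.
by rewrite !rest !addr0.
Qed.

Definition wdiff (s : 'I_r) : MJ := 'X_(fst2 s) - 'X_(snd2 s).

Lemma theta_wdiff s t : s != t ->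
  theta (fst2 s) (wdiff t) = 0 /\ theta (snd2 s) (wdiff t) = 0.
Proof.
move=> st; rewrite !raddfB /= !thetaU (inj_eq fst2_inj) (inj_eq snd2_inj).
rewrite (negPf st) fst2_neq_snd2 [snd2 s == _]eq_sym fst2_neq_snd2.
by rewrite !scale0r subrr.
Qed.

Lemma theta_wdiff_fst s : theta (fst2 s) (wdiff s) = 'X_(fst2 s).
Proof.
by rewrite raddfB /= !thetaU eqxx fst2_neq_snd2 scale1r scale0r subr0.
Qed.

Lemma theta_wdiff_snd s : theta (snd2 s) (wdiff s) = - 'X_(snd2 s).
Proof.
rewrite raddfB /= !thetaU eqxx [snd2 s == _]eq_sym fst2_neq_snd2.
by rewrite scale1r scale0r sub0r.
Qed.

Lemma opQ_const s f h : theta (fst2 s) f = 0 -> theta (snd2 s) f = 0 ->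
  opQ s (f * h) = f * opQ s h.
Proof.
move=> f1 f2; rewrite /opQ; set x := _ + alpha _; set b := beta _.
set g := x *: h + _.
have -> : x *: (f * h) + b *: theta (snd2 s) (f * h) = f * g.
  by rewrite thetaM f2 mul0r add0r mulrDr !scalerAr.
by rewrite !thetaM f1 f2 !mul0r !add0r !scalerAr -!mulrDr.
Qed.

(* The scalar extracted from a pair of variables sent to y_t, by a first order  *)
(* difference if b holds and by a second order one otherwise; see [opQ_lin] and *)
(* [opQ_sq].                                                                    *)
Definition kappa (t : 'I_r) (b : bool) : K :=
  if b then - ((a t)%:R + alpha t) else 2%:R * (beta t * (1 - beta t)).

Definition bfac (s : 'I_r) (b : bool) : MJ :=
  if b then wdiff s * 'X_(snd2 s) else wdiff s ^+ 2.

Lemma opQ_sq s h : ideal (wdiff s)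
  (opQ s (wdiff s ^+ 2 * h) - kappa (sigma s) false *: ('X_(snd2 s) ^+ 2 * h)).
Proof.
rewrite /opQ /kappa; set x := _ + alpha _; set b := beta _.
set w := wdiff s; set z := 'X_(snd2 s).
pose G := x *: (w * h) + b *: (w * theta (snd2 s) h - z * h *+ 2).
have tw : theta (snd2 s) w = - z := theta_wdiff_snd s.
have tw1 : theta (fst2 s) w = w + z by rewrite theta_wdiff_fst subrK.
have -> : x *: (w ^+ 2 * h) + b *: theta (snd2 s) (w ^+ 2 * h) = w * G.
  rewrite /G thetaM thetaXn tw expr1 mulr2n -!mul_mpolyC; ring.
rewrite !thetaM tw tw1; exists (x *: G + b *: G + b *: theta (fst2 s) G
  + theta (snd2 s) G + (b - 1) *: (z * (x *: h + b *: theta (snd2 s) h))).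
rewrite /G -!mul_mpolyC !(mpolyCM, mpolyCB, mpolyC1, mpolyC_nat); ring.
Qed.

Lemma opQ_lin s h : beta (sigma s) = 0 -> ideal (wdiff s)
  (opQ s (wdiff s * 'X_(snd2 s) * h) - kappa (sigma s) true *: ('X_(snd2 s) ^+ 2 * h)).
Proof.
move=> b0; rewrite /opQ /kappa b0; set x := _ + alpha _.
set w := wdiff s; set z := 'X_(snd2 s).
have tw : theta (snd2 s) w = - z := theta_wdiff_snd s.
exists (x *: (x *: (z * h) + theta (snd2 s) (z * h))).
rewrite !scale0r !addr0 -mulrA [theta _ (_ *: _)]linearZ /= [theta _ (w * _)]thetaM tw.
rewrite -!mul_mpolyC mpolyCN; ring.
Qed.

Lemma opQ_linear s : linear (opQ s).
Proof.
move=> x g h; rewrite /opQ (linearP (theta (snd2 s))) /=.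
set y := _ + alpha _; set b := beta _.
set g1 := y *: g + _; set h1 := y *: h + _.
have -> : y *: (x *: g + h) + b *: (x *: theta (snd2 s) g + theta (snd2 s) h)
    = x *: g1 + h1.
  by rewrite /g1 /h1 -!mul_mpolyC; ring.
rewrite !(linearP (theta _)) /= -!mul_mpolyC; ring.
Qed.

HB.instance Definition _ s :=
  GRing.isLinear.Build K MJ MJ _ (opQ s) (opQ_linear s).

Lemma opQ_bfac s (b : bool) h : (b -> beta (sigma s) = 0) -> ideal (wdiff s)
  (opQ s (bfac s b * h) - kappa (sigma s) b *: ('X_(snd2 s) ^+ 2 * h)).
Proof.
by case: b => [/(_ isT)|_]; [exact: opQ_lin | exact: opQ_sq].
Qed.

Definition wspan (ss : seq 'I_r) h : Prop :=
  exists q : 'I_r -> MJ, h = \sum_(s <- ss) wdiff s * q s.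

Lemma wspan_opQ t ss h : t \notin ss -> wspan ss h -> wspan ss (opQ t h).
Proof.
move=> tss [q ->]; exists (fun s => opQ t (q s)); rewrite linear_sum /=.
rewrite big_seq [RHS]big_seq; apply: eq_bigr => s sss.
have ts : t != s by apply: contraNneq tss => ->.
by have [w1 w2] := theta_wdiff ts; rewrite opQ_const.
Qed.

(** Blocks do not interact: [opQ t] commutes with the differences of the other blocks, hence
    preserves the ideal they span. Each block then yields its [kappa] by [opQ_bfac], modulo an ideal
    that the evaluation kills. *)
Lemma foldr_opQ (b : 'I_r -> bool) ss g :
  (forall s, b s -> beta (sigma s) = 0) -> uniq ss ->
  wspan ss (foldr opQ (\prod_(s <- ss) bfac s (b s) * g) ss
    - \prod_(s <- ss) (kappa (sigma s) (b s) *: 'X_(snd2 s) ^+ 2) * g).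
Proof.
move=> hb; elim: ss g => [|t ss IHss] g /=.
  by exists (fun=> 0); rewrite !big_nil subrr.
case/andP=> tss /IHss{IHss} IH.
have := IH (bfac t (b t) * g); rewrite !big_cons.
set B := \prod_(s <- ss) bfac _ _; set k := \prod_(s <- ss) (_ *: _).
have -> : bfac t (b t) * B * g = B * (bfac t (b t) * g) by ring.
have -> : k * (bfac t (b t) * g) = bfac t (b t) * (k * g) by ring.
set H := foldr _ _ _ => hH.
have {hH}[q hH] := wspan_opQ tss hH.
have [y hy] := opQ_bfac (k * g) (hb t).
exists (fun s => if s == t then y else q s); rewrite big_cons eqxx -hy.
have -> : \sum_(s <- ss) wdiff s * (if s == t then y else q s)
    = \sum_(s <- ss) wdiff s * q s.
  rewrite big_seq [RHS]big_seq; apply: eq_bigr => s sss.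
  by case: eqP sss => // ->; rewrite (negPf tss).
rewrite -hH linearB /= -!scalerAl -!mul_mpolyC; ring.
Qed.

(** Handles a block t prepared with a squared difference but sent to a variable with beta = 0: the
    second-order scalar vanishes and a factor [wdiff t] is left over. *)
Lemma foldr_opQ_kill t ss h : kappa (sigma t) false = 0 -> uniq ss ->
  ideal (wdiff t ^+ 2) h ->
  if t \in ss then ideal (wdiff t) (foldr opQ h ss)
  else ideal (wdiff t ^+ 2) (foldr opQ h ss).
Proof.
move=> k0; elim: ss => [|s ss IHss] //= /andP[sss uss] hh.
have {IHss} := IHss uss hh; rewrite inE; case: (eqVneq t s) => [<-|ts] /= in sss *.
  rewrite (negPf sss) => -[q ->]; have := opQ_sq t q.
  by rewrite k0 scale0r subr0.
have st : s != t by rewrite eq_sym.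
have [w1 w2] := theta_wdiff st.
case: (t \in ss) => -[q ->]; exists (opQ s q); rewrite opQ_const //.
  by rewrite thetaXn w1 mulr0 mul0rn.
by rewrite thetaXn w2 mulr0 mul0rn.
Qed.

End Block.

Definition bet0 (s : 'I_r) : bool := beta s == 0.

Definition crossJ : MJ :=
  \prod_i \prod_(j | (blk j != blk i) && (c (blk j) == c (blk i))) ('X_i - 'X_j).

(* crossJ removes the maps phi mixing two blocks, the factors bfac extract a    *)
(* multiplication operator from each block and vars makes all exponents         *)
(* positive.                                                                   *)
Definition hpol f : MJ :=
  \prod_(s <- enum 'I_r) bfac s (bet0 s) *
  (vars (r + r) * crossJ ^+ (size word).+1 * subst (fun s => 'X_(fst2 s)) f).

Lemma msupp_vars_mul n (h : {mpoly K[n]}) k :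
  k \in msupp (vars n * h) -> forall j, (0 < k j)%N.
Proof.
move=> /msuppM_le/allpairsP[[k1 k2] /= [+ _ ->]] j.
have -> : vars n = 'X_[\sum_j U_(j)] :> {mpoly K[n]}.
  by rewrite (big_morph (fun b => 'X_[b]) (@mpolyXD _ _) (@mpolyX0 _ _)).
rewrite msuppX inE => /eqP->; rewrite mnmDE mnm_sumE (bigD1 j) //= mnm1E eqxx.
by rewrite addSn.
Qed.

(** Every block has two letters, so [vars] appears squared and every difference of two blocks
    appears 2 x 2 times. *)
Lemma ev_blocks (sigma : 'I_r -> 'I_r) phi f : colour_preserving c sigma ->
  (forall j, phi j = sigma (blk j)) -> sym c f ->
  ev phi (vars (r + r) * crossJ ^+ (size word).+1
    * subst (fun s => 'X_(fst2 s)) f)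
  = vars r ^+ 2 * disc c ^+ (4 * (size word).+1) * f.
Proof.
move=> hs phiE fsym; have [sinj sc] := hs.
have sumJ (F : J -> M) (G : 'I_r -> M) : (forall j, F j = G (blk j)) ->
    \prod_j F j = (\prod_s G s) ^+ 2.
  move=> FG; rewrite big_split_ord /= expr2; congr (_ * _);
  by apply: eq_bigr => s _; rewrite FG ?blk_fst ?blk_snd.
rewrite !rmorphM rmorphXn /= !rmorph_prod /=; congr (_ * _ * _).
- rewrite (sumJ _ (fun s => 'X_(sigma s))) => [|j]; last by rewrite substU phiE.
  by rewrite /vars [in RHS](reindex_inj sinj).
- rewrite [in RHS]exprM; congr (_ ^+ _).
  rewrite (sumJ _ (fun s => (\prod_(t | (t != s) && (c t == c s))
    ('X_(sigma s) - 'X_(sigma t))) ^+ 2)) => [|i].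
    rewrite prodrXl -exprM; congr (_ ^+ _).
    rewrite -[in RHS](sym_disc hs) /disc rmorph_prod /=.
    apply: eq_bigr => s _; rewrite rmorph_prod; apply: eq_bigr => t _.
    by rewrite rmorphB /= !substU.
  rewrite rmorph_prod big_mkcond /=.
  rewrite (sumJ _ (fun t => if (t != blk i) && (c t == c (blk i))
    then 'X_(sigma (blk i)) - 'X_(sigma t) else 1)) => [|j].
    by rewrite -big_mkcond.
  by case: ifP => // _; rewrite rmorphB /= !substU !phiE.
rewrite subst_comp; rewrite -[in RHS](fsym sigma hs); apply: eq_subst => s.
by rewrite substU phiE blk_fst.
Qed.

Definition goodphi phi : bool :=
  [&& [forall s, phi (fst2 s) == phi (snd2 s)],
      injectiveb (fun s => phi (fst2 s))
    & [forall s, bet0 (phi (fst2 s)) == bet0 s]].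

Definition kap a : K := \prod_s kappa a s (bet0 s).

Lemma goodphiP phi : phi \in phis -> goodphi phi ->
  exists sigma : 'I_r -> 'I_r, [/\ colour_preserving c sigma,
    forall j, phi j = sigma (blk j) & forall s, bet0 (sigma s) = bet0 s].
Proof.
move=> hphi /and3P[/forallP h1 /injectiveP h2 /forallP h3].
exists (fun s => phi (fst2 s)); split.
- by split=> // s; rewrite (phisP hphi) blk_fst.
- by move=> j; case: (fst2_or_snd2 j) => {1}-> //; rewrite -(eqP (h1 _)).
by move=> s; exact: (eqP (h3 s)).
Qed.

(** The value does not depend on phi: the permutation sigma preserves colours and the vanishing of
    beta, so it only reorders the product [kap] and fixes the symmetric factors. Good terms
    therefore add up without cancelling. *)
Lemma term_good phi a f : phi \in phis -> goodphi phi -> sym c f ->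
  ev phi (opLs phi a word (hpol f)) =
  kap a *: (vars r ^+ 4 * disc c ^+ (4 * (size word).+1) * f).
Proof.
move=> hphi /(goodphiP hphi)[sigma [hs phiE hb]] fsym; have [sinj sc] := hs.
rewrite /word (opLs_blocks a sinj _ phiE) ?enum_uniq // -/word /hpol.
set g := vars _ * _ * _.
have [|q hq] := @foldr_opQ sigma a bet0 (enum 'I_r) g _ (enum_uniq _).
  by move=> s; rewrite -hb => /eqP.
have := congr1 (ev phi) hq; rewrite rmorphB /= [in RHS]rmorph_sum /= [in RHS]big1; last first.
  move=> s _; rewrite rmorphM rmorphB /= !substU !phiE blk_fst blk_snd.
  by rewrite subrr mul0r.
move/subr0_eq => ->; rewrite rmorphM /= (ev_blocks hs phiE fsym).
have -> : ev phi (\prod_(s <- enum 'I_r) (kappa a (sigma s) (bet0 s) *: 'X_(snd2 s) ^+ 2))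
    = kap a *: vars r ^+ 2.
  rewrite rmorph_prod big_enum /=.
  transitivity (\prod_s ((kappa a (sigma s) (bet0 (sigma s)))%:MP_[r] * 'X_(sigma s) ^+ 2)).
    apply: eq_bigr => s _.
    by rewrite linearZ rmorphXn /= substU phiE blk_snd hb mul_mpolyC.
  rewrite -(reindex_inj sinj (P := xpredT) (F := fun s => (kappa a s (bet0 s))%:MP_[r] * 'X_s ^+ 2)) /=.
  by rewrite big_split /= -rmorph_prod /= prodrXl mul_mpolyC.
by rewrite -scalerAl; congr (_ *: _); ring.
Qed.

(** If phi identifies letters of two blocks, [crossJ] kills the term. Otherwise phi comes from a
    permutation of the blocks that fails to respect the vanishing of beta, and [foldr_opQ_kill]
    applies. *)
Lemma term_bad phi a f : phi \in phis -> ~~ goodphi phi ->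
  ev phi (opLs phi a word (hpol f)) = 0.
Proof.
move=> hphi bad.
have [[i [j [bij pij]]]|sep] := pselect (exists i j, blk i != blk j /\ phi i = phi j).
  apply: (opLs_vanish a pij); rewrite /hpol.
  have : ideal ('X_i - 'X_j) crossJ.
    rewrite /crossJ (bigD1 i) //= (bigD1 j) /=; last first.
      by rewrite eq_sym bij -!(phisP hphi) pij eqxx.
    by rewrite -mulrA; eexists.
  case=> q ->; rewrite exprMn; set B := \prod_(_ <- _) _.
  exists (B * (vars (r + r) * q ^+ (size word).+1 * subst (fun s => 'X_(fst2 s)) f)).
  by ring.
pose sigma s := phi (fst2 s).
have sinj : injective sigma.
  move=> s t st; apply/eqP; apply/negPn/negP => nst; apply: sep.
  by exists (fst2 s), (fst2 t); rewrite !blk_fst.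
have phiE j : phi j = sigma (blk j).
  have [E|E] := fst2_or_snd2 j; first by rewrite {1}E.
  have [s' hs'] : exists s', phi j = sigma s'.
    by exists (invF sinj (phi j)); rewrite f_invF.
  have [<-//|ns] := eqVneq s' (blk j).
  exfalso; apply: sep; exists (fst2 s'), j; rewrite blk_fst ns.
  by rewrite hs'.
(* By counting: if no such t existed, the preimage of the set beta = 0 would lie in that set and
   have the same cardinality, so phi would be good. *)
have [t /andP[bt bst]] : exists t, ~~ bet0 t && bet0 (sigma t).
  apply/existsP; apply: contraNT bad; rewrite negb_exists => /forallP hall.
  apply/and3P; split; first by apply/forallP => s; rewrite !phiE blk_fst blk_snd.
    by apply/injectiveP.
  have /eqP E : (sigma @^-1: [set s | bet0 s]) == [set s | bet0 s].
    rewrite eqEcard card_preimset // leqnn andbT; apply/subsetP => s.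
    by rewrite !inE => bs; have := hall s; rewrite bs andbT negbK.
  by apply/forallP => s; have /setP/(_ s) := E; rewrite !inE => ->.
rewrite /word (opLs_blocks a sinj _ phiE) ?enum_uniq // -/word.
have k0 : kappa a (sigma t) false = 0.
  by rewrite /kappa (eqP bst) mul0r mulr0.
have := @foldr_opQ_kill sigma a t (enum 'I_r) (hpol f) k0 (enum_uniq _).
rewrite mem_enum => -[|q ->].
  rewrite /hpol (bigD1_seq t) ?enum_uniq ?mem_enum //= {1}/bfac (negPf bt).
  exact: (ex_intro _ _ (esym (mulrA _ _ _))).
by rewrite rmorphM rmorphB /= !substU !phiE blk_fst blk_snd subrr mul0r.
Qed.

Hypothesis charK0 : forall k, k.+1%:R != 0 :> K.

Lemma key_step N u f : stable E N -> N u -> sym c f ->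
  N (qpol c ^+ (4 * (size word).+1) * f * mdiag kap u).
Proof.
(* The extra power of [vars] matches its exponent with that of [disc], so that the product is a
   power of q. *)
move=> hN Nu fsym; pose f' := vars r ^+ (4 * size word) * f.
have f'sym : sym c f' by apply: symM => //; apply: symX; exact: sym_vars.
pose Y := vars r ^+ 4 * disc c ^+ (4 * (size word).+1) * f'.
have hsupp k : k \in msupp (hpol f') -> forall j, (0 < k j)%N.
  rewrite /hpol; set B := \prod_(_ <- _) _; set D := crossJ ^+ _; set F := subst _ _.
  have -> : B * (vars (r + r) * D * F) = vars (r + r) * (B * D * F) by ring.
  exact: msupp_vars_mul.
have TE : opT (hpol f') u = (count goodphi phis)%:R *: (Y * mdiag kap u).
  rewrite opT_formula //.
  transitivity (\sum_(phi <- phis | goodphi phi) Y * mdiag kap u); last first.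
    by rewrite big_const_seq iter_addr_0 scaler_nat.
  rewrite [RHS]big_mkcond big_seq [RHS]big_seq; apply: eq_bigr => phi hphi.
  case: ifP => [good|/negbT bad]; last first.
    by apply: big1 => a _; rewrite term_bad // mulr0 scaler0.
  rewrite /mdiag mulr_sumr; apply: eq_bigr => a _.
  rewrite term_good // -/Y -!scalerAr scalerA; congr (_ *: _); exact: mulrC.
have : N (opT (hpol f') u) by apply: opT_stable.
rewrite TE.
have : (0 < count goodphi phis)%N.
  rewrite -has_count; apply/hasP; exists blkf; first exact: blkf_phis.
  apply/and3P; split; first by apply/forallP => s; rewrite !ffunE blk_fst blk_snd.
    by apply/injectiveP => s t; rewrite !ffunE !blk_fst.
  by apply/forallP => s; rewrite ffunE blk_fst.
case: (count _ _) => // m _ Nm.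
have [hN0 _] := hN.
have := subspaceZ m.+1%:R^-1 hN0 Nm; rewrite scalerA mulVf // scale1r.
suff -> : Y = qpol c ^+ (4 * (size word).+1) * f by [].
have vE : vars r ^+ (4 * (size word).+1) = vars r ^+ 4 * vars r ^+ (4 * size word) :> M.
  by rewrite mulnS exprD.
by rewrite /Y /f' /qpol exprMn vE; ring.
Qed.

End Words.

(** * Noetherianity of the model modules *)

Section DiagonalOps.
Context {K : fieldType} {r : nat}.
Local Notation M := {mpoly K[r]}.
Implicit Types (pi : 'X_{1..r} -> K) (u : M).

Lemma mdiag_linear pi : linear (mdiag pi : M -> M).
Proof.
move=> x u v; apply/mpolyP => a.
by rewrite mcoeffD mcoeffZ !mcoeff_mdiag mcoeffD mcoeffZ mulrDl mulrA.
Qed.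

HB.instance Definition _ pi :=
  GRing.isLinear.Build K M M _ (mdiag pi : M -> M) (mdiag_linear pi).

Lemma mdiagX pi a : mdiag pi ('X_[a] : M) = pi a *: 'X_[a].
Proof.
apply/mpolyP => b; rewrite mcoeff_mdiag mcoeffZ mcoeffX mulrC.
by case: eqP => [->|_]; rewrite ?mulr0.
Qed.

Lemma mdiag_comp pi pi' u : mdiag pi (mdiag pi' u) = mdiag (fun a => pi' a * pi a) u.
Proof. by apply/mpolyP => a; rewrite !mcoeff_mdiag mulrA. Qed.

Lemma mdiag_id pi u : (forall a, pi a = 1) -> mdiag pi u = u.
Proof. by move=> h; apply/mpolyP => a; rewrite mcoeff_mdiag h mulr1. Qed.

End DiagonalOps.

Section ModelNoetherian.
Context {K : fieldType} {C : eqType}.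
Hypothesis charK0 : forall k, k.+1%:R != 0 :> K.

Definition nonresonant r (alpha : 'I_r -> K) : Prop :=
  forall s (k : nat), k%:R + alpha s != 0.

Section Nonresonant.
Variables (r : nat) (c : 'I_r -> C) (alpha beta : 'I_r -> K).
Local Notation M := {mpoly K[r]}.
Local Notation E := (opE c alpha beta).
Local Notation q := (@qpol K C r c).
Implicit Types (f p u w : M) (N : M -> Prop).

(** The w whose multiples by symmetric polynomials all fall into N after multiplication by one power
    of q. *)
Definition satur N w : Prop := exists k, forall f, sym c f -> N (q ^+ k * f * w).

Lemma satur_le N w k l : (k <= l)%N ->
  (forall f, sym c f -> N (q ^+ k * f * w)) ->
  forall f, sym c f -> N (q ^+ l * f * w).
Proof.
move=> /subnK <- h f fsym; rewrite exprD.
have -> : q ^+ (l - k) * q ^+ k * f * w = q ^+ k * (q ^+ (l - k) * f) * w by ring.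
by apply: h; apply: symM => //; apply: symX; exact: sym_qpol.
Qed.

(** By Leibniz, moving an operator past q^(k+1) f costs a derivative that still has the form q^k
    times a symmetric polynomial. *)
Lemma satur_stable N : stable E N -> stable E (satur N).
Proof.
move=> [hN hE]; have [N0 Nl] := hN; split; [split|].
- by exists 0%N => f _; rewrite mulr0.
- move=> x u v [k hk] [l hl]; exists (k + l)%N => f fsym.
  rewrite mulrDr -scalerAr; apply: Nl.
    by apply: (satur_le _ hk) => //; exact: leq_addr.
  by apply: (satur_le _ hl) => //; exact: leq_addl.
move=> mk w [k hk]; exists k.+1 => f fsym.
have -> : q ^+ k.+1 * f * E mk w = E mk (q ^+ k * (q * f) * w)
    - q ^+ k * (opD c mk q * f *+ k.+1 + q * opD c mk f) * w.
  have -> : q ^+ k * (q * f) = q ^+ k.+1 * f by rewrite exprSr mulrA.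
  rewrite opEM opDM opDXn exprSr.
  by rewrite -(mulr_natr (q ^+ k * _)) -(mulr_natr (opD c mk q * f)); ring.
apply: subspaceB => //.
  by apply: hE; apply: hk; apply: symM => //; exact: sym_qpol.
apply: hk; apply: symD.
  apply: symMn; apply: symM => //; apply: sym_opD; exact: sym_qpol.
by apply: symM; [exact: sym_qpol | exact: sym_opD].
Qed.

Lemma satur_div N k w : satur N (q ^+ k * w) -> satur N w.
Proof.
case=> l hl; exists (l + k)%N => f fsym.
have -> : q ^+ (l + k) * f * w = q ^+ l * f * (q ^+ k * w) by rewrite exprD; ring.
exact: hl.
Qed.

Hypothesis alphaN : nonresonant alpha.
Hypothesis beta1 : forall s, beta s != 1.

Lemma kap_neq0 a : kap alpha beta a != 0.
Proof.
apply/prodf_neq0 => s _; rewrite /kappa /bet0; case: (eqVneq (beta s) 0) => [_|b0].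
  by rewrite oppr_eq0 alphaN.
by rewrite !mulf_neq0 ?charK0 // subr_eq0 eq_sym beta1.
Qed.

(** [key_step], applied first to N and then repeatedly to [satur N], puts all positive powers of the
    diagonal operator [kap] on u into [satur N]; interpolation on the support of u ([mdiag_recover])
    gives u back. *)
Lemma satur_mem N u : stable E N -> N u -> satur N u.
Proof.
move=> hN Nu; have hS := satur_stable hN.
apply: (mdiag_recover (pi := kap alpha beta)); first by case: hS.
  by move=> a _; exact: kap_neq0.
elim=> [|k IHk].
  exists (4 * (size (word r)).+1)%N => f fsym.
  exact: (key_step charK0 hN Nu fsym).
have := key_step charK0 hS IHk (@sym1 _ _ _ c); rewrite mulr1 => /satur_div.
rewrite mdiag_comp; congr (satur N (mdiag _ _)).
by apply: functional_extensionality_dep => a; rewrite -exprSr.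
Qed.

Definition symspan (t : seq M) : M -> Prop :=
  fun x => forall N, sym_stable c N -> (forall v, v \in t -> N v) -> N x.

Lemma symspan_stable t : sym_stable c (symspan t).
Proof.
split; [split|] => [N [[]] //|x u v hu hv N hN tN|f u fsym hu N hN tN].
  by have [[_ h] _] := hN; apply: h; [apply: hu | apply: hv].
by have [_ h] := hN; apply: h => //; apply: hu.
Qed.

(** Each of the finitely many generators of the span over the symmetric polynomials involves only
    finitely many elements of N. *)
Lemma symspan_fg N : exists T : seq M, (forall u, u \in T -> N u) /\
  forall u, N u -> symspan T u.
Proof.
pose D x := exists t : seq M, (forall u, u \in t -> N u) /\ symspan t x.
have mono (t t' : seq M) : {subset t <= t'} -> forall x, symspan t x -> symspan t' x.
  by move=> tt' x hx N1 hN1 h; apply: hx => // v /tt'; exact: h.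
have hD : sym_stable c D.
  split; [split|].
  - by exists [::]; split=> // N1 [[]].
  - move=> x u v [t [tN hu]] [t' [tN' hv]]; exists (t ++ t'); split.
      by move=> w; rewrite mem_cat => /orP[/tN|/tN'].
    have [[_ h] _] := symspan_stable (t ++ t'); apply: h.
      by apply: mono hu => w; rewrite mem_cat => ->.
    by apply: mono hv => w; rewrite mem_cat orbC => ->.
  move=> f u fsym [t [tN hu]]; exists t; split=> //.
  by have [_ h] := symspan_stable t; exact: h.
have [s [sD hs]] := sym_fg hD.
have [T [TN hT]] : exists T : seq M, (forall u, u \in T -> N u) /\
    forall u, u \in s -> symspan T u.
  elim: s sD {hs} => [|x s IHs] sD; first by exists [::].
  have [|T [TN hT]] := IHs; first by move=> y ys; apply: sD; rewrite inE ys orbT.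
  have [|t [tN ht]] := sD x; first by rewrite inE eqxx.
  exists (t ++ T); split=> w; first by rewrite mem_cat => /orP[/tN|/TN].
  rewrite inE => /orP[/eqP->|/hT hw]; [apply: mono ht | apply: mono hw] => v;
  by rewrite mem_cat => ->; rewrite ?orbT.
exists T; split=> // u Nu; apply: (hs _ (symspan_stable T) hT).
by exists [:: u]; split=> [v|N1 _]; [rewrite inE => /eqP-> | apply; rewrite inE eqxx].
Qed.

Hypothesis noeth_q : forall k, noeth E whole (ideal (q ^+ k)).

(* Let N be a submodule and T a finite subset of N generating it over the     *)
(* symmetric polynomials. A power of q multiplies that span N~ into the       *)
(* submodule generated by T, and q^l M meets N~ inside q^k N~ for l large, by *)
(* the ascending chain condition on the modules (N~ : q^j).                   *)
Lemma noeth_nonresonant : noeth E whole null.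
Proof.
move=> N hN _; have [T [TN NT]] := symspan_fg N.
pose N0 := generated E T; have hN0 : stable E N0 by exact: generated_stable.
have [k hk] : exists k, forall u, u \in T -> forall f, sym c f -> N0 (q ^+ k * f * u).
  have : forall u, u \in T -> satur N0 u.
    by move=> u uT; apply: satur_mem => //; exact: generated_mem.
  elim: (T) => [|u t IHt] h; first by exists 0%N.
  have [|k hk] := IHt; first by move=> v vt; apply: h; rewrite inE vt orbT.
  have [|l hl] := h u; first by rewrite inE eqxx.
  exists (k + l)%N => v; rewrite inE => /orP[/eqP->|/hk hv].
    by apply: (satur_le _ hl); exact: leq_addl.
  by apply: (satur_le _ hv); exact: leq_addr.
have spanN0 x : symspan T x -> N0 (q ^+ k * x).
  move=> hx; suff : forall f, sym c f -> N0 (q ^+ k * f * x).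
    by move/(_ 1 (@sym1 _ _ _ c)); rewrite mulr1.
  have [[N00 N0l] _] := hN0.
  apply: (hx (fun x => forall f, sym c f -> N0 (q ^+ k * f * x))) => [|v vT]; last exact: hk.
  split; [split|] => [f _|a u v hu hv f fsym|g u gsym hu f fsym].
  - by rewrite mulr0.
  - by rewrite mulrDr -scalerAr; apply: N0l; [apply: hu | apply: hv].
  by rewrite mulrA -(mulrA _ f); apply: hu; apply: symM.
have [Ssub Smul] := symspan_stable T.
have Sq j x : symspan T x -> symspan T (q ^+ j * x).
  by apply: Smul; apply: symX; exact: sym_qpol.
pose U x := exists j, symspan T (q ^+ j * x).
have hU : sym_stable c U.
  split; [split|].
  - by exists 0%N; rewrite mulr0; case: Ssub.
  - move=> a u v [i hi] [j hj]; exists (i + j)%N.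
    rewrite mulrDr -scalerAr; have [_ h] := Ssub; apply: h.
      by rewrite addnC exprD -mulrA; exact: Sq.
    by rewrite exprD -mulrA; exact: Sq.
  by move=> f u fsym [j hj]; exists j; rewrite mulrCA; exact: Smul.
have [s [sU hs]] := sym_fg hU.
have [j hj] : exists j, forall u, u \in s -> symspan T (q ^+ j * u).
  elim: (s) sU => [|u t IHt] h; first by exists 0%N.
  have [|i hi] := IHt; first by move=> v vt; apply: h; rewrite inE vt orbT.
  have [|l hl] := h u; first by rewrite inE eqxx.
  exists (i + l)%N => v; rewrite inE => /orP[/eqP->|/hi hv].
    by rewrite exprD -mulrA; exact: Sq.
  by rewrite addnC exprD -mulrA; exact: Sq.
have Uj x : U x -> symspan T (q ^+ j * x).
  apply: (hs (fun x => symspan T (q ^+ j * x))) => //; split; [split|].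
  - by rewrite mulr0; case: Ssub.
  - by move=> a u v hu hv; rewrite mulrDr -scalerAr; have [_ h] := Ssub; exact: h.
  by move=> f u fsym hu; rewrite mulrCA; exact: Smul.
have [//|t [tN ht]] := noethI (noeth_q (k + j)) hN.
exists (T ++ t); split=> [u|N' hN' sN' u Nu].
  by rewrite mem_cat => /orP[/TN|/tN].
exists u; last exact: subrr.
have [|v [N'v Nv [x hx]]] := ht N' hN' _ u Nu.
  by move=> w wt; apply: sN'; rewrite mem_cat wt orbT.
rewrite -[u](subrK v); apply: subspaceD => //; first by case: hN'.
have Ux : U x by exists (k + j)%N; rewrite -hx; apply: NT; apply: subspaceB => //; case: hN.
rewrite hx exprD -mulrA.
apply: (spanN0 _ (Uj x Ux)) => // w wT.
by apply: sN'; rewrite mem_cat wT.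
Qed.

End Nonresonant.

(* P_s = theta_s + alpha_s intertwines the tensor densities with beta_s = 0 and *)
(* beta_s = 1 (the de Rham differential), and is onto without resonances.      *)
Lemma noeth_beta1 r (c : 'I_r -> C) (alpha beta : 'I_r -> K) :
  nonresonant alpha ->
  noeth (opE c alpha (fun s => if beta s == 1 then 0 else beta s)) whole null ->
  noeth (opE c alpha beta) whole null.
Proof.
move=> nonres h; set beta' := fun s => _ in h.
pose pi (a : 'X_{1..r}) : K := \prod_s (if beta s == 1 then (a s)%:R + alpha s else 1).
have pi0 a : pi a != 0.
  by apply/prodf_neq0 => s _; case: (eqVneq (beta s) 1) => _; [exact: nonres | exact: oner_neq0].
apply: (@noeth_image _ _ _ _ _ (opE c alpha beta') (mdiag pi)).
- split; first exact: subspace0.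
  by move=> mk _ ->; rewrite raddf0.
- by move=> mk; exact: opE_linear.
- exact: mdiag_linear.
- move=> u _; exists (mdiag (fun a => (pi a)^-1) u); rewrite mdiag_comp mdiag_id.
    by rewrite /null subrr.
  by move=> a; rewrite mulVf.
- move=> mk; apply: mpoly_lin_ind => [x p p' hp hp'||a].
  + rewrite /null in hp hp' *.
    rewrite (opE_linear _ _ _ _ x p p') !mdiag_linear opE_linear.
    by rewrite opprD addrACA -scalerBr hp hp' scaler0 addr0.
  + by rewrite /null (linear0 (opE c alpha beta' mk)) (linear0 (mdiag pi))
      (linear0 (opE c alpha beta mk)) subrr.
  rewrite /null mdiagX linearZ /= !opEX linear_sum scaler_sumr -sumrB /=.
  apply: big1 => s _; rewrite linearZ /= mdiagX !scalerA -scalerBl.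
  set k := mk.2.+1.
  suff -> : ((a s)%:R + alpha s + k%:R * beta' s) * pi (a + U_(s) *+ k)%MM
      = pi a * ((a s)%:R + alpha s + k%:R * beta s) by rewrite subrr scale0r.
  rewrite /pi !(bigD1 (P := xpredT) s) //= mnmDE mulmnE mnm1E eqxx mul1n.
  set x := \prod_(t | t != s) _; set y := \prod_(t | t != s) _.
  have -> : x = y.
    apply: eq_bigr => t ts; rewrite mnmDE mulmnE mnm1E (eq_sym s) (negPf ts).
    by rewrite mul0n addn0.
  rewrite /beta'; case: (eqVneq (beta s) 1) => [->|_]; last by rewrite !mul1r mulrC.
  by rewrite natrD; ring.
exact: noeth_fg.
Qed.

Lemma nonresonant_shift r (alpha : 'I_r -> K) :
  exists k : nat, nonresonant (fun s => alpha s + k%:R).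
Proof.
have natr_inj (i j : nat) : (i < j)%N -> i%:R != j%:R :> K.
  move=> ij; rewrite eq_sym -subr_eq0 -natrB ?(ltnW ij) //.
  by move: ij; rewrite -subn_gt0; case: (j - i)%N.
have one s : exists k : nat, forall l : nat, (k <= l)%N -> l%:R + alpha s != 0.
  have [[n /eqP hn]|h] := pselect (exists n : nat, n%:R + alpha s == 0); last first.
    by exists 0%N => l _; apply/negP => hl; apply: h; exists l.
  exists n.+1 => l nl; apply/eqP => hl.
  have := natr_inj n l nl; rewrite -(inj_eq (addIr (alpha s))) hn hl eqxx.
  by [].
have [k hk] : exists k : nat, forall s, s \in enum 'I_r ->
    forall l : nat, (k <= l)%N -> l%:R + alpha s != 0.
  elim: (enum 'I_r) => [|s ss [k hk]]; first by exists 0%N.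
  have [k' hk'] := one s; exists (k + k')%N => t; rewrite inE.
  case/orP=> [/eqP->|/hk h] l kl; [apply: hk' | apply: h]; apply: leq_trans kl.
    exact: leq_addl.
  exact: leq_addr.
exists k => s l; rewrite addrCA -natrD addrC; apply: hk; first by rewrite mem_enum.
exact: leq_addl.
Qed.

(** The ideal of [vars]^k is a submodule isomorphic to the module with alpha shifted by k,
    nonresonant for suitable k; the quotient by it is covered by [noeth_qpol], since [vars] divides
    q. *)
Theorem noeth_model r (c : 'I_r -> C) (alpha beta : 'I_r -> K) :
  noeth (opE c alpha beta) whole null.
Proof.
elim/ltn_ind: r c alpha beta => r IH c alpha beta.
have [k hk] := nonresonant_shift alpha.
set alpha' := fun s => _ in hk.
have nE : noeth (opE c alpha' beta) whole null.
  apply: noeth_beta1 => //; apply: noeth_nonresonant => // [s|l].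
    by case: (eqVneq (beta s) 1) => [_|//]; rewrite eq_sym oner_neq0.
  exact: noeth_qpol.
have theta_vars s : theta s (vars r) = vars r :> {mpoly K[r]}.
  have -> : vars r = 'X_[\sum_j U_(j)] :> {mpoly K[r]}.
    by rewrite (big_morph (fun b => 'X_[b]) (@mpolyXD _ _) (@mpolyX0 _ _)).
  rewrite thetaX mnm_sumE (bigD1 s) //= mnm1E eqxx big1 ?scale1r // => j js.
  by rewrite mnm1E (negPf js).
have theta_varsX s : theta s (vars r ^+ k) = vars r ^+ k *+ k :> {mpoly K[r]}.
  by case: (k) => [|l]; rewrite ?theta1 // thetaXn theta_vars -exprSr.
have opE_vars mk p : opE c alpha beta mk (vars r ^+ k * p)
    = vars r ^+ k * opE c alpha' beta mk p.
  rewrite /opE mulr_sumr; apply: eq_bigr => s _.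
  rewrite thetaM theta_varsX -!mul_mpolyC /alpha' !mpolyCD mpolyC_nat -mulr_natr; ring.
apply: (@noeth_trans _ _ _ _ _ (ideal (vars r ^+ k))).
- split; first exact: ideal_subspace.
  by move=> mk _ [p ->]; rewrite opE_vars; eexists.
- apply: (noeth_mono _ _ (noeth_qpol IH k)) => // _ [p ->].
  by exists (disc c ^+ k * p); rewrite /qpol exprMn mulrA.
apply: (@noeth_image _ _ _ _ _ (opE c alpha' beta) (fun p => vars r ^+ k * p)).
- split; first exact: subspace0.
  by move=> mk _ ->; rewrite raddf0.
- by move=> mk; exact: opE_linear.
- by move=> x p p'; rewrite mulrDr -scalerAr.
- by move=> _ [p ->]; exists p; rewrite /null subrr.
- by move=> mk p; rewrite /null opE_vars subrr.
exact: noeth_fg.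
Qed.

End ModelNoetherian.

(** * Weight vectors *)

Lemma linear_at0 {K : fieldType} (V' W' : lmodType K) (f : V' -> W') : linear f -> f 0 = 0.
Proof. by move=> h; have := h (-1) 0 0; rewrite scaler0 addr0 scaleN1r addNr. Qed.

Lemma act_linearr_scale {K : fieldType} (L : lieAlgType K) (M : lmodType K)
    (a : lieAction L M) x c u : a x (c *: u) = c *: a x u.
Proof.
by have := act_linearr a x c u 0; rewrite (linear_at0 (act_linearr a x)) !addr0.
Qed.

(** * Finite sums of images of noetherian modules *)

Section SumOfImages.
Context {K : fieldType} {V W : lmodType K} {J : Type} {I : eqType}.
Variables (F : J -> V -> V) (F' : I -> J -> W -> W) (phi : I -> W -> V).
Hypothesis Flin : forall j, linear (F j).
Hypothesis phi_lin : forall i, linear (phi i).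
Hypothesis phi_eq : forall i j x, phi i (F' i j x) = F j (phi i x).
Hypothesis noethF' : forall i, noeth (F' i) whole null.

Fixpoint sum_images (s : seq I) : V -> Prop :=
  if s is i :: s' then fun u => exists x v, sum_images s' v /\ u = phi i x + v
  else fun u => u = 0.

Lemma sum_images_stable s : stable F (sum_images s).
Proof.
elim: s => [|i s [[h0 hl] hF]] /=.
  split; first exact: subspace0.
  by move=> j u ->; exact: linear_at0.
split; [split|].
- by exists 0, 0; rewrite (linear_at0 (phi_lin i)) addr0.
- move=> c _ _ [x [v [hv ->]]] [x' [v' [hv' ->]]]; exists (c *: x + x'), (c *: v + v').
  by split; [exact: hl | rewrite phi_lin scalerDr addrACA].
move=> j _ [x [v [hv ->]]]; exists (F' i j x), (F j v); split; first exact: hF.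
by have := Flin j 1 (phi i x) v; rewrite !scale1r phi_eq.
Qed.

Lemma sum_images_mem s i x : i \in s -> sum_images s (phi i x).
Proof.
elim: s => [|i' s IHs] //=; rewrite inE => /orP[/eqP<-|/IHs h].
  by exists x, 0; rewrite addr0; have [[]] := sum_images_stable s.
by exists 0, (phi i x); rewrite (linear_at0 (phi_lin i')) add0r.
Qed.

Lemma noeth_sum_images s : noeth F (sum_images s) null.
Proof.
elim: s => [|i s IHs] /=; first exact: noeth_refl.
apply: noeth_trans IHs; first exact: sum_images_stable.
apply: (@noeth_image _ _ _ _ _ (F' i) (phi i)) => //.
- exact: sum_images_stable.
- by move=> _ [x [v [hv ->]]]; exists x; rewrite addrC addKr.
- move=> j x; rewrite phi_eq subrr.
  by have [[]] := sum_images_stable s.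
exact: noeth_fg.
Qed.

End SumOfImages.

Section LinearExtension.
Context {K : fieldType} {V : lmodType K} {n : nat}.
Variable g : 'X_{1..n} -> V.

Definition lin_ext (p : {mpoly K[n]}) : V := \sum_(a <- msupp p) p@_a *: g a.

Lemma lin_extE (s : seq 'X_{1..n}) p : uniq s -> {subset msupp p <= s} ->
  lin_ext p = \sum_(a <- s) p@_a *: g a.
Proof.
move=> us sub; rewrite /lin_ext [RHS](bigID (mem (msupp p))) /=.
rewrite [X in _ + X]big1 => [|a /memN_msupp_eq0 ->]; last by rewrite scale0r.
rewrite addr0 -[RHS]big_filter; apply: perm_big; apply: uniq_perm.
- exact: msupp_uniq.
- exact: filter_uniq.
by move=> a; rewrite mem_filter; case: (boolP (a \in msupp p)) => //= /sub.
Qed.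

Lemma lin_ext_linear : linear lin_ext.
Proof.
move=> c p q; pose s := undup (msupp p ++ msupp q ++ msupp (c *: p + q)).
have us : uniq s by exact: undup_uniq.
rewrite !(@lin_extE s) // => [|a|a|a]; try by rewrite mem_undup !mem_cat => ->; rewrite ?orbT.
rewrite scaler_sumr -big_split; apply: eq_bigr => a _ /=.
by rewrite mcoeffD mcoeffZ scalerDl scalerA.
Qed.

Lemma lin_extX a : lin_ext 'X_[a] = g a.
Proof. by rewrite /lin_ext msuppX big_seq1 mcoeffX eqxx scale1r. Qed.

End LinearExtension.

Local Arguments act_fun : simpl never.

Section Weights.
Context {K : fieldType} {n m : nat}.
Variable rho : lieHom (gl K n) (gl K m).
Local Notation V := 'cV[K]_m.
Local Notation A := (gl_module rho).

Definition is_weight (mu : 'I_n -> K) (w : V) : Prop :=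
  forall i, A (delta_mx i i) w = mu i *: w.

Definition weight_sum (w : V) : Prop :=
  exists s : seq ({ffun 'I_n -> K} * V),
    (forall p, p \in s -> is_weight p.1 p.2) /\ w = \sum_(p <- s) p.2.

Lemma weight_sum_subspace : subspace weight_sum.
Proof.
split=> [|c _ _ [s [sW ->]] [s' [sW' ->]]]; first by exists [::]; rewrite big_nil.
exists ([seq (p.1, c *: p.2) | p <- s] ++ s'); split.
  move=> p; rewrite mem_cat => /orP[/mapP[p' /sW h ->] i|/sW'//] /=.
  by rewrite act_linearr_scale h !scalerA mulrC.
by rewrite big_cat big_map /= scaler_sumr.
Qed.

Lemma weight_shift mu w (i j : 'I_n) : is_weight mu w ->
  is_weight (fun k => mu k + (k == i)%:R - (k == j)%:R) (A (delta_mx i j) w).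
Proof.
move=> hw k.
have -> : A (delta_mx k k) (A (delta_mx i j) w)
    = A (lieb (delta_mx k k : gl K n) (delta_mx i j)) w + mu k *: A (delta_mx i j) w.
  by rewrite act_lieb hw act_linearr_scale subrK.
have -> : lieb (delta_mx k k : gl K n) (delta_mx i j)
    = ((k == i)%:R - (k == j)%:R) *: delta_mx i j + 0 :> gl K n.
  rewrite /lieb /= /gl_lieb !mul_delta_mx_cond addr0 scalerBl !scaler_nat.
  congr (_ - _); first by case: eqP => [->|].
  by rewrite eq_sym; case: eqP => [->|].
rewrite act_linearl (linear_at0 (act_linearl A w)) addr0 -scalerDl.
by congr (_ *: _); rewrite addrC addrA.
Qed.

(** Matrix units map weight vectors to weight vectors, so sums of weight vectors form a submodule;
    it is nonzero, hence everything by irreducibility. *)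
Lemma weight_sum_total mu v : lie_irreducible A -> v != 0 -> is_weight mu v ->
  forall w, weight_sum w.
Proof.
move=> [_ irr] v0 hv; have hS := weight_sum_subspace.
have weightS mu' w : is_weight mu' w -> weight_sum w.
  move=> hw; exists [:: ([ffun i => mu' i], w)]; rewrite big_seq1; split=> // p.
  by rewrite inE => /eqP-> i; rewrite /= ffunE; exact: hw.
have [||h] := irr weight_sum; last exact: h.
  split; [by case: hS | by case: hS |] => x _ [s [sW ->]].
  have act_sum (I : Type) (t : seq I) (G : I -> V) :
      A x (\sum_(p <- t) G p) = \sum_(p <- t) A x (G p).
    elim: t => [|p t IHt]; first by rewrite !big_nil (linear_at0 (act_linearr A x)).
    by rewrite !big_cons -IHt; have := act_linearr A x 1 (G p) (\sum_(j <- t) G j); rewrite !scale1r.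
  rewrite act_sum big_seq; apply: subspace_sum => // p /sW hp.
  have -> : A x p.2 = \sum_i \sum_j x i j *: A (delta_mx i j) p.2.
    have AL : linear (fun y : gl K n => A y p.2) := act_linearl A p.2.
    have AL0 := linear_at0 AL.
    have ALs (I : finType) (G : I -> gl K n) :
        A (\sum_i G i) p.2 = \sum_i A (G i) p.2.
      elim: (index_enum I) => [|i t IHt]; first by rewrite !big_nil.
      by rewrite !big_cons -IHt; have := AL 1 (G i) (\sum_(j <- t) G j); rewrite !scale1r.
    rewrite {1}[x]matrix_sum_delta ALs; apply: eq_bigr => i _.
    rewrite ALs; apply: eq_bigr => j _.
    by have := AL (x i j) (delta_mx i j) 0; rewrite AL0 !addr0.
  apply: subspace_sum => // i _; apply: subspace_sum => // j _.
  by apply: subspaceZ => //; apply: weightS; exact: weight_shift hp.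
by move=> h0; move: v0; rewrite (h0 v (weightS _ _ hv)) eqxx.
Qed.

Lemma weight_gens mu v : lie_irreducible A -> v != 0 -> is_weight mu v ->
  exists s : seq ({ffun 'I_n -> K} * V),
    (forall p, p \in s -> is_weight p.1 p.2) /\
    forall N : V -> Prop, subspace N -> (forall p, p \in s -> N p.2) ->
    forall w, N w.
Proof.
move=> irr v0 hv.
have [s [sW hs]] : exists s : seq ({ffun 'I_n -> K} * V),
    (forall p, p \in s -> is_weight p.1 p.2) /\
    forall N : V -> Prop, subspace N -> (forall p, p \in s -> N p.2) ->
    forall a, a \in enum 'I_m -> N (delta_mx a 0).
  elim: (enum 'I_m) => [|a t [s [sW hs]]]; first by exists [::].
  have [s' [sW' hs']] := weight_sum_total irr v0 hv (delta_mx a 0).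
  exists (s' ++ s); split=> [p|N hN sN b].
    by rewrite mem_cat => /orP[/sW'|/sW].
  rewrite inE => /orP[/eqP->|]; last first.
    by apply: hs => // p ps; apply: sN; rewrite mem_cat ps orbT.
  rewrite hs' big_seq; apply: subspace_sum => // p ps.
  by apply: sN; rewrite mem_cat ps.
exists s; split=> // N hN sN w; rewrite [w]matrix_sum_delta.
apply: subspace_sum => // a _; rewrite big_ord1; apply: subspaceZ => //.
by apply: hs => //; rewrite mem_enum.
Qed.

End Weights.

(** * Reduction of tensor fields to the model modules *)

Section PureTensorFields.
Context {K : fieldType} {n m : nat}.

Lemma tf_pure_linearl (v : 'cV[K]_m) :
  linear (fun g : {mpoly K[n]} => tf_pure g v : tfield K n m).
Proof.
move=> c g h; apply/ffunP => a; rewrite !ffunE scalerDr !scalerA.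
by rewrite [c * _]mulrC.
Qed.

Lemma tf_pure_linearr (g : {mpoly K[n]}) :
  linear (fun v : 'cV[K]_m => tf_pure g v : tfield K n m).
Proof.
by move=> c v w; apply/ffunP => a; rewrite !ffunE !mxE scalerDl scalerA.
Qed.

Lemma tf_pure_span (N : tfield K n m -> Prop) : subspace N ->
  (forall b v, N (tf_pure 'X_[b] v)) -> forall F, N F.
Proof.
move=> hN hX F.
have pureN g v : N (tf_pure g v).
  elim/(@mpoly_lin_ind K n): g => [c p q hp hq||b //].
    by rewrite tf_pure_linearl; case: hN => _; apply.
  by rewrite (linear_at0 (tf_pure_linearl v)); case: hN.
have -> : F = \sum_a tf_pure (F a) (delta_mx a 0).
  apply/ffunP => b; rewrite sum_ffunE (bigD1 b) //= ffunE !mxE !eqxx scale1r.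
  rewrite big1 ?addr0 // => a ab; rewrite ffunE !mxE eq_sym (negPf ab).
  by rewrite scale0r.
exact: subspace_sum.
Qed.

Variable rho : lieHom (gl K n) (gl K m).

Lemma tf_act_weight (mu : 'I_n -> K) (w : 'cV[K]_m) (X : vfield K n)
    (i : 'I_n) (D : nat) (e : K) (b : 'X_{1..n}) :
  is_weight rho mu w ->
  X = [ffun j => if j == i then e *: 'X_i ^+ D.+1 else 0] ->
  tf_act rho X (tf_pure 'X_[b] w)
  = (e * ((b i)%:R + D.+1%:R * mu i)) *: tf_pure 'X_[b + U_(i) *+ D] w.
Proof.
move=> hw ->; rewrite tf_act_pure.
rewrite (bigD1 i) //= [X in _ + X + _]big1 => [|j ji]; last first.
  by rewrite ffunE (negPf ji) mul0r (linear_at0 (tf_pure_linearl w)).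
rewrite addr0 ffunE eqxx.
rewrite (bigD1 i) //= [X in _ + (_ + X)]big1 => [|k ki]; last first.
  apply: big1 => j _; rewrite ffunE.
  have [->|ji] := eqVneq j i; last by rewrite mderiv0 mul0r (linear_at0 (tf_pure_linearl _)).
  rewrite mderivZ mderiv_exp mderiv_var eq_sym (negPf ki) mulr0 scaler0 mul0r.
  exact: linear_at0 (tf_pure_linearl _).
rewrite addr0 (bigD1 i) //= [X in _ + (_ + X)]big1 => [|j ji]; last first.
  by rewrite ffunE (negPf ji) mderiv0 mul0r (linear_at0 (tf_pure_linearl _)).
rewrite addr0 ffunE eqxx hw mderivZ mderiv_exp mderiv_var eqxx mulr1 /=.
have -> : e *: 'X_i ^+ D.+1 * mderiv i 'X_[b] = (e * (b i)%:R) *: 'X_[b + U_(i) *+ D] :> {mpoly K[n]}.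
  rewrite exprSr -scalerAl -mulrA -/(theta i 'X_[b]) thetaX -scalerAr scalerA.
  by congr (_ *: _); rewrite mulrC mpolyXn -mpolyXD.
have -> : e *: ('X_i ^+ D *+ D.+1) * 'X_[b] = (e * D.+1%:R) *: 'X_[b + U_(i) *+ D] :> {mpoly K[n]}.
  rewrite -scaler_nat scalerA -scalerAl; congr (_ *: _).
  by rewrite mulrC mpolyXn -mpolyXD.
have Zl c g : tf_pure (c *: g) w = c *: tf_pure g w :> tfield K n m.
  by have := tf_pure_linearl w c g 0; rewrite (linear_at0 (tf_pure_linearl w)) !addr0.
have Zr c g : tf_pure g (c *: w) = c *: tf_pure g w :> tfield K n m.
  by have := tf_pure_linearr g c w 0; rewrite (linear_at0 (tf_pure_linearr g)) !addr0.
by rewrite Zr !Zl !scalerA -scalerDl; congr (_ *: _); ring.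
Qed.

End PureTensorFields.

Lemma tensor_span {K : fieldType} (r : nat) (M : 'I_r -> lmodType K)
    (G : forall s, M s -> Prop) (N : tensor M -> Prop) : subspace N ->
  (forall s (N' : M s -> Prop), subspace N' -> (forall x, G s x -> N' x) -> forall x, N' x) ->
  (forall t : tprod M, (forall s, G s (t s)) -> N (tens t)) -> forall u, N u.
Proof.
move=> hN hG hNt; have [N0 Nl] := hN.
suff h (ss : seq 'I_r) : forall t : tprod M,
    (forall s, s \notin ss -> G s (t s)) -> N (tens t).
  by apply: tensor_ind => // t; apply: (h (enum 'I_r)) => s; rewrite mem_enum.
elim: ss => [|s ss IHss] t ht; first by apply: hNt => s; apply: ht.
rewrite -(upd_id t s); move: (t s) => x.
apply: (hG s (fun x => N (tens (upd t x)))) => [|y Gy].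
  split=> [|c y z hy hz]; last by rewrite tens_lin; exact: Nl.
  have := tens_lin t (-1) (0 : M s) 0; rewrite scaler0 addr0 scaleN1r addNr => ->.
  exact: N0.
apply: IHss => k kss; have [<-|sk] := eqVneq s k; first by rewrite upd_in.
by rewrite upd_out //; apply: ht; rewrite inE negb_or eq_sym sk.
Qed.

Section TensorReduction.
Context {K : fieldType}.
Variables (n r d : nat) (charK0 : [pchar K] =i pred0) (d_gt0 : (0 < d)%N).
Variables (m : 'I_r -> nat) (rho : forall s, lieHom (gl K n) (gl K (m s))).
Local Notation TM := (tensor (fun s : 'I_r => tfield K n (m s))).
Local Notation T := (tensor_action (fun s => tf_action (rho s))).
Local Notation A := (lie_restrict (L1_embedding n charK0 d_gt0)
  (lie_restrict (Ld_incl K n d) T)).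

Definition actT (jk : 'I_n * nat) : TM -> TM :=
  A (L1_inj jk.1 (L1_e K jk.2.+1)).

Variables (k0 : nat) (wt : forall s, 'I_k0 -> {ffun 'I_n -> K} * 'cV[K]_(m s)).
Hypothesis wtP : forall s i, is_weight (rho s) (wt s i).1 (wt s i).2.
Hypothesis wt_span : forall s (N : 'cV[K]_(m s) -> Prop), subspace N ->
  (forall i, N (wt s i).2) -> forall w, N w.

Definition ivar := ('I_r * 'I_n)%type.
Definition nvar := #|{: ivar}|.
Definition component :=
  ({ffun 'I_r -> 'I_k0} * {ffun ivar -> 'I_d})%type.
Implicit Types (z : component) (a : 'X_{1..nvar}).

Definition vcol (v : 'I_nvar) : 'I_n := (enum_val v).2.
(** With b = d a + residue, the scalar (b + (dk + 1) mu) / d of [tf_act_weight] is a + (residue +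
    mu) / d + k mu; this gives alpha and beta. *)
Definition valpha z (v : 'I_nvar) : K :=
  d%:R^-1 * ((z.2 (enum_val v))%:R + (wt (enum_val v).1 (z.1 (enum_val v).1)).1 (enum_val v).2).
Definition vbeta z (v : 'I_nvar) : K :=
  (wt (enum_val v).1 (z.1 (enum_val v).1)).1 (enum_val v).2.

Definition expo z a (s : 'I_r) : 'X_{1..n} :=
  [multinom (d * a (enum_rank (s, i)) + z.2 (s, i))%N | i < n].
Definition tuple_of z a : tprod (fun s : 'I_r => tfield K n (m s)) :=
  [ffun s => tf_pure 'X_[expo z a s] (wt s (z.1 s)).2].
Definition comp_map z : {mpoly K[nvar]} -> TM :=
  lin_ext (fun a => tens (tuple_of z a)).

Lemma actT_linear jk : linear (actT jk).
Proof. exact: act_linearr. Qed.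

Lemma actT_tens jk t : actT jk (tens t) = \sum_s tens (upd t
  (tf_act (rho s) [ffun j => if j == jk.1
     then d%:R^-1 *: 'X_jk.1 ^+ (d * jk.2.+1).+1 else 0] (t s))).
Proof.
transitivity (tensor_act (fun s => tf_action (rho s))
    (Ld_val (L1_embedding n charK0 d_gt0 (L1_inj jk.1 (L1_e K jk.2.+1)))) (tens t)).
  by [].
by rewrite tensor_act_tens L1_embeddingE.
Qed.

Lemma comp_map_eq z jk p :
  comp_map z (opE vcol (valpha z) (vbeta z) jk p) = actT jk (comp_map z p).
Proof.
have cl : linear (comp_map z) := lin_ext_linear _.
have d0 : d%:R != 0 :> K := d_neq0 charK0 d_gt0.
elim/(@mpoly_lin_ind K nvar): p => [c p q hp hq||a].
- by rewrite opE_linear !cl actT_linear hp hq.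
- by rewrite (linear_at0 (opE_linear _ _ _ _)) (linear_at0 cl) (linear_at0 (actT_linear jk)).
have clX b : comp_map z 'X_[b] = tens (tuple_of z b) := lin_extX _ b.
rewrite clX actT_tens opEX.
have cls (I : finType) (P : pred I) (x : I -> K) (g : I -> {mpoly K[nvar]}) :
    comp_map z (\sum_(i | P i) x i *: g i) = \sum_(i | P i) x i *: comp_map z (g i).
  elim: (index_enum I) => [|i t IHt]; first by rewrite !big_nil (linear_at0 cl).
  by rewrite !big_cons; case: (P i); rewrite ?cl IHt.
(* Leibniz sums over the tensor factors, [opE] over the variables of colour [jk.1]: there is one
   such variable per factor. *)
rewrite cls (reindex_onto (fun s : 'I_r => enum_rank (s, jk.1))
  (fun v => (enum_val v).1)) /=; last first.
  move=> v /eqP; rewrite /vcol => vj; rewrite -[RHS]enum_valK; congr enum_rank.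
  by rewrite -vj -surjective_pairing.
apply: eq_big => [s|s _]; first by rewrite /vcol enum_rankK !eqxx.
rewrite clX /valpha /vbeta enum_rankK /= {1}/tuple_of ffunE.
rewrite (tf_act_weight _ (wtP s (z.1 s)) erefl).
have tensZ (t : tprod (fun s : 'I_r => tfield K n (m s))) x (y : tfield K n (m s)) :
    tens (upd t (x *: y)) = x *: tens (upd t y).
  have e0 : tens (upd t (0 : tfield K n (m s))) = 0.
    by have := tens_lin t (-1) (0 : tfield K n (m s)) 0;
      rewrite scaler0 addr0 scaleN1r addNr.
  by have := tens_lin t x y 0; rewrite e0 !addr0.
rewrite tensZ; congr (_ *: tens _).
  rewrite mnmE natrD -[(d * _).+1%:R]natr1 !natrM.
  by field.
apply/ffunP => k; rewrite ffunE.
have [<-|sk] := eqVneq s k.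
  rewrite upd_in; congr (tf_pure 'X_[_] _); apply/mnmP => i.
  rewrite !(mnmDE, mulmnE, mnm1E, mnmE) (inj_eq enum_rank_inj) xpair_eqE eqxx /=.
  by rewrite mulnDr addnAC; case: (eqVneq jk.1 i) => _; rewrite ?mul1n ?mul0n ?muln0.
rewrite upd_out // ffunE; congr (tf_pure 'X_[_] _); apply/mnmP => i.
rewrite !(mnmDE, mulmnE, mnm1E, mnmE) (inj_eq enum_rank_inj) xpair_eqE (negPf sk).
by rewrite mul0n addn0.
Qed.

Lemma comp_span (N : TM -> Prop) : subspace N ->
  (forall z p, N (comp_map z p)) -> forall u, N u.
Proof.
move=> hN hz.
apply: (@tensor_span K r _ (fun s x => exists bi : 'X_{1..n} * 'I_k0,
  x = tf_pure 'X_[bi.1] (wt s bi.2).2)) => //.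
  move=> s N' hN' hx; apply: tf_pure_span => // b.
  apply: wt_span => [|i]; last by apply: hx; exists (b, i).
  split=> [|c v w hv hw]; last by rewrite tf_pure_linearr; case: hN' => _; apply.
  by rewrite (linear_at0 (tf_pure_linearr _)); case: hN'.
move=> t /fin_all_exists[f hf].
pose z : component := ([ffun s => (f s).2],
  [ffun si => Ordinal (ltn_pmod ((f si.1).1 si.2) d_gt0)]).
pose a : 'X_{1..nvar} :=
  [multinom ((f (enum_val v).1).1 (enum_val v).2 %/ d)%N | v < nvar].
suff -> : t = tuple_of z a.
  by rewrite -[tens _](lin_extX (fun a => tens (tuple_of z a))); exact: hz.
apply/ffunP => s; rewrite hf !ffunE; congr (tf_pure 'X_[_] _); apply/mnmP => i.
by rewrite !mnmE ffunE enum_rankK /= mulnC -divn_eq.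
Qed.

Hypothesis charK0' : forall k, k.+1%:R != 0 :> K.

Lemma noeth_tensor : noeth actT whole null.
Proof.
have cl z : linear (comp_map z) := lin_ext_linear _.
pose F' z := opE vcol (valpha z) (vbeta z).
have hF z : noeth (F' z) whole null by exact: noeth_model.
have h := @noeth_sum_images K TM {mpoly K[nvar]} _ _ actT F' comp_map actT_linear
  cl comp_map_eq hF.
apply: (noeth_mono _ _ (h (enum {: component}))) => // u _.
apply: comp_span => [|z p].
  by have [] := sum_images_stable actT_linear cl comp_map_eq (enum {: component}).
apply: (sum_images_mem actT_linear cl comp_map_eq).
by rewrite mem_enum.
Qed.

End TensorReduction.

Theorem theorem2p3p3 (K : fieldType) (charK0 : [pchar K] =i pred0)
    (n r d : nat) (n_gt0 : (1 <= n)%N) (r_gt0 : (1 <= r)%N) (d_gt0 : (1 <= d)%N)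
    (lam : 'I_r -> 'I_n -> int) (lam_dom : forall s, dominant (lam s))
    (m : 'I_r -> nat) (rho : forall s : 'I_r, lieHom (gl K n) (gl K (m s)))
    (rhoV : forall s, is_V (lam s) (rho s)) :
  let T : lieAction (vfield K n) (tensor (fun s : 'I_r => tfield K n (m s))) :=
    tensor_action (fun s => tf_action (rho s)) in
  lie_noetherian
    (lie_restrict (L1_embedding n charK0 d_gt0) (lie_restrict (Ld_incl K n d) T))
  /\ lie_noetherian (lie_restrict (Ld_incl K n d) T).
Proof.
move=> T.
have natr_neq0 k : k.+1%:R != 0 :> K by rewrite ((pcharf0P K).1 charK0).
have gens s : exists ws : seq ({ffun 'I_n -> K} * 'cV[K]_(m s)),
    (forall p, p \in ws -> is_weight (rho s) p.1 p.2) /\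
    forall N : 'cV[K]_(m s) -> Prop, subspace N ->
      (forall p, p \in ws -> N p.2) -> forall w, N w.
  have [irr [v [v0 _ hv]]] := rhoV s.
  exact: weight_gens irr v0 hv.
have [ws hws] := fin_all_exists gens.
pose k0 := \max_s size (ws s).
pose wt s (i : 'I_k0) := nth (0, 0) (ws s) i.
have wtP s i : is_weight (rho s) (wt s i).1 (wt s i).2.
  have [hi|hi] := ltnP i (size (ws s)).
    by have [h _] := hws s; apply: h; exact: mem_nth.
  (* Padding the lists to a common length uses the zero vector, which satisfies [is_weight] for
     every weight. *)
  rewrite /wt nth_default //= => j.
  by rewrite (linear_at0 (act_linearr _ _)) scaler0.
have wt_span s (N : 'cV[K]_(m s) -> Prop) : subspace N ->
    (forall i, N (wt s i).2) -> forall w, N w.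
  move=> hN hi; have [_ h] := hws s; apply: h => // p /(nthP (0, 0))[i si <-].
  have ik : (i < k0)%N by apply: leq_trans si (leq_bigmax s).
  exact: hi (Ordinal ik).
have nT : noeth (actT charK0 d_gt0 rho) whole null.
  exact: noeth_tensor wtP wt_span natr_neq0.
have fg := noeth_fg nT.
(* A submodule for more operators is one for fewer, so finite generation under the e_k alone gives
   it for the direct sum of copies of L_1, and then for L_d. *)
have sub N : lie_submodule (lie_restrict (L1_embedding n charK0 d_gt0)
    (lie_restrict (Ld_incl K n d) T)) N -> stable (actT charK0 d_gt0 rho) N.
  by case=> N0 Nl NT; split=> // jk u Nu; apply: NT.
split=> N hN.
  have [s [sN hs]] := fg N (sub N hN).
  by exists s; split=> // N' /sub; exact: hs.
have sub' N0 : lie_submodule (lie_restrict (Ld_incl K n d) T) N0 ->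
    lie_submodule (lie_restrict (L1_embedding n charK0 d_gt0)
      (lie_restrict (Ld_incl K n d) T)) N0.
  by case=> h0 hl hT; split=> // x u Nu; apply: hT.
have [s [sN hs]] := fg N (sub N (sub' N hN)).
by exists s; split=> // N' /sub'/sub; exact: hs.
Qed.
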